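(* Let $d\ge 1$, $0<\sigma\le 1$, $r\ge 0$, $p\ge 2$, $L\ge 1$ and $0\le\tau\le 1$. There exists a universal constant $C>0$ such that the following hold for all $n\in\mathbb{N}$ and all $z\ge 0$. (i) For all $\mu,\nu\in\mathcal{P}(\mathbb{B}_d(r))$, if $X_1,\dots,X_n$ are i.i.d. $\sim\mu$ and $Y_1,\dots,Y_n$ are i.i.d. $\sim\nu$ (on a common probability space), $\hat\mu_n=\frac1n\sum_i\delta_{X_i}$, $\hat\nu_n=\frac1n\sum_i\delta_{Y_i}$, then $$\mathbb{P}\Big(\big|\mathsf{D}_{\mathsf{KL}}(\hat\mu_n*\gamma_\sigma\|\hat\nu_n*\gamma_\sigma)-\mathsf{D}_{\mathsf{KL}}(\mu*\gamma_\sigma\|\nu*\gamma_\sigma)\big|\ge C\,\xi_{r,d,\sigma}\big(\tilde\xi_{r,d,\sigma}n^{-1/2}+z\big)\Big)\le 2e^{-(nz^2\wedge nz)},$$ where $\xi_{r,d,\sigma}:=\exp\!\Big(\frac{(r^2+4r)(2dr^2+(8d+1)r+1)}{2\sigma^2}\Big)$ and $\tilde\xi_{r,d,\sigma}:=(3ed)^{3(d+2)}(r+1)^{\frac d2+1}\sigma^{-\frac d2}$. (ii) For all $\mu,\nu\in\mathsf{SG}(L)$ such that $X\sim\mu$ satisfies $\|X\|_{\psi_p}\le L$, if $X_1,\dots,X_n$ are i.i.d. $\sim\mu$ and $\hat\mu_n=\frac1n\sum_i\delta_{X_i}$, then $$\mathbb{P}\Big(\big|\mathsf{D}_{\mathsf{KL}}(\hat\mu_n*\gamma_\sigma\|\nu*\gamma_\sigma)-\mathsf{D}_{\mathsf{KL}}(\mu*\gamma_\sigma\|\nu*\gamma_\sigma)\big|\ge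 C\,\check\xi_{d,L,\sigma}\big(\hat\xi_{d,L,\sigma}n^{-\frac12(1-\tau)}+z\big)\Big)\le 3e^{-\hat\zeta_{n,d,p,\tau}(z)},$$ where $\hat\xi_{d,L,\sigma}:=(3ed)^{3(d+2)}(4L)^{\frac d2+2}\sigma^{-\frac d2}$, $\check\xi_{d,L,\sigma}:=L^4d^3\sigma^{-4}$, and $$\hat\zeta_{n,d,p,\tau}(z):=n^{\frac{d+12-8\tau}{d+12}}z^2\wedge n^{\frac{d+12-4\tau}{d+12}}z\wedge\frac{n^{\frac{p\tau}{d+12}}}{\log(n+1)}.$$
   Context: $\gamma_\sigma=N(0,\sigma^2I_d)$ is the centered Gaussian on $\mathbb{R}^d$ with covariance $\sigma^2I_d$; $*$ denotes convolution. $\mathbb{B}_d(r)=\{x\in\mathbb{R}^d:\|x\|_2\le r\}$ and $\mathcal{P}(\mathbb{B}_d(r))$ is the set of Borel probability measures on $\mathbb{R}^d$ with support contained in $\mathbb{B}_d(r)$. For Borel probability measures $\mu,\nu$, $\mathsf{D}_{\mathsf{KL}}(\mu\|\nu)=\int p_\mu\log(p_\mu/p_\nu)\,d\rho$ if $\mu\ll\nu$ (densities w.r.t. any dominating $\sigma$-finite $\rho$) and $+\infty$ otherwise. A distribution $\mu$ on $\mathbb{R}^d$ is $s^2$-sub-Gaussian if $X\sim\mu$ satisfies $\mathbb{E}[e^{u\cdot(X-\mathbb{E}X)}]\le e^{s^2\|u\|^2/2}$ for all $u\in\mathbb{R}^d$; $\mathsf{SG}(L)$ is the set of $s^2$-sub-Gaussian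 distributions with $s^2\vee\|\mathbb{E}[X]\|\le L$. For $p\ge1$, $\psi_p(x)=e^{x^p}-1$ and $\|X\|_{\psi_p}=\inf\{c>0:\mathbb{E}[\psi_p(\|X\|/c)]\le1\}$. $a\wedge b=\min\{a,b\}$. *)

(* Defs.v *)
From HB Require Import structures.
From mathcomp Require Import all_boot all_order all_algebra.
From mathcomp Require Import all_classical all_reals all_analysis.
Set Implicit Arguments. Unset Strict Implicit. Unset Printing Implicit Defensive.
Import Order.TTheory GRing.Theory Num.Theory.
Import numFieldNormedType.Exports.
Local Open Scope classical_set_scope.
Local Open Scope ring_scope.

(* R^d is modelled by d.-tuple R with its product (= Borel) sigma-algebra. *)
Section Defs.
Context {R : realType}.

Definition vsub d (y x : d.-tuple R) : d.-tuple R := [tuple tnth y i - tnth x i | i < d].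
Definition vdot d (u x : d.-tuple R) : R := \sum_(i < d) tnth u i * tnth x i.
Definition vnorm d (x : d.-tuple R) : R := Num.sqrt (\sum_(i < d) tnth x i ^+ 2).

(* Lebesgue measure on R^d, characterised by its value on closed boxes
   (this determines it uniquely on the Borel sigma-algebra). *)
Definition is_lebesgue_Rd d (lam : {measure set (d.-tuple R) -> \bar R}) : Prop :=
  forall a b : d.-tuple R, (forall i, tnth a i <= tnth b i) ->
    lam [set x | forall i, tnth a i <= tnth x i <= tnth b i]
    = (\prod_(i < d) (tnth b i - tnth a i))%:E.

Definition gauss_dens d (sigma : R) (u : d.-tuple R) : R :=
  (Num.sqrt (2 * pi * sigma ^+ 2)) ^- d * expR (- (vnorm u ^+ 2) / (2 * sigma ^+ 2)).

Definition conv_gauss_dens d (sigma : R) (mu : set (d.-tuple R) -> \bar R)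
    (y : d.-tuple R) : R :=
  fine (\int[mu]_x (gauss_dens sigma (vsub y x))%:E)%E.

(* KL divergence of P = p.rho w.r.t. Q = q.rho (rho a dominating measure,
   p, q densities):  +oo unless P << Q, i.e. rho{p > 0, q = 0} = 0 *)
Definition kl_integrand (a b : R) : R := if a == 0 then 0 else a * ln (a / b).

Definition KL_dens dT (T : measurableType dT) (rho : {measure set T -> \bar R})
    (p q : T -> R) : \bar R :=
  if `[< {ae rho, forall x, q x = 0 -> p x = 0} >]
  then (\int[rho]_x (kl_integrand (p x) (q x))%:E)%E
  else +oo%E.

Definition KL_gauss d (lam : {measure set (d.-tuple R) -> \bar R}) (sigma : R)
    (mu nu : set (d.-tuple R) -> \bar R) : \bar R :=
  KL_dens lam (conv_gauss_dens sigma mu) (conv_gauss_dens sigma nu).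

Definition empirical d n (x : 'I_n -> d.-tuple R) : set (d.-tuple R) -> \bar R :=
  fun A => (((n%:R)^-1)%:E * \sum_(i < n) \d_(x i) A)%E.

Definition supp_in_ball d (r : R) (mu : probability (d.-tuple R) R) : Prop :=
  mu [set x | r < vnorm x] = 0%E.

Definition iid dO (Omega : measurableType dO) (P : probability Omega R) d n
    (X : 'I_n -> Omega -> d.-tuple R) (mu : probability (d.-tuple R) R) : Prop :=
  (forall i, measurable_fun setT (X i)) /\
  (forall i A, measurable A -> P (X i @^-1` A) = mu A) /\
  (forall A : 'I_n -> set (d.-tuple R), (forall i, measurable (A i)) ->
     P (\bigcap_(i in [set: 'I_n]) (X i @^-1` A i)) = (\prod_(i < n) P (X i @^-1` A i))%E).

Definition mean_vec d (mu : probability (d.-tuple R) R) : d.-tuple R :=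
  [tuple (\int[mu]_x tnth x i)%R | i < d].

Definition sub_gaussian d (s2 : R) (mu : probability (d.-tuple R) R) : Prop :=
  (forall i : 'I_d, mu.-integrable setT (fun x => (tnth x i)%:E)) /\
  forall u : d.-tuple R,
    (\int[mu]_x (expR (vdot u (vsub x (mean_vec mu))))%:E
       <= (expR (s2 * vnorm u ^+ 2 / 2))%:E)%E.

Definition SG d (L : R) (mu : probability (d.-tuple R) R) : Prop :=
  exists s2 : R, 0 <= s2 /\ sub_gaussian s2 mu /\ Num.max s2 (vnorm (mean_vec mu)) <= L.

Definition psi_norm d (p : R) (mu : probability (d.-tuple R) R) : \bar R :=
  ereal_inf [set c%:E | c in [set c : R | 0 < c /\
     (\int[mu]_x (expR ((vnorm x / c) `^ p) - 1)%:E <= 1)%E]].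

(* outer probability bound: the event is contained in a measurable set of
   probability at most b *)
Definition prob_le dO (Omega : measurableType dO) (P : probability Omega R)
    (E : set Omega) (b : R) : Prop :=
  exists A, measurable A /\ E `<=` A /\ (P A <= b%:E)%E.

End Defs.

(* Main.v *)
Require Import Defs.
From HB Require Import structures.
From mathcomp Require Import all_boot all_order all_algebra.
From mathcomp Require Import all_classical all_reals all_analysis.
From mathcomp Require Import measurable_realfun.
From mathcomp Require Import ring lra.
Set SsrOldRewriteGoalsOrder.
Set Implicit Arguments. Unset Strict Implicit. Unset Printing Implicit Defensive.
Import Order.TTheory GRing.Theory Num.Theory.
Import numFieldNormedType.Exports.
Local Open Scope classical_set_scope.
Local Open Scope ring_scope.

(* The KL integrand is Lipschitz in both densities with a locally explicit
   constant, so |KL^ - KL| is at most the weighted distance  int w |p^ - p|,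
   with w = 3 exp((4 r |y| + r^2) / (2 sigma^2)) on a ball of radius r (where
   both densities lie between m(y) and (w(y) / 3) m(y)), and w quadratic in |y|
   in the sub-Gaussian case (where the logarithm of every density involved is
   bounded by a quadratic, by Jensen).  The weighted distance is a function of
   the independent X_i, each of which moves it by at most
   N(X_i) / n + E N(X_i) / n, where N(x) = int w k(x, .) has an exponential
   moment.  Its mean is O(n^(-1/2)), by Cauchy-Schwarz against a Gaussian
   weight and the variance of p^(y); its exponential moment around the mean is
   controlled one coordinate at a time, and Chernoff's bound gives the
   two-regime tail exp(- n min(z^2, z)). *)

(** * Iterated integrals against a product law *)

(** In the sub-Gaussian case the smoothed empirical density has no deterministic lower bound, since
    the sample may lie far from [y]. The stability estimate for a moving first argument is therefore
    one-sided: it asks only for an upper bound on the logarithm of the new density, and the Gaussian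
    peak provides one. In the ball case both arguments move, but all four densities are pinched
    between deterministic bounds. The influence [N] of one observation is unbounded in the
    sub-Gaussian case, so differences are controlled through an exponential moment of [N] instead of
    a supremum. This only tolerates a Chernoff parameter of at most 1 / (2 K), and that cap is the
    origin of the linear regime of the tail. Everything is integrated as nonnegative functions:
    terms are moved across inequalities until no subtraction is left, so Tonelli's theorem and
    additivity apply without integrability side conditions. Both parts are obtained with the rate
    n^(-1/2); the exponents in [tau] follow from n >= 1 at the very end. *)

Section iterated_integral.
Context {R : realType} {dT : measure_display} {T : measurableType dT}.
Variable mu : {sigma_finite_measure set T -> \bar R}.

(** Stands in for integration against the [n]-fold power of [mu], head coordinate outermost, so that
    statements on tuples go by induction on the length. Sigma-finiteness is the common ground of its
    two uses, the law of a sample point and Lebesgue measure on the line. *)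
Fixpoint iterint (n : nat) : (n.-tuple T -> \bar R) -> \bar R :=
  match n with
  | 0 => fun F => F [tuple]
  | k.+1 => fun F => (\int[mu]_x iterint (fun s => F [tuple of x :: s]))%E
  end.

Lemma iterint_ge0 n (F : n.-tuple T -> \bar R) :
  (forall s, 0 <= F s)%E -> (0 <= iterint F)%E.
Proof.
elim: n F => [|n IH] F F0 //=.
by apply: integral_ge0 => x _; apply: IH => s.
Qed.

(** The parameter space is arbitrary because the induction moves the head coordinate into it: the
    induction hypothesis is used at [X * T]. *)
Lemma measurable_iterint n dX (X : measurableType dX)
    (F : X * n.-tuple T -> \bar R) :
  (forall z, 0 <= F z)%E -> measurable_fun setT F ->
  measurable_fun setT (fun x => iterint (fun s => F (x, s))).
Proof.
elim: n dX X F => [|n IH] dX X F F0 mF /=.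
  apply: (@measurableT_comp _ _ _ _ _ _ F _ (fun x => (x, [tuple]))) => //.
pose G (z : (X * T) * n.-tuple T) := F (z.1.1, [tuple of z.1.2 :: z.2]).
have mG : measurable_fun setT G.
  apply: (measurableT_comp mF); apply: measurable_fun_pair => /=.
    exact: (measurableT_comp measurable_fst measurable_fst).
  apply: measurable_cons; last exact: measurable_snd.
  exact: (measurableT_comp measurable_snd measurable_fst).
have := IH _ _ G (fun z => F0 _) mG.
move=> mI.
apply: (@measurable_fun_fubini_tonelli_F _ _ _ _ _ mu
  (fun z => iterint (fun s => G (z, s)))) => //.
by move=> z; apply: iterint_ge0 => s; exact: F0.
Qed.

Lemma eq_iterint n (F G : n.-tuple T -> \bar R) : F =1 G -> iterint F = iterint G.
Proof. by move=> FG; congr iterint; apply/funext. Qed.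

Lemma measurable_iterint_cons n (F : n.+1.-tuple T -> \bar R) :
  (forall z, 0 <= F z)%E -> measurable_fun setT F ->
  measurable_fun setT (fun x => iterint (fun s => F [tuple of x :: s])).
Proof.
move=> F0 mF.
apply: (@measurable_iterint _ _ _ (fun z => F [tuple of z.1 :: z.2])) => //.
by apply: (measurableT_comp mF); apply: measurable_cons.
Qed.

Lemma measurable_consl n (F : n.+1.-tuple T -> \bar R) x :
  measurable_fun setT F -> measurable_fun setT (fun s : n.-tuple T => F [tuple of x :: s]).
Proof. by move=> mF; apply: (measurableT_comp mF); apply: measurable_cons. Qed.

(** The measure is the push-forward of [mu \x m] along cons, a measurable bijection with measurable
    inverse [psi]. It serves as the reference measure in [tuple_tonelli]. *)
Lemma exists_tuple_power n : exists m : {sigma_finite_measure set (n.-tuple T) -> \bar R},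
  forall F : n.-tuple T -> \bar R, (forall s, 0 <= F s)%E ->
    measurable_fun setT F -> (\int[m]_s F s)%E = iterint F.
Proof.
elim: n => [|n [m IH]].
  exists (dirac [tuple] : {sigma_finite_measure set _ -> \bar R}) => F F0 mF /=.
  by rewrite integral_dirac// diracT mul1e.
pose phi (z : T * n.-tuple T) : n.+1.-tuple T := [tuple of z.1 :: z.2].
have mphi : measurable_fun setT phi by apply: measurable_cons.
pose psi (s : n.+1.-tuple T) : T * n.-tuple T := (thead s, [tuple of behead s]).
have mpsi : measurable_fun setT psi.
  apply: measurable_fun_pair; first exact: measurable_tnth.
  exact: measurable_behead.
have phiK z : psi (phi z) = z by case: z => x s; congr pair; apply: val_inj.
have psiK s : phi (psi s) = s by rewrite /phi/psi/=; apply/esym/tuple_eta.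
pose m' := pushforward (mu \x m)%E phi.
pose m1 : {measure set (n.+1.-tuple T) -> \bar R} :=
  measure_function_pushforward__canonical__measure_function_Measure (mu \x m)%E mphi.
have sfin : sigma_finite setT m'.
  have /sigma_finiteP[F [TF ndF Foo]] := sigma_finiteT mu.
  have /sigma_finiteP[G [TG ndG Goo]] := sigma_finiteT m.
  have mFG k : measurable (F k `*` G k).
    by have [? _] := Foo k; have [? _] := Goo k; exact: measurableX.
  exists (fun k => psi @^-1` (F k `*` G k)) => /=.
    apply/seteqP; split => // s _.
    have [k _ Fk] : (\bigcup_k F k) (thead s) by rewrite -TF.
    have [l _ Gl] : (\bigcup_k G k) [tuple of behead s] by rewrite -TG.
    exists (maxn k l) => //; split => /=.
      by move: Fk; exact/subsetPset/ndF/leq_maxl.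
    by move: Gl; exact/subsetPset/ndG/leq_maxr.
  move=> k; have [mFk Fk] := Foo k; have [mGk Gk] := Goo k; split.
    by rewrite -[X in measurable X]setTI; exact: mpsi.
  rewrite /m' /pushforward (_ : phi @^-1` _ = F k `*` G k); last first.
    by rewrite -comp_preimage (_ : psi \o phi = id) ?preimage_id//; exact/funext.
  by rewrite product_measure1E// lte_mul_pinfty// ge0_fin_numE.
pose m2 : {sigma_finite_measure set (n.+1.-tuple T) -> \bar R} :=
  HB.pack m' (Measure.class m1) (Measure_isSigmaFinite.Build _ _ _ m1 sfin).
exists (m2 mphi) => F F0 mF /=; move: @m2 => _.
rewrite (_ : (\int[pushforward (mu \x m) phi]_s F s)%E = (\int[mu \x m]_z (F \o phi) z)%E); last first.
  by rewrite ge0_integral_pushforward ?preimage_setT.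
rewrite fubini_tonelli1; last 2 first.
- exact: measurableT_comp.
- by move=> z; exact: F0.
apply: eq_integral => x _; rewrite /fubini_F -IH//.
exact: measurable_consl.
Qed.

Definition rect n (A : 'I_n -> set T) : set (n.-tuple T) :=
  [set s | forall i, A i (tnth s i)].

Lemma measurable_rect n (A : 'I_n -> set T) :
  (forall i, measurable (A i)) -> measurable (rect A).
Proof.
move=> mA; rewrite (_ : rect A = \bigcap_(i in [set: 'I_n]) ((@tnth n T)^~ i @^-1` A i)).
  apply: fin_bigcap_measurable => // i _.
  by rewrite -[X in measurable X]setTI; apply: measurable_tnth.
by apply/seteqP; split => s /= sA i; [move=> _|]; exact: sA.
Qed.

Lemma le_iterint n (F G : n.-tuple T -> \bar R) :
  (forall s, 0 <= F s)%E -> measurable_fun setT F ->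
  (forall s, 0 <= G s)%E -> measurable_fun setT G ->
  (forall s, F s <= G s)%E -> (iterint F <= iterint G)%E.
Proof.
elim: n F G => [|n IH] F G F0 mF G0 mG FG //=.
apply: ge0_le_integral => //.
- by move=> x _; exact: iterint_ge0.
- exact: measurable_iterint_cons.
- exact: measurable_iterint_cons.
- by move=> x _; apply: IH => //; exact: measurable_consl.
Qed.

Lemma iterintZl n (k : \bar R) (F : n.-tuple T -> \bar R) :
  (0 <= k)%E -> (forall s, 0 <= F s)%E -> measurable_fun setT F ->
  iterint (fun s => k * F s)%E = (k * iterint F)%E.
Proof.
move=> k0; elim: n F => [|n IH] F F0 mF //=.
rewrite -ge0_integralZl//; last 2 first.
- exact: measurable_iterint_cons.
- by move=> x _; exact: iterint_ge0.
apply: eq_integral => x _; apply: IH => //; exact: measurable_consl.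
Qed.

Lemma measurable_tuple_prod n (g : 'I_n -> T -> R) :
  (forall i, measurable_fun setT (g i)) ->
  measurable_fun setT (fun s : n.-tuple T => (\prod_(i < n) g i (tnth s i))).
Proof.
move=> mg; apply: measurable_prod => i _.
exact: (measurableT_comp (mg i) (measurable_tnth i)).
Qed.

Lemma iterint_prod n (g : 'I_n -> T -> R) :
  (forall i x, 0 <= g i x) -> (forall i, measurable_fun setT (g i)) ->
  iterint (fun s => (\prod_(i < n) g i (tnth s i))%:E) =
  (\prod_(i < n) \int[mu]_x (g i x)%:E)%E.
Proof.
elim: n g => [|n IH] g g0 mg /=; first by rewrite !big_ord0.
rewrite big_ord_recl/=.
have mP := measurable_tuple_prod (fun i => mg (lift ord0 i)).
under eq_integral => x _.
  rewrite (@eq_iterint _ _ (fun s => (g ord0 x)%:E * (\prod_(i < n) g (lift ord0 i) (tnth s i))%:E)%E); last first.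
    move=> s; rewrite big_ord_recl tnth0 EFinM; congr (_ * (_)%:E)%E.
    by apply: eq_bigr => i _; rewrite tnthS.
  rewrite iterintZl ?lee_fin//; last 2 first.
  - by move=> s; rewrite lee_fin prodr_ge0.
  - exact/measurable_EFinP.
  rewrite (IH (fun i => g (lift ord0 i)))// muleC.
  over.
rewrite /= ge0_integralZl//; last 3 first.
- exact/measurable_EFinP.
- by move=> x _; rewrite lee_fin.
- by apply: prode_ge0 => i _; apply: integral_ge0 => x _; rewrite lee_fin.
by rewrite muleC.
Qed.

Section generated.
Variables (G : set (set T)) (D : (set T)^nat).
Hypotheses (mG : measurable = <<s G >>) (GI : setI_closed G).
Hypotheses (GD : forall k, G (D k)) (ndD : forall k l, (k <= l)%N -> D k `<=` D l).
Hypothesis (DT : \bigcup_k D k = setT).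

Definition rects n : set (set (n.-tuple T)) :=
  [set rect A | A in [set A | forall i, G (A i)]].

Lemma measurable_rects n : @measurable _ (n.-tuple T) = <<s @rects n >>.
Proof.
apply/seteqP; split.
  have : measurable_fun setT (fun x : g_sigma_algebraType (@rects n) => x : n.-tuple T).
    apply/measurable_fun_tnthP => i /=.
    apply: (@measurability _ _ _ _ setT _ G mG).
    move=> _ [B GB <-]; rewrite setTI.
    (* The whole space need not belong to [G], so the free coordinates run through the exhausting
       sequence [D]. Finitely many coordinates share a common index because [D] is nondecreasing. *)
    rewrite (_ : _ @^-1` _ = \bigcup_k rect (fun j => if j == i then B else D k)).
      apply: bigcupT_measurable => k; apply: sub_sigma_algebra.
      by exists (fun j => if j == i then B else D k) => //= j; case: ifP.
    apply/seteqP; split=> s /=.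
      move=> Bs.
      have [k Hk] : exists k, forall j, D k (tnth s j).
        have /choice[f Hf] : forall j, exists k, D k (tnth s j).
          by move=> j; have : [set: T] (tnth s j) by []; rewrite -DT => -[k _ ?]; exists k.
        exists (\max_j f j) => j; apply: ndD (Hf j); exact: leq_bigmax.
      by exists k => // j; case: eqVneq => [->|_].
    by move=> [k _] /(_ i); rewrite eqxx.
  by move=> mid A mA; have := mid measurableT A mA; rewrite setTI.
apply: smallest_sub; first exact: sigma_algebra_measurable.
move=> _ [A GA <-]; apply: measurable_rect => i; rewrite mG.
exact: sub_sigma_algebra.
Qed.

Lemma rects_setI n : setI_closed (@rects n).
Proof.
move=> _ _ [A GA <-] [B GB <-]; exists (fun i => A i `&` B i).
  by move=> i; exact: GI.
by apply/seteqP; split=> [s /= AB|s /= [sA sB] i //]; split=> i; have [] := AB i.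
Qed.

(** Uniqueness of measures: rectangles with sides in [G] form a generating pi-system, and the cubes
    over [D] exhaust the space with finite mass. [G] stays abstract because it is the full
    sigma-algebra for a sample, but the closed intervals for Lebesgue measure, whose values are
    given only on closed boxes. *)
Lemma tuple_tonelli n (m : {measure set (n.-tuple T) -> \bar R}) :
  (forall k, mu (D k) < +oo)%E ->
  (forall A : 'I_n -> set T, (forall i, G (A i)) ->
     m (rect A) = \prod_(i < n) mu (A i))%E ->
  forall F : n.-tuple T -> \bar R, (forall s, 0 <= F s)%E ->
    measurable_fun setT F -> (\int[m]_s F s)%E = iterint F.
Proof.
move=> Doo mP F F0 mF; have [m' Hm'] := exists_tuple_power n.
have GT B : G B -> measurable B by rewrite mG; exact: sub_sigma_algebra.
have m'P A : (forall i, G (A i)) -> (m' (rect A) = \prod_(i < n) mu (A i))%E.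
  move=> GA; have mA i := GT _ (GA i).
  have -> : m' (rect A) = (\int[m']_s (\prod_(i < n) \1_(A i) (tnth s i) : R)%:E)%E.
    rewrite -(setIT (rect A)) -integral_indic//; last exact: measurable_rect.
    apply: eq_integral => s _; congr EFin; rewrite indicE.
    case: (boolP (s \in _)) => [/set_mem As|/negP nAs].
      by rewrite big1// => i _; rewrite indicE mem_set//; exact: As.
    apply/esym/eqP; rewrite prodf_seq_eq0; apply/hasP.
    have [i nAi] : exists i, ~ A i (tnth s i).
      by apply/existsNP => As; apply: nAs; exact/mem_set.
    by exists i; rewrite ?mem_index_enum//= indicE memNset.
  rewrite Hm'//; last first.
  - apply/measurable_EFinP; apply: (@measurable_tuple_prod n (fun i => \1_(A i))) => i.
    exact: measurable_indic.
  - by move=> s; rewrite lee_fin prodr_ge0// => i _; rewrite indicE.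
  rewrite (@iterint_prod n (fun i => \1_(A i)))//.
  by apply: eq_bigr => i _; rewrite integral_indic// setIT.
rewrite -Hm'//; apply: eq_measure_integral => X mX _.
apply: (measure_unique (@rects n) (fun k => rect (fun=> D k))) => //.
- exact: measurable_rects.
- exact: rects_setI.
- by move=> k; exists (fun=> D k) => //= i; exact: GD.
- apply/seteqP; split => // s _.
  have /choice[f Hf] : forall j, exists k, D k (tnth s j).
    by move=> j; have : [set: T] (tnth s j) by []; rewrite -DT => -[k _ ?]; exists k.
  exists (\max_j f j) => //= j; apply: ndD (Hf j); exact: leq_bigmax.
- by move=> _ [A GA <-]; rewrite mP//; exact/esym/m'P.
- move=> k; rewrite mP//.
  suff /andP[] : (0 <= \prod_(i < n) mu (D k) < +oo)%E by [].
  elim/big_ind : _ => [|x y /andP[x0 xoo] /andP[y0 yoo]|i _].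
  + by rewrite lee_fin ler01 ltry.
  + by rewrite mule_ge0//= lte_mul_pinfty// ge0_fin_numE.
  + by rewrite measure_ge0 Doo.
Qed.

End generated.
End iterated_integral.

(** * Concentration of functions of independent variables *)

Section scalar_bounds.
Context {R : realType}.
Implicit Types u t : R.

(** The linear term is exact, so it vanishes in mean for a centred [u]; the factor e^|u| is the
    price for treating both signs without a bound on [u]. *)
Lemma expR_le_quad u : expR u <= 1 + u + u ^+ 2 * expR `|u|.
Proof.
have e0 := expR_gt0 u.
have H : expR u - 1 <= u * expR u.
  have := expR_ge1Dx (- u); rewrite expRN => H.
  have : (1 - u) * expR u <= 1.
    by rewrite -ler_pdivlMr// div1r.
  nra.
have [u0|u0] := leP 0 u.
  rewrite ger0_norm//.
  have : u * (expR u - 1) <= u * (u * expR u) by rewrite ler_wpM2l.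
  nra.
have := expR_ge1Dx u => H1.
rewrite ltr0_norm//.
have : 1 <= expR (- u) by rewrite -expR0 ler_expR oppr_ge0 ltW.
move=> H2.
have : u * (expR u - 1) <= u ^+ 2 by nra.
have : u ^+ 2 <= u ^+ 2 * expR (- u) by rewrite ler_peMr// sqr_ge0.
nra.
Qed.

Lemma sqr_le_expR t : 0 <= t -> t ^+ 2 <= 4 * expR t.
Proof.
move=> t0; have := expR_ge1Dx (t / 2) => H.
have -> : expR t = expR (t / 2) ^+ 2 by rewrite expr2 -expRD -splitr.
nra.
Qed.

End scalar_bounds.

Section affine.
Context {R : realType} {dT : measure_display} {T : measurableType dT}.
Variable mu : probability T R.

(** Nonnegativity replaces integrability: the identity holds even when an integral is infinite.
    Later inequalities are arranged so as to meet these sign conditions. *)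
Lemma ge0_integral_affine (f g : T -> R) (a b c : R) :
  (forall x, 0 <= f x) -> measurable_fun setT f ->
  (forall x, 0 <= g x) -> measurable_fun setT g ->
  0 <= a -> 0 <= b -> 0 <= c ->
  (\int[mu]_x (a * f x + b * g x + c)%:E =
   a%:E * \int[mu]_x (f x)%:E + b%:E * \int[mu]_x (g x)%:E + c%:E)%E.
Proof.
move=> f0 mf g0 mg a0 b0 c0.
have mEf : measurable_fun setT (fun x => (f x)%:E) by exact/measurable_EFinP.
have mEg : measurable_fun setT (fun x => (g x)%:E) by exact/measurable_EFinP.
under eq_integral do rewrite 2!EFinD 2!EFinM.
rewrite ge0_integralD//; first last.
- by apply: emeasurable_funD; apply: measurable_funeM.
- by move=> x _; rewrite adde_ge0// mule_ge0// lee_fin.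
rewrite ge0_integralD//; first last.
- exact: measurable_funeM.
- by move=> x _; rewrite mule_ge0// lee_fin.
- exact: measurable_funeM.
- by move=> x _; rewrite mule_ge0// lee_fin.
rewrite !ge0_integralZl//; try by move=> x _; rewrite lee_fin.
by rewrite integral_cst// [X in (c%:E * X)%E]probability_setT mule1.
Qed.
End affine.

Section concentration.
Context {R : realType} {dT : measure_display} {T : measurableType dT}.
Variable mu : probability T R.

Lemma iterintDc n (F : n.-tuple T -> \bar R) (c : R) : 0 <= c ->
  (forall s, 0 <= F s)%E -> measurable_fun setT F ->
  iterint mu (fun s => F s + c%:E)%E = (iterint mu F + c%:E)%E.
Proof.
move=> c0; elim: n F => [|n IH] F F0 mF //=.
transitivity (\int[mu]_x (iterint mu (fun s : n.-tuple T => F [tuple of x :: s]) + c%:E))%E.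
  by apply: eq_integral => x _; rewrite IH//; exact: measurable_consl.
rewrite ge0_integralD//; last 2 first.
- by move=> x _; exact: iterint_ge0.
- exact: measurable_iterint_cons.
by rewrite integral_cst// [X in (_ * X)%E]probability_setT mule1.
Qed.

Variables (N : T -> R) (K c0 : R).
Hypotheses (mN : measurable_fun setT N) (N0 : forall x, 0 <= N x) (K0 : 0 < K).
Hypothesis expN : (\int[mu]_x (expR (N x / K))%:E <= c0%:E)%E.

(** The variance factor per coordinate, in units of (l K)^2: 16 comes from (2 l K)^2 times the 4 of
    [sqr_le_expR], e^(c0 - 1) from the mean of [N], and [c0] from its exponential moment. *)
Let vK := 16 * c0 * expR (c0 - 1).

Lemma expN_ge1 : 1 <= c0.
Proof.
rewrite -lee_fin; apply: le_trans expN.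
rewrite -[leLHS](@probability_setT _ _ _ mu) -[leLHS]mul1e -integral_cst//.
apply: ge0_le_integral => //.
- apply/measurable_EFinP; apply: measurableT_comp => //.
  exact: measurable_funM.
- move=> x _; rewrite lee_fin -expR0 ler_expR divr_ge0// ltW//.
Qed.

(** Integrate 1 + N / K <= e^(N / K). *)
Lemma mean_N : (\int[mu]_x (N x)%:E <= ((c0 - 1) * K)%:E)%E.
Proof.
have mE : measurable_fun setT (fun x => (expR (N x / K))%:E).
  by apply/measurable_EFinP; apply: measurableT_comp => //; exact: measurable_funM.
have H : (K^-1%:E * \int[mu]_x (N x)%:E + 1%:E <= c0%:E)%E.
  apply: le_trans expN.
  rewrite -ge0_integralZl//; last 3 first.
  - exact/measurable_EFinP.
  - by move=> x _; rewrite lee_fin.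
  - by rewrite lee_fin invr_ge0 ltW.
  rewrite -[X in (_ + X)%E](@probability_setT _ _ _ mu) -[X in (_ + X)%E]mul1e -integral_cst//.
  rewrite -ge0_integralD//; last 2 first.
  - by move=> x _; rewrite -EFinM lee_fin mulr_ge0 ?invr_ge0// ltW.
  - by apply/measurable_EFinP; exact: measurable_funM.
  apply: ge0_le_integral => //.
  - by move=> x _; rewrite -EFinM -EFinD lee_fin addr_ge0// mulr_ge0 ?invr_ge0// ltW.
  - by apply: emeasurable_funD => //; apply/measurable_EFinP; exact: measurable_funM.
  - move=> x _; rewrite -EFinM -EFinD lee_fin addrC mulrC; exact: expR_ge1Dx.
move: H; have : (0 <= \int[mu]_x (N x)%:E)%E by apply: integral_ge0 => x _; rewrite lee_fin.
case: (\int[mu]_x _)%E => [r| |]//= _.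
  rewrite -EFinM -EFinD !lee_fin => H.
  by rewrite -ler_pdivrMr// mulrC; lra.
by rewrite mulry gtr0_sg ?invr_gt0// mul1e.
Qed.

(** Averaging the hypothesis over [y] gives |h - m| <= l (N + E N) for the mean [m]. The
    second-order expansion of exp around [m] then has a remainder dominated by a multiple of e^(N /
    K), whose integral is at most [c0]. *)
Lemma mgf_step (h : T -> R) (l : R) : measurable_fun setT h ->
  (forall x, 0 <= h x) -> 0 <= l -> 2 * l * K <= 1 ->
  (forall x y, `|h x - h y| <= l * (N x + N y)) ->
  exists m : R, [/\ 0 <= m, (\int[mu]_x (h x)%:E = m%:E)%E &
    (\int[mu]_x (expR (h x))%:E <= (expR (m + vK * (l * K) ^+ 2))%:E)%E].
Proof.
move=> mh h0 l0 lK hN.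
have c1 := expN_ge1.
have fineN : (\int[mu]_x (N x)%:E \is a fin_num)%E.
  rewrite ge0_fin_numE ?(le_lt_trans mean_N) ?ltry//.
  by apply: integral_ge0 => x _; rewrite lee_fin.
pose EN := fine (\int[mu]_x (N x)%:E).
have EN0 : 0 <= EN by apply/fine_ge0/integral_ge0 => x _; rewrite lee_fin.
have ENK : EN <= (c0 - 1) * K by rewrite -lee_fin fineK// mean_N.
have intlN a x : 0 <= a ->
    (\int[mu]_y (a + l * (N x + N y))%:E = (a + l * (N x + EN))%:E)%E.
  move=> a0.
  under eq_integral do rewrite mulrDr addrA EFinD EFinM.
  rewrite ge0_integralD//; last 3 first.
  - by move=> y _; rewrite lee_fin addr_ge0// mulr_ge0.
  - by move=> y _; rewrite -EFinM lee_fin mulr_ge0.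
  - by apply/measurable_EFinP; exact: measurable_funM.
  rewrite integral_cst// [X in (_ * X)%E]probability_setT mule1.
  rewrite ge0_integralZl//; last 2 first.
  - exact/measurable_EFinP.
  - by move=> y _; rewrite lee_fin.
  by rewrite -(fineK fineN) -EFinM -EFinD mulrDr addrA.
(* A probability space has a point, and comparison with the value there bounds [h] by an integrable
   function. *)
have hlt : (\int[mu]_x (h x)%:E < +oo)%E.
  have [x0 _] : exists x0 : T, True.
    apply: contrapT => nT; have : mu setT = 0%E.
      by rewrite (_ : setT = set0) ?measure0//; apply/seteqP; split=> x // _; apply: nT; exists x.
    by rewrite [mu _]probability_setT => /eqP; rewrite onee_eq0.
  apply: (@le_lt_trans _ _ (h x0 + l * (N x0 + EN))%:E); last exact: ltry.
  rewrite -intlN//; apply: ge0_le_integral => //.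
  - by move=> x _; rewrite lee_fin.
  - exact/measurable_EFinP.
  - apply/measurable_EFinP; apply: measurable_funD => //; apply: measurable_funM => //.
    exact: measurable_funD.
  - by move=> x _; rewrite lee_fin; have := hN x x0; rewrite ler_norml addrC => /andP[_]; lra.
have fineh : (\int[mu]_x (h x)%:E \is a fin_num)%E.
  by rewrite ge0_fin_numE// integral_ge0// => x _; rewrite lee_fin.
pose m := fine (\int[mu]_x (h x)%:E).
have m0 : 0 <= m by apply/fine_ge0/integral_ge0 => x _; rewrite lee_fin.
have mE : (\int[mu]_x (h x)%:E = m%:E)%E by rewrite fineK.
exists m; split => //.
have mlN a x : measurable_fun setT (fun y => (a + l * (N x + N y))%:E).
  by apply/measurable_EFinP; apply: measurable_funD => //; apply: measurable_funM => //; exact: measurable_funD.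
have hm x : `|h x - m| <= l * (N x + EN).
  rewrite ler_norml; apply/andP; split.
    suff : m <= h x + l * (N x + EN) by lra.
    rewrite -lee_fin -intlN// -mE; apply: ge0_le_integral => //.
    - by move=> y _; rewrite lee_fin.
    - exact/measurable_EFinP.
    - by move=> y _; rewrite lee_fin; have := hN y x; rewrite ler_norml addrC => /andP[_]; lra.
  suff : h x <= m + l * (N x + EN) by lra.
  rewrite -lee_fin -[X in (_ <= (_ + X)%:E)%E]add0r EFinD -intlN// -mE.
  rewrite -[leLHS]mule1 -[X in (_ * X <= _)%E](@probability_setT _ _ _ mu) -integral_cst//.
  rewrite -ge0_integralD//; last 3 first.
  - by move=> y _; rewrite lee_fin.
  - exact/measurable_EFinP.
  - by move=> y _; rewrite lee_fin add0r mulr_ge0// addr_ge0.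
  apply: ge0_le_integral => //.
  - by move=> y _; rewrite lee_fin.
  - by apply: emeasurable_funD => //; exact/measurable_EFinP.
  - by move=> y _; rewrite -EFinD lee_fin add0r; have := hN x y; rewrite ler_norml => /andP[_]; lra.
pose b := 16 * (l * K) ^+ 2 * expR (c0 - 1).
have b0 : 0 <= b by rewrite mulr_ge0 ?expR_ge0// mulr_ge0// sqr_ge0.
(* The expansion around [m], multiplied by e^m. The term e^m m stands on the left to keep both sides
   nonnegative; after integration it cancels the mean of e^m h. *)
have key x : expR (h x) + expR m * m <= expR m * (1 + b * expR (N x / K)) + expR m * h x.
  have -> : expR (h x) = expR m * expR (h x - m) by rewrite -expRD addrC subrK.
  rewrite -!mulrDr ler_pM2l ?expR_gt0//.
  have := expR_le_quad (h x - m).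
  suff : (h x - m) ^+ 2 * expR `|h x - m| <= b * expR (N x / K) by lra.
  (* Chosen so that |h x - m| <= 2 l K t and e^(2 t) = e^(c0 - 1) e^(N x / K). One factor e^t pays
     for t^2 and the other for the exponential; the latter uses 2 l K <= 1. *)
  pose t := (N x / K + (c0 - 1)) / 2.
  have NK0 : 0 <= N x / K by rewrite divr_ge0// ltW.
  have t0 : 0 <= t by rewrite divr_ge0// addr_ge0// subr_ge0.
  have tle : `|h x - m| <= (2 * l * K) * t.
    apply: (le_trans (hm x)); rewrite /t.
    have -> : 2 * l * K * ((N x / K + (c0 - 1)) / 2) = l * (N x + (c0 - 1) * K).
      by field; rewrite lt0r_neq0.
    by rewrite ler_wpM2l// lerD2l.
  have lKt : 2 * l * K * t <= t by rewrite ler_piMl.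
  have -> : b * expR (N x / K) = (2 * l * K) ^+ 2 * (4 * expR t) * expR t.
    have E : expR (c0 - 1) * expR (N x / K) = expR t * expR t.
      by rewrite -!expRD; congr expR; rewrite /t; lra.
    by rewrite /b -mulrA E; ring.
  rewrite ler_pM ?expR_ge0 ?sqr_ge0//; last by rewrite ler_expR; exact: le_trans lKt.
  apply: (@le_trans _ _ ((2 * l * K * t) ^+ 2)).
    by rewrite -real_normK ?num_real// lerXn2r// nnegrE// mulr_ge0// mulr_ge0 ?mulr_ge0// ltW.
  by rewrite exprMn ler_wpM2l ?sqr_ge0// sqr_le_expR.
have : (\int[mu]_x (expR (h x))%:E + (expR m * m)%:E <=
    (expR m * (1 + b * c0) + expR m * m)%:E)%E.
  have mE' : measurable_fun setT (fun x => expR (N x / K)).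
    by apply: measurableT_comp => //; exact: measurable_funM.
  have -> : (\int[mu]_x (expR (h x))%:E + (expR m * m)%:E =
      \int[mu]_x (1 * expR (h x) + 0 * h x + expR m * m)%:E)%E.
    rewrite (@ge0_integral_affine _ _ _ mu (fun x => expR (h x)) h _ _ _
      (fun x => expR_ge0 _) _ h0 mh ler01 (lexx 0) (mulr_ge0 (expR_ge0 m) m0)); last first.
      exact: measurableT_comp.
    by rewrite mul1e mul0e adde0.
  apply: (@le_trans _ _ (\int[mu]_x ((expR m * b) * expR (N x / K) + expR m * h x + expR m)%:E)%E).
    apply: ge0_le_integral => //.
    - by move=> x _; rewrite lee_fin mul1r mul0r addr0 addr_ge0// ?mulr_ge0 ?expR_ge0.
    - apply/measurable_EFinP; apply: measurable_funD => //; apply: measurable_funD => //.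
        by apply: measurable_funM => //; exact: measurableT_comp.
      exact: measurable_funM.
    - apply/measurable_EFinP; apply: measurable_funD => //; apply: measurable_funD => //.
        exact: measurable_funM.
      exact: measurable_funM.
    - by move=> x _; rewrite lee_fin; have := key x; lra.
  rewrite (@ge0_integral_affine _ _ _ mu (fun x => expR (N x / K)) h _ _ _
    (fun x => expR_ge0 _) mE' h0 mh (mulr_ge0 (expR_ge0 m) b0) (expR_ge0 m) (expR_ge0 m)) mE.
  rewrite -EFinM.
  apply: (@le_trans _ _ ((expR m * b)%:E * c0%:E + (expR m * m)%:E + (expR m)%:E)%E).
    by rewrite leeD2r// leeD2r// lee_wpmul2l// lee_fin mulr_ge0 ?expR_ge0.
  by rewrite -EFinM -!EFinD lee_fin; lra.
rewrite EFinD leeD2rE// => /le_trans; apply.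
rewrite lee_fin expRD ler_pM2l ?expR_gt0//.
have -> : vK * (l * K) ^+ 2 = b * c0 by rewrite /vK /b; ring.
exact: expR_ge1Dx.
Qed.

(** A bounded-difference condition whose bound is the random quantity [N], evaluated at the old and
    the new value of the coordinate. *)
Definition bounded_diff n (l : R) (g : n.-tuple T -> R) :=
  forall (s s' : n.-tuple T) i, (forall j, j != i -> tnth s j = tnth s' j) ->
    `|g s - g s'| <= l * (N (tnth s i) + N (tnth s' i)).

(** A martingale argument in iterated form: [h], the conditional mean given the head coordinate,
    inherits the difference bound and is treated by [mgf_step]. The other coordinates are treated by
    induction with the head frozen, and the variance factors add up. *)
Lemma mgf_tuple n (g : n.-tuple T -> R) (l : R) : measurable_fun setT g ->
  (forall s, 0 <= g s) -> 0 <= l -> 2 * l * K <= 1 -> bounded_diff l g ->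
  exists m : R, [/\ 0 <= m, iterint mu (fun s => (g s)%:E) = m%:E &
    (iterint mu (fun s => (expR (g s))%:E) <=
      (expR (m + n%:R * (vK * (l * K) ^+ 2)))%:E)%E].
Proof.
move=> + + l0 lK; elim: n g => [|n IH] g mg g0 bg.
  by exists (g [tuple]); split => //=; rewrite mul0r addr0.
have mEg : measurable_fun setT (fun s => (g s)%:E) by exact/measurable_EFinP.
have E0 s : (0 <= (g s)%:E)%E by rewrite lee_fin.
have {}IH x : exists m : R, [/\ 0 <= m,
    iterint mu (fun s : n.-tuple T => (g [tuple of x :: s])%:E) = m%:E &
    (iterint mu (fun s : n.-tuple T => (expR (g [tuple of x :: s]))%:E) <=
      (expR (m + n%:R * (vK * (l * K) ^+ 2)))%:E)%E].
  apply: (IH (fun s : n.-tuple T => g [tuple of x :: s])) => //.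
    by apply/measurable_EFinP; exact: (measurable_consl x mEg).
  move=> s s' i ss'; have := bg [tuple of x :: s] [tuple of x :: s'] (lift ord0 i).
  rewrite !tnthS; apply => j; case: (unliftP ord0 j) => [k|] ->; last by rewrite !tnth0.
  by rewrite !tnthS => /negP kj; apply: ss'; apply/negP => /eqP ki; apply: kj; rewrite ki.
pose h x := fine (iterint mu (fun s : n.-tuple T => (g [tuple of x :: s])%:E)).
have hE x : iterint mu (fun s : n.-tuple T => (g [tuple of x :: s])%:E) = (h x)%:E.
  by have [m [_ E _]] := IH x; rewrite /h E.
have h0 x : 0 <= h x by have [m [m0 E _]] := IH x; rewrite /h E.
have mh : measurable_fun setT h.
  by apply: measurableT_comp => //; exact: (measurable_iterint_cons mu E0 mEg).
have hN x y : `|h x - h y| <= l * (N x + N y).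
  have mcons w : measurable_fun setT (fun s : n.-tuple T => (g [tuple of w :: s])%:E).
    exact: (measurable_consl w mEg).
  have half u v : h u <= h v + l * (N u + N v).
    rewrite -lee_fin EFinD -!hE -iterintDc ?mulr_ge0 ?addr_ge0//.
    apply: le_iterint => //.
    - by move=> s; rewrite -EFinD lee_fin addr_ge0// mulr_ge0// addr_ge0.
    - by exact: emeasurable_funD.
    - move=> s; rewrite -EFinD lee_fin.
      have := bg [tuple of u :: s] [tuple of v :: s] ord0; rewrite !tnth0.
      have H j : j != ord0 -> tnth [tuple of u :: s] j = tnth [tuple of v :: s] j.
        by case: (unliftP ord0 j) => [k|] ->; rewrite ?eqxx// !tnthS.
      by move=> /(_ H); rewrite ler_norml => /andP[_]; lra.
  by rewrite ler_norml; have := half x y; have := half y x; move=> *; apply/andP; split; lra.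
have [m [m0 mE Hm]] := mgf_step mh h0 l0 lK hN.
exists m; split => //=.
  by rewrite -mE; apply: eq_integral => x _; rewrite hE.
pose v := vK * (l * K) ^+ 2; rewrite -/v in Hm *.
apply: (@le_trans _ _ ((expR (n%:R * v))%:E * \int[mu]_x (expR (h x))%:E)%E).
  rewrite -ge0_integralZl//; last first.
  - by apply/measurable_EFinP; exact: measurableT_comp.
  have mEx : measurable_fun setT (fun s => (expR (g s))%:E).
    by apply/measurable_EFinP; exact: measurableT_comp.
  apply: ge0_le_integral => //.
  - by move=> x _; apply: iterint_ge0 => s; rewrite lee_fin expR_ge0.
  - have E1 s : (0 <= (expR (g s))%:E)%E by rewrite lee_fin expR_ge0.
    exact: (measurable_iterint_cons mu E1 mEx).
  - by apply: measurable_funeM; apply/measurable_EFinP; exact: measurableT_comp.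
  - move=> x _; have [m' [_ m'E H]] := IH x; apply: (le_trans H).
    by rewrite -EFinM lee_fin -expRD /h m'E addrC.
apply: (@le_trans _ _ ((expR (n%:R * v))%:E * (expR (m + v))%:E)%E).
  by rewrite lee_wpmul2l// lee_fin expR_ge0.
rewrite -EFinM lee_fin -expRD ler_expR -natr1; lra.
Qed.

(* [Z] stands for an i.i.d. sample whose joint law is given by [iterint mu]. *)
Lemma concentration n dO (Omega : measurableType dO) (P : probability Omega R)
    (Z : Omega -> n.-tuple T) (g : n.-tuple T -> R) (M z : R) :
  measurable_fun setT Z ->
  (forall F : n.-tuple T -> \bar R, (forall s, 0 <= F s)%E -> measurable_fun setT F ->
     (\int[P]_w F (Z w) = iterint mu F)%E) ->
  measurable_fun setT g -> (forall s, 0 <= g s) -> bounded_diff 1 g ->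
  (iterint mu (fun s => (g s)%:E) <= M%:E)%E -> 0 <= z ->
  (P [set w | (M + (vK + 2) * K * n%:R * z <= g (Z w))%R] <=
     (expR (- (n%:R * Num.min (z ^+ 2) z)))%:E)%E.
Proof.
move=> mZ lawZ mg g0 bg gM z0.
(* The Chernoff parameter is [q / (2 * K)]. The cap at 1 keeps 2 l K <= 1, and q z = min(z^2, z)
   gives both regimes at once. *)
pose q := Num.min 1 z.
have q0 : 0 <= q by rewrite le_min ler01.
have q1 : q <= 1 by rewrite ge_min lexx.
have qz : q <= z by rewrite ge_min lexx orbT.
have qE : q * z = Num.min (z ^+ 2) z.
  rewrite /q; case: (leP 1 z) => z1; rewrite ?mul1r.
    by rewrite min_r// expr2 ler_peMl.
  by rewrite min_l// expr2 ler_piMl// ltW.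
pose l := q / (2 * K).
have l0 : 0 <= l by rewrite divr_ge0// mulr_ge0// ltW.
have lKE : l * K = q / 2 by rewrite /l; field; rewrite lt0r_neq0.
have lK : 2 * l * K <= 1 by rewrite -mulrA lKE; lra.
have vK0 : 0 <= vK.
  by rewrite mulr_ge0 ?expR_ge0// mulr_ge0// (le_trans ler01)// expN_ge1.
have mlg : measurable_fun setT (fun s => l * g s) by exact: measurable_funM.
have [m [m0 mE Hm]] : exists m : R, [/\ 0 <= m,
    iterint mu (fun s => (l * g s)%:E) = m%:E &
    (iterint mu (fun s => (expR (l * g s))%:E) <=
      (expR (m + n%:R * (vK * (l * K) ^+ 2)))%:E)%E].
  apply: mgf_tuple => //.
  - by move=> s; rewrite mulr_ge0.
  - move=> s s' i ss'; rewrite -mulrBr normrM ger0_norm// ler_wpM2l//.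
    by rewrite -[leRHS]mul1r; exact: bg.
have mM : m <= l * M.
  rewrite -lee_fin -mE EFinM.
  rewrite (@eq_iterint _ _ _ mu _ _ (fun s => l%:E * (g s)%:E)%E)//.
  rewrite iterintZl//.
  - exact: lee_wpmul2l.
  - exact/measurable_EFinP.
pose t := (vK + 2) * K * n%:R * z.
pose A := [set w | M + t <= g (Z w)].
have mA : measurable A.
  have mgZ : measurable_fun setT (g \o Z) by exact: measurableT_comp.
  have := @measurable_fun_le _ _ _ setT (cst (M + t)) (g \o Z).
  rewrite setTI => H; exact: H.
have : ((expR (l * (M + t)))%:E * P A <= (expR (m + n%:R * (vK * (l * K) ^+ 2)))%:E)%E.
  apply: le_trans Hm; rewrite -lawZ; last 2 first.
  - by move=> s; rewrite lee_fin expR_ge0.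
  - by apply/measurable_EFinP; exact: measurableT_comp.
  have mE' : measurable_fun setT (fun w => (expR (l * g (Z w)))%:E).
    by apply/measurable_EFinP; apply: measurableT_comp => //; exact: (measurableT_comp mlg mZ).
  rewrite -integral_cst//.
  apply: (@le_trans _ _ (\int[P]_(w in A) (expR (l * g (Z w)))%:E)%E).
    apply: ge0_le_integral => //.
    - by move=> w _; rewrite lee_fin expR_ge0.
    - exact: measurable_funTS.
    - by move=> w /= Aw; rewrite lee_fin ler_expR ler_wpM2l.
  apply: ge0_subset_integral => //.
rewrite -/t -/A => H.
have -> : (P A = (expR (- (l * (M + t))))%:E * ((expR (l * (M + t)))%:E * P A))%E.
  by rewrite muleA -EFinM -expRD addNr expR0 mul1e.
apply: (le_trans (lee_wpmul2l _ H)); first by rewrite lee_fin expR_ge0.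
rewrite -EFinM lee_fin -expRD ler_expR lKE -qE.
have -> : l * (M + t) = l * M + (vK + 2) * n%:R * (q * z) / 2.
  rewrite /t /l; field; rewrite lt0r_neq0//.
(* As q^2 <= q z, the variance costs at most n vK q z / 4, whereas the threshold gains n (vK + 2) q
   z / 2; what survives is at least n q z. *)
have : n%:R * (vK * (q / 2) ^+ 2) <= n%:R * (vK * (q * z)) / 4.
  have qq : (q / 2) ^+ 2 <= q * z / 4.
    have : q * q <= q * z by rewrite ler_wpM2l.
    by rewrite expr2; lra.
  by rewrite -[leRHS]mulrA -[X in _ <= _ * X]mulrA !ler_wpM2l.
have : 0 <= n%:R * vK * (q * z) by apply: mulr_ge0; [exact: mulr_ge0|exact: mulr_ge0].
lra.
Qed.

End concentration.

(** * Second moments of sums of independent variables *)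

Section variance.
Context {R : realType} {dT : measure_display} {T : measurableType dT}.
Variable mu : probability T R.

Lemma measurable_sum_tnth n (k : T -> R) : measurable_fun setT k ->
  measurable_fun setT (fun s : n.-tuple T => \sum_(i < n) k (tnth s i)).
Proof.
move=> mk; apply: measurable_sum => i.
exact: (measurableT_comp mk (measurable_tnth i)).
Qed.

(** The cross term vanishes because [c] is the mean of [k], and a variance is at most a second
    moment. *)
Lemma integral_sq_shift (k : T -> R) (a c V : R) : measurable_fun setT k ->
  (forall x, 0 <= k x) -> (\int[mu]_x (k x)%:E = c%:E)%E ->
  (\int[mu]_x (k x ^+ 2)%:E <= V%:E)%E ->
  (\int[mu]_x ((a + (k x - c)) ^+ 2)%:E <= (a ^+ 2 + V)%:E)%E.
Proof.
move=> mk k0 kc kV.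
have c0 : 0 <= c by rewrite -lee_fin -kc integral_ge0// => x _; rewrite lee_fin.
have mk2 : measurable_fun setT (fun x => k x ^+ 2) by exact: measurable_funX.
have k20 x : 0 <= k x ^+ 2 by exact: sqr_ge0.
have ma : measurable_fun setT (fun x => (a + (k x - c)) ^+ 2).
  by apply: measurable_funX; apply: measurable_funD => //; exact: measurable_funB.
have a20 x : 0 <= (a + (k x - c)) ^+ 2 by exact: sqr_ge0.
pose b := 2 * `|a - c|.
have b0 : 0 <= b by rewrite mulr_ge0.
have ab : 0 <= b - 2 * (a - c) by have := ler_norm (a - c); rewrite /b; lra.
(* [b >= 2 (a - c)] makes both sides of the expansion of the square nonnegative *)
have : (\int[mu]_x (1 * (a + (k x - c)) ^+ 2 + (b - 2 * (a - c)) * k x + 0)%:E <=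
        \int[mu]_x (1 * k x ^+ 2 + b * k x + (a - c) ^+ 2)%:E)%E.
  apply: ge0_le_integral => //.
  - by move=> x _; rewrite lee_fin addr_ge0// addr_ge0// ?mul1r// mulr_ge0.
  - apply/measurable_EFinP; apply: measurable_funD => //.
    by apply: measurable_funD => //; exact: measurable_funM.
  - apply/measurable_EFinP; apply: measurable_funD => //.
    by apply: measurable_funD => //; exact: measurable_funM.
  - by move=> x _; rewrite lee_fin; nra.
rewrite (ge0_integral_affine mu a20 ma k0 mk ler01 ab (lexx 0)).
rewrite (ge0_integral_affine mu k20 mk2 k0 mk ler01 b0 (sqr_ge0 (a - c))).
rewrite !mul1e kc.
have : (\int[mu]_x ((a + (k x - c)) ^+ 2)%:E >= 0)%E by apply: integral_ge0 => x _; rewrite lee_fin.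
have : (\int[mu]_x (k x ^+ 2)%:E >= 0)%E by apply: integral_ge0 => x _; rewrite lee_fin.
move: kV; case: (\int[mu]_x (k x ^+ 2)%:E)%E => [v| |]//.
case: (\int[mu]_x _)%E => [u| |]//.
rewrite -!EFinM -!EFinD !lee_fin => vV v0 u0 H; nra.
Qed.

(** The shift [a] carries the contribution of the coordinates already fixed, which is what the
    induction needs; the use is at [a = 0]. *)
Lemma iterint_sq_sum n (k : T -> R) (a c V : R) : measurable_fun setT k ->
  (forall x, 0 <= k x) -> (\int[mu]_x (k x)%:E = c%:E)%E ->
  (\int[mu]_x (k x ^+ 2)%:E <= V%:E)%E ->
  (iterint mu (fun s : n.-tuple T => ((a + \sum_(i < n) (k (tnth s i) - c)) ^+ 2)%:E) <=
    (a ^+ 2 + n%:R * V)%:E)%E.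
Proof.
move=> mk k0 kc kV; elim: n a => [|n IH] a /=.
  by rewrite big_ord0 addr0 mul0r addr0.
have V0 : 0 <= V.
  by rewrite -lee_fin; apply: le_trans kV; apply: integral_ge0 => x _; rewrite lee_fin sqr_ge0.
apply: (@le_trans _ _ (\int[mu]_x (1 * (a + (k x - c)) ^+ 2 + 0 * k x + n%:R * V)%:E)%E).
  apply: ge0_le_integral => //.
  - by move=> x _; apply: iterint_ge0 => s; rewrite lee_fin sqr_ge0.
  - apply: (@measurable_iterint_cons _ _ _ mu n
      (fun s => ((a + \sum_(i < n.+1) (k (tnth s i) - c)) ^+ 2)%:E)).
      by move=> s; rewrite lee_fin sqr_ge0.
    apply/measurable_EFinP; apply: measurable_funX; apply: measurable_funD => //.
    apply: (measurable_sum_tnth (k := fun x => k x - c)); exact: measurable_funB.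
  - apply/measurable_EFinP; apply: measurable_funD => //; apply: measurable_funD.
      apply: measurable_funM => //; apply: measurable_funX; apply: measurable_funD => //.
      exact: measurable_funB.
    exact: measurable_funM.
  - move=> x _; rewrite mul1r mul0r addr0; apply: le_trans (IH (a + (k x - c))).
    rewrite le_eqVlt; apply/orP; left; apply/eqP; apply: eq_iterint => s.
    congr ((_ ^+ 2)%:E); rewrite big_ord_recl tnth0 addrA; congr (_ + _).
    by apply: eq_bigr => i _; rewrite tnthS.
rewrite (ge0_integral_affine mu (fun x => sqr_ge0 _) _ k0 mk ler01 (lexx 0) (mulr_ge0 (ler0n R n) V0)).
  rewrite mul1e mul0e adde0.
  apply: (@le_trans _ _ ((a ^+ 2 + V)%:E + (n%:R * V)%:E)%E).
    by rewrite leeD2r//; exact: integral_sq_shift.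
  by rewrite -EFinD lee_fin -natr1; lra.
by apply: measurable_funX; apply: measurable_funD => //; exact: measurable_funB.
Qed.

End variance.

(** * The law of an i.i.d. sample and Lebesgue measure on tuples *)

Section iid_law.
Context {R : realType} {d n : nat} {dO : measure_display} {Omega : measurableType dO}.
Variables (P : probability Omega R) (X : 'I_n -> Omega -> d.-tuple R).
Variable mu : probability (d.-tuple R) R.

Definition sample (w : Omega) : n.-tuple (d.-tuple R) := [tuple X i w | i < n].

Lemma measurable_sample : iid P X mu -> measurable_fun setT sample.
Proof.
move=> [mX _]; apply/measurable_fun_tnthP => i.
by rewrite (_ : _ \o _ = X i)//; apply/funext => w /=; rewrite tnth_mktuple.
Qed.

(** Independence and identical distribution fix the joint law on measurable rectangles, which
    suffices by [tuple_tonelli]. *)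
Lemma iid_law : iid P X mu ->
  forall F : n.-tuple (d.-tuple R) -> \bar R, (forall s, 0 <= F s)%E ->
    measurable_fun setT F -> (\int[P]_w F (sample w) = iterint mu F)%E.
Proof.
move=> iidX F F0 mF; have [mX [idX indX]] := iidX.
have mZ := measurable_sample iidX.
pose m : {measure set (n.-tuple (d.-tuple R)) -> \bar R} :=
  measure_function_pushforward__canonical__measure_function_Measure P mZ.
transitivity (\int[m]_s F s)%E.
  by rewrite /m/= ge0_integral_pushforward ?preimage_setT.
apply: (@tuple_tonelli _ _ _ mu measurable (fun=> setT)) => //.
- by rewrite sigma_algebra_id//; exact: sigma_algebra_measurable.
- by move=> A B mA mB; exact: measurableI.
- by rewrite bigcup_const.
- by move=> k; rewrite [X in (X < _)%E]probability_setT ltry.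
- move=> A mA; rewrite /m/= /pushforward.
  rewrite (_ : sample @^-1` _ = \bigcap_(i in [set: 'I_n]) (X i @^-1` A i)); last first.
    apply/seteqP; split => w /= wA i; first by move=> _; have := wA i; rewrite tnth_mktuple.
    by rewrite tnth_mktuple; exact: wA.
  by rewrite indX//; apply: eq_bigr => i _; rewrite idX.
Qed.

End iid_law.

Section sigma_finite_measure_of.
Context {R : realType} {dT : measure_display} {T : measurableType dT}.
Variable m : {measure set T -> \bar R}.
Hypothesis sfin : sigma_finite setT m.

(** A copy of [m] whose body mentions [sfin], so that the proof becomes an argument of the constant
    and a sigma-finite structure can be attached to it. *)
Definition as_sigma_finite : set T -> \bar R := let _ := sfin in m.
HB.instance Definition _ := Measure.on as_sigma_finite.
HB.instance Definition _ := Measure_isSigmaFinite.Build _ _ _ as_sigma_finite sfin.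

Lemma sigma_finite_measure_of :
  exists m' : {sigma_finite_measure set T -> \bar R}, (m' : set T -> \bar R) = m.
Proof. by exists as_sigma_finite. Qed.

End sigma_finite_measure_of.

(** * Lebesgue measure on R^d from its values on closed boxes, and Gaussian integrals *)

Section lebesgue.
Context {R : realType}.

(** Without the requirement a <= b the empty set is included, which makes the family closed under
    intersection. *)
Definition closed_itvs : set (set R) := [set A | exists a b : R, A = `[a, b]%classic].

Lemma measurable_closed_itvs : @measurable _ R = <<s closed_itvs >>.
Proof.
apply/seteqP; split; last first.
  apply: smallest_sub; first exact: sigma_algebra_measurable.
  by move=> _ [a [b ->]]; exact: measurable_itv.
have -> : @measurable _ R = <<s @RGenCInfty.G R >> by exact: RGenCInfty.measurableE.
apply: smallest_sub; first exact: smallest_sigma_algebra.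
move=> _ [a ->].
rewrite (_ : `[a, +oo[%classic = \bigcup_k `[a, a + k%:R]%classic).
  apply: sigma_algebra_bigcup => k; apply: sub_sigma_algebra.
  by exists a, (a + k%:R).
apply/seteqP; split=> x /=; rewrite in_itv/= ?andbT.
  move=> ax; exists (Num.truncn (x - a)).+1 => //=; rewrite in_itv/= ax/=.
  by rewrite -lerBlDl ltW// truncnS_gt.
by move=> [k _] /=; rewrite in_itv/= => /andP[].
Qed.

Lemma closed_itvs_setI : setI_closed closed_itvs.
Proof.
move=> _ _ [a [b ->]] [a' [b' ->]].
exists (Num.max a a'), (Num.min b b').
apply/seteqP; split => x /=; rewrite !in_itv/= ge_max le_min.
  by move=> [/andP[-> ->] /andP[-> ->]].
by move=> /andP[/andP[-> ->] /andP[-> ->]].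
Qed.

(* Mathcomp equips [R] and [measurableTypeR R], the type on which
   [lebesgue_measure] lives, with the same sigma-algebra but different displays. *)
Lemma lebesgue_measure_on_R : exists m : {sigma_finite_measure set R -> \bar R},
  (forall A, measurable A -> m A = lebesgue_measure A) /\
  forall f : R -> \bar R, (forall x, 0 <= f x)%E -> measurable_fun setT f ->
    (\int[m]_x f x = \int[lebesgue_measure]_x f x)%E.
Proof.
have mid : measurable_fun setT (idfun : measurableTypeR R -> R).
  by move=> _ A mA; rewrite setTI preimage_id.
pose m := measure_function_pushforward__canonical__measure_function_Measure
  (@lebesgue_measure R) mid.
have sfin : sigma_finite setT m.
  exists (fun k : nat => `[- k%:R, k%:R]%classic : set R).
    apply/seteqP; split=> // x _; exists (Num.truncn `|x|).+1 => //=.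
    by rewrite in_itv/= -ler_norml ltW// truncnS_gt.
  move=> k; split; first exact: measurable_itv.
  rewrite /m/= /pushforward preimage_id lebesgue_measure_itv.
  by case: ifP => _; rewrite ?ltry// -EFinD ltry.
have [m' m'E] := sigma_finite_measure_of sfin.
exists m'; split => [A mA|f f0 mf]; rewrite m'E.
  by rewrite /m/= /pushforward preimage_id.
by rewrite /m/= ge0_integral_pushforward// preimage_setT.
Qed.

Variable (d : nat) (lam : {measure set (d.-tuple R) -> \bar R}).
Hypothesis Hlam : is_lebesgue_Rd lam.

Lemma lebesgue_Rd_tonelli (m : {sigma_finite_measure set R -> \bar R}) (F : d.-tuple R -> \bar R) :
  (forall A, measurable A -> m A = lebesgue_measure A) ->
  (forall s, 0 <= F s)%E -> measurable_fun setT F ->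
  (\int[lam]_s F s = iterint m F)%E.
Proof.
move=> mE F0 mF.
have mEitv (a b : R) : m `[a, b]%classic = lebesgue_measure `[a, b]%classic.
  by apply: mE; exact: measurable_itv.
pose D (k : nat) : set R := `[- k%:R, k%:R]%classic.
apply: (@tuple_tonelli _ _ _ m closed_itvs D) => //.
- exact: measurable_closed_itvs.
- exact: closed_itvs_setI.
- by move=> k; exists (- k%:R), k%:R.
- move=> k l kl x; rewrite /D /= !in_itv/= => /andP[x1 x2].
  by rewrite (le_trans _ x1) ?(le_trans x2) ?lerN2 ?ler_nat.
- apply/seteqP; split=> // x _; exists (Num.truncn `|x|).+1 => //.
  by rewrite /D/= in_itv/= -ler_norml ltW// truncnS_gt.
- by move=> k; rewrite mEitv lebesgue_measure_itv; case: ifP => _; rewrite ?ltry// -EFinD ltry.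
- move=> A HA.
  have /choice[ab Hab] : forall i, exists ab : R * R, A i = `[ab.1, ab.2]%classic.
    by move=> i; have [a [b ->]] := HA i; exists (a, b).
  have [le_ab|] := pselect (forall i, (ab i).1 <= (ab i).2).
    have := Hlam (a := [tuple (ab i).1 | i < d]) (b := [tuple (ab i).2 | i < d]).
    rewrite (_ : [set x | _] = rect A); last first.
      apply/seteqP; split => s /= sA i; have := sA i; rewrite Hab !tnth_mktuple /= in_itv//=.
    move=> ->; last by move=> i; rewrite !tnth_mktuple.
    rewrite -prodEFin; apply: eq_bigr => i _; rewrite Hab !tnth_mktuple.
    rewrite mEitv lebesgue_measure_itv/= lte_fin.
    by have := le_ab i; rewrite le_eqVlt => /predU1P[->|->//]; rewrite subrr ltxx.
  (* A reversed interval is empty, so the box and the product of lengths both have measure zero. *)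
  move=> /existsNP[i /negP]; rewrite -ltNge => ba.
  have Ai0 : A i = set0.
    rewrite Hab; apply/seteqP; split => // x /=; rewrite in_itv/= => /andP[x1 x2].
    by have := lt_le_trans ba (le_trans x1 x2); rewrite ltxx.
  rewrite (_ : rect A = set0); last by apply/seteqP; split => // s /(_ i); rewrite Ai0.
  by rewrite measure0 (bigD1 i)//= Ai0 measure0 mul0e.
Qed.

Lemma lebesgue_Rd_sigma_finite : sigma_finite setT lam.
Proof.
pose D (k : nat) : set R := `[- k%:R, k%:R]%classic.
exists (fun k : nat => rect (fun=> D k)).
  apply/seteqP; split => // s _.
  exists (Num.truncn (\sum_(i < d) `|tnth s i|)).+1 => //= i.
  rewrite /D/= in_itv/= -ler_norml ltW//.
  apply: le_lt_trans (truncnS_gt _).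
  by rewrite (bigD1 i)//= lerDl sumr_ge0.
move=> k; split; first by apply: measurable_rect => i; exact: measurable_itv.
have k0 : - k%:R <= k%:R :> R by rewrite (@le_trans _ _ 0)// oppr_le0.
have := Hlam (a := [tuple - k%:R | i < d]) (b := [tuple k%:R | i < d]).
rewrite (_ : [set x | _] = rect (fun=> D k)); last first.
  by apply/seteqP; split => s /= sA i; have := sA i; rewrite /D !tnth_mktuple /= in_itv.
by move=> ->; [rewrite ltry|move=> i; rewrite !tnth_mktuple].
Qed.

Lemma integral_lebesgue_Rd_prod (g : 'I_d -> R -> R) :
  (forall i x, 0 <= g i x) -> (forall i, measurable_fun setT (g i)) ->
  (\int[lam]_y (\prod_(i < d) g i (tnth y i))%:E =
   \prod_(i < d) \int[lebesgue_measure]_x (g i x)%:E)%E.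
Proof.
move=> g0 mg; have [m [mE mI]] := lebesgue_measure_on_R.
rewrite (lebesgue_Rd_tonelli mE).
- rewrite iterint_prod//; apply: eq_bigr => i _; rewrite mI//.
    by move=> x; rewrite lee_fin.
  exact/measurable_EFinP.
- by move=> s; rewrite lee_fin prodr_ge0.
- by apply/measurable_EFinP; exact: measurable_tuple_prod.
Qed.

(** The normalisation of the normal density of variance 1 / (2 b). *)
Lemma integral_gauss1 (b m : R) : 0 < b ->
  (\int[lebesgue_measure]_x (expR (- b * (x - m) ^+ 2))%:E = (Num.sqrt (pi / b))%:E)%E.
Proof.
move=> b0; pose s := Num.sqrt (2 * b)^-1.
have s0 : 0 < s by rewrite sqrtr_gt0 invr_gt0 mulr_gt0.
have s2 : s ^+ 2 = (2 * b)^-1 by rewrite sqr_sqrtr// invr_ge0 mulr_ge0// ltW.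
have E : (\int[lebesgue_measure]_x ((normal_peak s)%:E * (expR (- b * (x - m) ^+ 2))%:E) = 1)%E.
  rewrite -(integral_normal_pdf m s); apply: eq_integral => x _.
  rewrite normal_pdfE ?gt_eqF// -EFinM; congr ((_ * expR _)%:E).
  by rewrite s2 -mulr_natr; field; rewrite lt0r_neq0.
have mf : measurable_fun setT (fun x : R => (expR (- b * (x - m) ^+ 2))%:E).
  apply/measurable_EFinP; apply: measurableT_comp => //; apply: measurable_funM => //.
  by apply: measurable_funX; exact: measurable_funB.
rewrite ge0_integralZl// in E; last by rewrite lee_fin normal_peak_ge0.
have pE : (normal_peak s)^-1 = Num.sqrt (pi / b).
  by rewrite /normal_peak invrK s2 -mulr_natr; congr Num.sqrt; field; rewrite lt0r_neq0.
have p0 : normal_peak s != 0 by rewrite gt_eqF// normal_peak_gt0// gt_eqF.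
rewrite -pE -[RHS]mule1 -E muleA -EFinM mulVf// mul1e//.
Qed.

Lemma vnorm2E (u : d.-tuple R) : vnorm u ^+ 2 = \sum_(i < d) tnth u i ^+ 2.
Proof. by rewrite sqr_sqrtr// sumr_ge0// => i _; exact: sqr_ge0. Qed.

Lemma integral_gauss_Rd (b : R) (x : d.-tuple R) : 0 < b ->
  (\int[lam]_y (expR (- b * vnorm (vsub y x) ^+ 2))%:E = (Num.sqrt (pi / b) ^+ d)%:E)%E.
Proof.
move=> b0.
under eq_integral => y _.
  rewrite vnorm2E mulr_sumr expR_sum.
  under eq_bigr do rewrite tnth_mktuple.
  over.
rewrite (integral_lebesgue_Rd_prod (g := fun i t => expR (- b * (t - tnth x i) ^+ 2))).
- under eq_bigr do rewrite integral_gauss1//.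
  by rewrite prodEFin prodr_const card_ord.
- by move=> i t; exact: expR_ge0.
- move=> i; apply: measurableT_comp => //; apply: measurable_funM => //.
  by apply: measurable_funX; exact: measurable_funB.
Qed.

End lebesgue.

(** * Weighted L1 deviation of an empirical mixture *)

Section iterint_fubini.
Context {R : realType} {dT dU : measure_display}.
Context {T : measurableType dT} {U : measurableType dU}.
Variables (mu : {sigma_finite_measure set T -> \bar R}).
Variables (lam : {sigma_finite_measure set U -> \bar R}).

Lemma iterint_fubini n (F : n.-tuple T * U -> \bar R) :
  (forall z, 0 <= F z)%E -> measurable_fun setT F ->
  iterint mu (fun s => \int[lam]_y F (s, y))%E =
  (\int[lam]_y iterint mu (fun s => F (s, y)))%E.
Proof.
elim: n F => [//|n IH] F F0 mF /=.
pose G x (z : n.-tuple T * U) := F ([tuple of x :: z.1], z.2).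
have mG x : measurable_fun setT (G x).
  apply: (measurableT_comp mF); apply: measurable_fun_pair => /=; last exact: measurable_snd.
  by apply: measurable_cons => //; exact: measurable_fst.
transitivity (\int[mu]_x \int[lam]_y iterint mu (fun s => G x (s, y)))%E.
  by apply: eq_integral => x _; rewrite -(IH (G x))// => z; exact: F0.
pose H (z : T * U) := iterint mu (fun s => G z.1 (s, z.2)).
rewrite (@fubini_tonelli _ _ _ _ _ mu lam H)//.
  apply: (@measurable_iterint _ _ _ mu n _ _ (fun z : (T * U) * n.-tuple T => G z.1.1 (z.2, z.1.2))).
    by move=> z; exact: F0.
  apply: (measurableT_comp mF); apply: measurable_fun_pair => /=.
    apply: measurable_cons; last exact: measurable_snd.
    exact: (measurableT_comp measurable_fst measurable_fst).
  exact: (measurableT_comp measurable_snd measurable_fst).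
by move=> z; apply: iterint_ge0 => s; exact: F0.
Qed.

End iterint_fubini.

Section L1_deviation.
Context {R : realType} {dT dU : measure_display}.
Context {T : measurableType dT} {U : measurableType dU}.
Variables (mu : probability T R) (lam : {sigma_finite_measure set U -> \bar R}).
Variables (k : T -> U -> R) (w th : U -> R) (B K c0 a b : R).
Hypotheses (mk : measurable_fun setT (fun z : T * U => k z.1 z.2)).
Hypotheses (k0 : forall x y, 0 <= k x y) (kB : forall x y, k x y <= B).
Hypotheses (mw : measurable_fun setT w) (w0 : forall y, 0 <= w y).
Hypotheses (mth : measurable_fun setT th) (th0 : forall y, 0 < th y).
Hypothesis mthV : measurable_fun setT (fun y => (th y)^-1).

(** The influence of an observation at [x], that is, the weighted mass of its kernel; [p] below is
    the mixture density. The function [th] is the auxiliary weight of the Cauchy-Schwarz step, with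
    mass [a] and dual second moment [b]. *)
Let NE x := (\int[lam]_y (w y * k x y)%:E)%E.
Let N x := fine (NE x).
Let p y := fine (\int[mu]_x (k x y)%:E)%E.

Hypothesis Noo_ : True.
Hypotheses (Noo : forall x, (NE x < +oo)%E) (K0 : 0 < K).
Hypothesis expN : (\int[mu]_x (expR (N x / K))%:E <= c0%:E)%E.
Hypothesis tha : (\int[lam]_y (th y)%:E <= a%:E)%E.
Hypothesis thb : (\int[mu]_x \int[lam]_y (w y ^+ 2 * k x y ^+ 2 / th y)%:E <= b%:E)%E.

Let mk1 y : measurable_fun setT (k ^~ y).
Proof.
apply: (@measurableT_comp _ _ _ _ _ _ (fun z : T * U => k z.1 z.2) _ (fun x => (x, y))) => //.
Qed.

Let mk2 x : measurable_fun setT (k x).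
Proof.
apply: (@measurableT_comp _ _ _ _ _ _ (fun z : T * U => k z.1 z.2) _ (fun y => (x, y))) => //.
exact: pair1_measurable.
Qed.

Let mwk : measurable_fun setT (fun z : T * U => (w z.2 * k z.1 z.2)%:E).
Proof.
apply/measurable_EFinP; apply: measurable_funM => //.
exact: (measurableT_comp mw measurable_snd).
Qed.

Let NE0 x : (0 <= NE x)%E.
Proof. by apply: integral_ge0 => y _; rewrite lee_fin mulr_ge0. Qed.

Let NEE x : NE x = (N x)%:E.
Proof. by rewrite fineK// ge0_fin_numE. Qed.

Let N0 x : 0 <= N x. Proof. exact/fine_ge0. Qed.

Let mNE : measurable_fun setT NE.
Proof.
apply: (@measurable_fun_fubini_tonelli_F _ _ _ _ _ lam _ mwk) => z.
by rewrite lee_fin mulr_ge0.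
Qed.

Let mN : measurable_fun setT N.
Proof. exact: measurableT_comp. Qed.

Let pE y : (\int[mu]_x (k x y)%:E = (p y)%:E)%E.
Proof.
rewrite fineK// ge0_fin_numE; last by apply: integral_ge0 => x _; rewrite lee_fin.
apply: (@le_lt_trans _ _ (\int[mu]_x B%:E)%E).
  apply: ge0_le_integral => //.
  - by move=> x _; rewrite lee_fin.
  - exact/measurable_EFinP.
  - by move=> x _; rewrite lee_fin.
by rewrite integral_cst// [X in (_ * X)%E]probability_setT mule1 ltry.
Qed.

Let p0 y : 0 <= p y.
Proof. by rewrite -lee_fin -pE integral_ge0// => x _; rewrite lee_fin. Qed.

Let mp : measurable_fun setT p.
Proof.
apply: measurableT_comp => //.
apply: (@measurable_fun_fubini_tonelli_G _ _ _ _ _ mu (fun z => (k z.1 z.2)%:E)).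
  exact/measurable_EFinP.
by move=> z; rewrite lee_fin.
Qed.

(** By Tonelli this integral is the mean of [N], finite by [mean_N]. *)
Lemma integral_wp_lty : (\int[lam]_y (w y * p y)%:E < +oo)%E.
Proof.
rewrite (_ : \int[lam]_y _ = \int[mu]_x NE x)%E.
  under eq_integral do rewrite NEE.
  by apply: le_lt_trans (mean_N mN N0 K0 expN) _; rewrite ltry.
rewrite (@fubini_tonelli _ _ _ _ _ mu lam (fun z => (w z.2 * k z.1 z.2)%:E))//; last first.
  by move=> z; rewrite lee_fin mulr_ge0.
apply: eq_integral => y _; rewrite /fubini_G/=.
under [RHS]eq_integral do rewrite EFinM.
rewrite ge0_integralZl//; last 3 first.
- exact/measurable_EFinP.
- by move=> x _; rewrite lee_fin.
- by rewrite lee_fin.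
by rewrite pE.
Qed.

Section deviation_sum.
Variable n : nat.

(** This is [n] times the difference between empirical and true mixture densities; left
    unnormalised, it satisfies the difference condition with constant 1. *)
Definition dev_sum (s : n.-tuple T) (y : U) := \sum_(i < n) (k (tnth s i) y - p y).
Let gE s := (\int[lam]_y (w y * `|dev_sum s y|)%:E)%E.

Let msum : measurable_fun setT (fun z : n.-tuple T * U => dev_sum z.1 z.2).
Proof.
apply: measurable_sum => i; apply: measurable_funB.
  apply: (@measurableT_comp _ _ _ _ _ _ (fun z : T * U => k z.1 z.2) _
    (fun z : n.-tuple T * U => (tnth z.1 i, z.2))) => //.
  apply: measurable_fun_pair => //=.
  exact: (measurableT_comp (measurable_tnth i) measurable_fst).
exact: (measurableT_comp mp measurable_snd).
Qed.

Let msum2 s : measurable_fun setT (dev_sum s).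
Proof.
apply: (@measurableT_comp _ _ _ _ _ _ (fun z : n.-tuple T * U => dev_sum z.1 z.2) _ (fun y => (s, y))) => //.
exact: pair1_measurable.
Qed.

Let mint s : measurable_fun setT (fun y => (w y * `|dev_sum s y|)%:E).
Proof.
apply/measurable_EFinP; apply: measurable_funM => //.
exact: measurableT_comp.
Qed.

Let gE0 s : (0 <= gE s)%E.
Proof. by apply: integral_ge0 => y _; rewrite lee_fin mulr_ge0. Qed.

Let gEoo s : (gE s < +oo)%E.
Proof.
apply: (@le_lt_trans _ _ (\sum_(i < n) (NE (tnth s i) + \int[lam]_y (w y * p y)%:E))%E).
  under eq_bigr => i _.
    rewrite -ge0_integralD//; last 4 first.
    - by move=> y _; rewrite lee_fin mulr_ge0.
    - by apply/measurable_EFinP; exact: measurable_funM.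
    - by move=> y _; rewrite lee_fin mulr_ge0.
    - by apply/measurable_EFinP; exact: measurable_funM.
    over.
  rewrite -ge0_integral_sum//; last 2 first.
  - move=> i; apply: emeasurable_funD; apply/measurable_EFinP; exact: measurable_funM.
  - by move=> i y _; rewrite -EFinD lee_fin addr_ge0// mulr_ge0.
  apply: ge0_le_integral => //.
  - by move=> y _; rewrite lee_fin mulr_ge0.
  - apply: emeasurable_sum => i; apply: emeasurable_funD; apply/measurable_EFinP; exact: measurable_funM.
  - move=> y _; under eq_bigr do rewrite -EFinD; rewrite sumEFin lee_fin.
    under eq_bigr do rewrite -mulrDr.
    rewrite -mulr_sumr ler_wpM2l//; apply: (le_trans (ler_norm_sum _ _ _)).
    apply: ler_sum => i _; apply: (le_trans (ler_normB _ _)).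
    by rewrite !ger0_norm.
elim/big_ind : _ => [|x y xoo yoo|i _]; first by rewrite ltry.
  exact: lte_add_pinfty.
by rewrite lte_add_pinfty// integral_wp_lty.
Qed.

Definition L1_dev s := fine (gE s).

Lemma L1_devE s : (\int[lam]_y (w y * `|dev_sum s y|)%:E = (L1_dev s)%:E)%E.
Proof. by rewrite fineK// ge0_fin_numE. Qed.

Let mg : measurable_fun setT L1_dev.
Proof.
apply: measurableT_comp => //.
apply: (@measurable_fun_fubini_tonelli_F _ _ _ _ _ lam
  (fun z : n.-tuple T * U => (w z.2 * `|dev_sum z.1 z.2|)%:E)).
  apply/measurable_EFinP; apply: measurable_funM; first exact: (measurableT_comp mw measurable_snd).
  exact: measurableT_comp.
by move=> z; rewrite lee_fin mulr_ge0.
Qed.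

(** Replacing one observation changes the sum by a difference of two kernels, as [p] cancels; each
    kernel contributes its own weighted mass. *)
Let bg : bounded_diff N 1 L1_dev.
Proof.
have half s s' i : (forall j, j != i -> tnth s j = tnth s' j) ->
    L1_dev s <= L1_dev s' + (N (tnth s i) + N (tnth s' i)).
  move=> ss'; rewrite -lee_fin !EFinD -!L1_devE -!NEE.
  rewrite -ge0_integralD//; last 4 first.
  - by move=> y _; rewrite lee_fin mulr_ge0.
  - by apply/measurable_EFinP; exact: measurable_funM.
  - by move=> y _; rewrite lee_fin mulr_ge0.
  - by apply/measurable_EFinP; exact: measurable_funM.
  rewrite -ge0_integralD//; last 3 first.
  - by move=> y _; rewrite lee_fin mulr_ge0.
  - by move=> y _; rewrite -EFinD lee_fin addr_ge0// mulr_ge0.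
  - by apply: emeasurable_funD; apply/measurable_EFinP; exact: measurable_funM.
  apply: ge0_le_integral => //.
  - by move=> y _; rewrite lee_fin mulr_ge0.
  - apply: emeasurable_funD => //.
    by apply: emeasurable_funD; apply/measurable_EFinP; exact: measurable_funM.
  - move=> y _; rewrite -!EFinD lee_fin -!mulrDr ler_wpM2l//.
    have E : dev_sum s y = dev_sum s' y + (k (tnth s i) y - k (tnth s' i) y).
      rewrite /dev_sum (bigD1 i)//= [X in _ = X + _](bigD1 i)//=.
      rewrite (eq_bigr (fun j => k (tnth s' j) y - p y)); last by move=> j ji; rewrite ss'.
      ring.
    rewrite E; apply: (le_trans (ler_normD _ _)); rewrite lerD2l.
    by apply: (le_trans (ler_normB _ _)); rewrite !ger0_norm.
move=> s s' i ss'; rewrite mul1r.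
have H1 := half s s' i ss'.
have H2 : L1_dev s' <= L1_dev s + (N (tnth s' i) + N (tnth s i)).
  by apply: half => j ji; rewrite ss'.
by rewrite ler_norml; apply/andP; split; lra.
Qed.

Let V y := fine (\int[mu]_x (k x y ^+ 2)%:E)%E.

Let VE y : (\int[mu]_x (k x y ^+ 2)%:E = (V y)%:E)%E.
Proof.
rewrite fineK// ge0_fin_numE; last by apply: integral_ge0 => x _; rewrite lee_fin sqr_ge0.
apply: (@le_lt_trans _ _ (\int[mu]_x (B ^+ 2)%:E)%E).
  apply: ge0_le_integral => //.
  - by move=> x _; rewrite lee_fin sqr_ge0.
  - by apply/measurable_EFinP; exact: measurable_funX.
  - by move=> x _; rewrite lee_fin lerXn2r// nnegrE// (le_trans (k0 x y)).
by rewrite integral_cst// [X in (_ * X)%E]probability_setT mule1 ltry.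
Qed.

(* [w |D| <= (sqrt n th + w^2 D^2 / (sqrt n th)) / 2], and [D] has variance at
   most [n] times the second moment of the kernel. *)
Let mean_dev : (0 < n)%N ->
  (iterint mu (fun s => (L1_dev s)%:E) <= (Num.sqrt n%:R * (a + b) / 2)%:E)%E.
Proof.
move=> n0; pose q : R := Num.sqrt n%:R.
have q0 : 0 < q by rewrite sqrtr_gt0 ltr0n.
have q2 : n%:R = q ^+ 2 by rewrite sqr_sqrtr.
rewrite (eq_iterint mu (fun s => esym (L1_devE s))).
have mwS : measurable_fun setT (fun z : n.-tuple T * U => (w z.2 * `|dev_sum z.1 z.2|)%:E).
  apply/measurable_EFinP; apply: measurable_funM; first exact: (measurableT_comp mw measurable_snd).
  exact: measurableT_comp.
rewrite (@iterint_fubini _ _ _ _ _ mu lam n (fun z => (w z.2 * `|dev_sum z.1 z.2|)%:E))//; last first.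
  by move=> z; rewrite lee_fin mulr_ge0.
have pt y : (iterint mu (fun s => (w y * `|dev_sum s y|)%:E) <=
    (q / 2 * th y + q / 2 * (w y ^+ 2 * V y / th y))%:E)%E.
  pose c := w y ^+ 2 / (2 * q * th y).
  have c_ge0 : 0 <= c by rewrite divr_ge0 ?sqr_ge0// mulr_ge0 ?mulr_ge0// ltW.
  have msq : measurable_fun setT (fun s => ((0 + dev_sum s y) ^+ 2)%:E).
    apply/measurable_EFinP; apply: measurable_funX; apply: measurable_funD => //.
    by apply: (measurable_sum_tnth (k := fun x => k x y - p y)); exact: measurable_funB.
  apply: (@le_trans _ _ (iterint mu (fun s => c%:E * ((0 + dev_sum s y) ^+ 2)%:E + (q / 2 * th y)%:E)%E)).
    apply: le_iterint => //.
    - by move=> s; rewrite lee_fin mulr_ge0.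
    - apply/measurable_EFinP; apply: measurable_funM => //; apply: measurableT_comp => //.
      by apply: (measurable_sum_tnth (k := fun x => k x y - p y)); exact: measurable_funB.
    - move=> s; rewrite -EFinM -EFinD lee_fin; apply: addr_ge0.
        by apply: mulr_ge0 => //; exact: sqr_ge0.
      by apply: mulr_ge0; [rewrite divr_ge0// ltW|exact: ltW].
    - by apply: emeasurable_funD => //; exact: measurable_funeM.
    - move=> s; rewrite -EFinM -EFinD lee_fin add0r -(real_normK (num_real (dev_sum s y))).
      set D := `|_|.
      rewrite -subr_ge0 (_ : _ - _ = (w y * D - q * th y) ^+ 2 / (2 * q * th y)).
        by rewrite divr_ge0 ?sqr_ge0// mulr_ge0 ?mulr_ge0// ltW.
      by rewrite /c; field; rewrite !gt_eqF.
  rewrite iterintDc//; first last.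
  - exact: measurable_funeM.
  - by move=> s; rewrite mule_ge0// lee_fin sqr_ge0.
  - by rewrite mulr_ge0// ?divr_ge0//; exact: ltW.
  rewrite iterintZl//; last by move=> s; rewrite lee_fin sqr_ge0.
  have := @iterint_sq_sum _ _ _ mu n (k ^~ y) 0 (p y) (V y) (mk1 y) (k0 ^~ y) (pE y).
  rewrite VE => /(_ (lexx _)) H.
  apply: (@le_trans _ _ (c%:E * (0 ^+ 2 + n%:R * V y)%:E + (q / 2 * th y)%:E)%E).
    by rewrite leeD2r// lee_wpmul2l.
  rewrite -EFinM -EFinD lee_fin addrC lerD2l /c q2 le_eqVlt; apply/orP; left; apply/eqP.
  by field; rewrite !gt_eqF.
have mV : measurable_fun setT V.
  apply: measurableT_comp => //.
  apply: (@measurable_fun_fubini_tonelli_G _ _ _ _ _ mu (fun z => (k z.1 z.2 ^+ 2)%:E)).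
    by apply/measurable_EFinP; exact: measurable_funX.
  by move=> z; rewrite lee_fin sqr_ge0.
have V0 y : 0 <= V y by apply/fine_ge0/integral_ge0 => x _; rewrite lee_fin sqr_ge0.
have mwV : measurable_fun setT (fun y => (w y ^+ 2 * V y / th y)%:E).
  apply/measurable_EFinP; apply: measurable_funM => //; apply: measurable_funM => //.
  exact: measurable_funX.
have wV0 y : (0 <= (w y ^+ 2 * V y / th y)%:E)%E.
  by rewrite lee_fin divr_ge0// ?mulr_ge0 ?sqr_ge0// ltW.
have mthE : measurable_fun setT (fun y => (th y)%:E) by exact/measurable_EFinP.
have intV : (\int[lam]_y (w y ^+ 2 * V y / th y)%:E <= b%:E)%E.
  apply: le_trans thb.
  have mF : measurable_fun setT (fun z : T * U => (w z.2 ^+ 2 * k z.1 z.2 ^+ 2 / th z.2)%:E).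
    apply/measurable_EFinP; apply: measurable_funM; last exact: (measurableT_comp mthV measurable_snd).
    apply: measurable_funM; last exact: measurable_funX.
    apply: measurable_funX; exact: (measurableT_comp mw measurable_snd).
  rewrite (@fubini_tonelli _ _ _ _ _ mu lam _ mF); last first.
    by move=> z; rewrite lee_fin divr_ge0// ?mulr_ge0 ?sqr_ge0// ltW.
  rewrite le_eqVlt; apply/orP; left; apply/eqP; apply: eq_integral => y _.
  rewrite /fubini_G/=.
  under [RHS]eq_integral do rewrite mulrAC EFinM.
  rewrite ge0_integralZl//; last 3 first.
  - by apply/measurable_EFinP; exact: measurable_funX.
  - by move=> x _; rewrite lee_fin sqr_ge0.
  - by rewrite lee_fin divr_ge0 ?sqr_ge0// ltW.
  by rewrite VE -EFinM mulrAC.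
apply: (@le_trans _ _ (\int[lam]_y ((q / 2)%:E * (th y)%:E + (q / 2)%:E * (w y ^+ 2 * V y / th y)%:E))%E).
  apply: ge0_le_integral => //.
  - by move=> y _; apply: iterint_ge0 => s; rewrite lee_fin mulr_ge0.
  - apply: (@measurable_iterint _ _ _ mu n _ _ (fun z : U * n.-tuple T => (w z.1 * `|dev_sum z.2 z.1|)%:E)).
      by move=> z; rewrite lee_fin mulr_ge0.
    apply: (@measurableT_comp _ _ _ _ _ _ (fun z : n.-tuple T * U =>
      (w z.2 * `|dev_sum z.1 z.2|)%:E) _ (fun z : U * n.-tuple T => (z.2, z.1)) mwS).
    exact: measurable_fun_pair.
  - by apply: emeasurable_funD; exact: measurable_funeM.
  - by move=> y _; rewrite -!EFinM -EFinD; exact: pt.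
rewrite ge0_integralD//; last 4 first.
- by move=> y _; rewrite -EFinM lee_fin mulr_ge0// ?divr_ge0//; exact: ltW.
- exact: measurable_funeM.
- by move=> y _; rewrite mule_ge0// lee_fin divr_ge0// ltW.
- exact: measurable_funeM.
have q20 : (0 <= (q / 2)%:E)%E by rewrite lee_fin divr_ge0// ltW.
rewrite !ge0_integralZl//; last by move=> y _; rewrite lee_fin ltW.
apply: (@le_trans _ _ ((q / 2)%:E * a%:E + (q / 2)%:E * b%:E)%E).
  by apply: leeD; exact: lee_wpmul2l.
by rewrite -!EFinM -EFinD lee_fin -/q; lra.
Qed.

Lemma L1_deviation dO (Omega : measurableType dO) (P : probability Omega R)
    (Z : Omega -> n.-tuple T) (z : R) : (0 < n)%N ->
  measurable_fun setT Z ->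
  (forall F : n.-tuple T -> \bar R, (forall s, 0 <= F s)%E -> measurable_fun setT F ->
     (\int[P]_w F (Z w) = iterint mu F)%E) -> 0 <= z ->
  let A := [set w | (Num.sqrt n%:R * (a + b) / 2 +
    (16 * c0 * expR (c0 - 1) + 2) * K * n%:R * z <= L1_dev (Z w))%R] in
  measurable A /\ (P A <= (expR (- (n%:R * Num.min (z ^+ 2) z)))%:E)%E.
Proof.
move=> n0 mZ lawZ z0 A; split.
  have := @measurable_fun_le _ _ _ setT (cst (Num.sqrt n%:R * (a + b) / 2 +
    (16 * c0 * expR (c0 - 1) + 2) * K * n%:R * z)) (L1_dev \o Z).
  by rewrite setTI; apply => //; exact: measurableT_comp.
apply: (concentration mN N0 K0 expN mZ lawZ) => //.
- by move=> s; rewrite -lee_fin -L1_devE; exact: gE0.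
- exact: mean_dev.
Qed.

End deviation_sum.
End L1_deviation.

(** * Gaussian kernels *)

Section vectors.
Context {R : realType} {d : nat}.
Implicit Types x y : d.-tuple R.

Lemma vnorm_ge0 x : 0 <= vnorm x. Proof. exact: sqrtr_ge0. Qed.

(** With |a|, |b| the two norms, the sum of squares of |b| a_i - |a| b_i equals 2 |a| |b| (|a| |b| -
    a.b). One can divide unless a norm vanishes, in which case all products are zero. *)
Lemma cauchy_schwarz (a b : 'I_d -> R) :
  \sum_(i < d) a i * b i <= Num.sqrt (\sum_(i < d) a i ^+ 2) * Num.sqrt (\sum_(i < d) b i ^+ 2).
Proof.
set A := \sum_(i < d) a i ^+ 2; set B := \sum_(i < d) b i ^+ 2.
have A0 : 0 <= A by apply: sumr_ge0 => i _; exact: sqr_ge0.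
have B0 : 0 <= B by apply: sumr_ge0 => i _; exact: sqr_ge0.
have sA := sqrtr_ge0 A; have sB := sqrtr_ge0 B.
have H : 0 <= 2 * (Num.sqrt A * Num.sqrt B) *
    (Num.sqrt A * Num.sqrt B - \sum_(i < d) a i * b i).
  have -> : 2 * (Num.sqrt A * Num.sqrt B) *
      (Num.sqrt A * Num.sqrt B - \sum_(i < d) a i * b i) =
      \sum_(i < d) (Num.sqrt B * a i - Num.sqrt A * b i) ^+ 2.
    rewrite [RHS](eq_bigr (fun i => Num.sqrt B ^+ 2 * a i ^+ 2 + Num.sqrt A ^+ 2 * b i ^+ 2
      - 2 * (Num.sqrt A * Num.sqrt B) * (a i * b i))); last by move=> i _; ring.
    rewrite sumrB big_split/= -!mulr_sumr -/A -/B.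
    by rewrite -[X in _ * X + _ - _](sqr_sqrtr A0) -[X in _ + _ * X - _](sqr_sqrtr B0); ring.
  by apply: sumr_ge0 => i _; exact: sqr_ge0.
have : 0 <= Num.sqrt A * Num.sqrt B by exact: mulr_ge0.
rewrite le_eqVlt => /predU1P[AB0|AB0]; last first.
  by move: H; rewrite pmulr_rge0 ?subr_ge0// mulr_gt0.
have zero (c : 'I_d -> R) : \sum_(i < d) c i ^+ 2 <= 0 -> forall i, c i = 0.
  move=> le0 i; apply/eqP; rewrite -sqrf_eq0 eq_le sqr_ge0 andbT.
  apply: le_trans le0; rewrite (bigD1 i)//= lerDl sumr_ge0// => j _; exact: sqr_ge0.
rewrite -AB0 big1// => i _; have /eqP := esym AB0.
by rewrite mulf_eq0 => /orP[]; rewrite sqrtr_eq0 => /zero ->; rewrite ?mul0r ?mulr0.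
Qed.

Lemma vnorm_vsub_sqr y x :
  vnorm (vsub y x) ^+ 2 = vnorm y ^+ 2 + vnorm x ^+ 2 - 2 * \sum_(i < d) tnth y i * tnth x i.
Proof.
rewrite !vnorm2E mulr_sumr -big_split/= -sumrB; apply: eq_bigr => i _.
by rewrite tnth_mktuple; ring.
Qed.

Lemma vnorm_vsub_le y x : vnorm (vsub y x) <= vnorm y + vnorm x.
Proof.
rewrite -(@ler_pXn2r _ 2)// ?nnegrE ?addr_ge0 ?vnorm_ge0// vnorm_vsub_sqr.
have := cauchy_schwarz (fun i => tnth y i) (fun i => - tnth x i).
rewrite (eq_bigr (fun i => - (tnth y i * tnth x i))); last by move=> i _; rewrite mulrN.
rewrite [X in _ * Num.sqrt X](eq_bigr (fun i => tnth x i ^+ 2)); last by move=> i _; rewrite sqrrN.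
by rewrite sumrN -/(vnorm x) -/(vnorm y); nra.
Qed.

Lemma vnorm_le_add y x : vnorm y <= vnorm x + vnorm (vsub y x).
Proof.
rewrite -(@ler_pXn2r _ 2)// ?nnegrE ?addr_ge0 ?vnorm_ge0//.
have := cauchy_schwarz (fun i => tnth (vsub y x) i) (fun i => tnth x i).
rewrite -/(vnorm x) -/(vnorm (vsub y x)).
have -> : vnorm y ^+ 2 = vnorm (vsub y x) ^+ 2 + vnorm x ^+ 2 + 2 * \sum_(i < d) tnth (vsub y x) i * tnth x i.
  rewrite !vnorm2E mulr_sumr -!big_split/=; apply: eq_bigr => i _.
  by rewrite tnth_mktuple; ring.
by nra.
Qed.

Lemma vnorm_sqr_le y x : vnorm y ^+ 2 <= 2 * vnorm x ^+ 2 + 2 * vnorm (vsub y x) ^+ 2.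
Proof.
have := vnorm_le_add y x; have := vnorm_ge0 y; have := vnorm_ge0 x; have := vnorm_ge0 (vsub y x).
by move=> *; have := sqr_ge0 (vnorm x - vnorm (vsub y x)); nra.
Qed.

Lemma vnorm_vsub_sqr_le y x : vnorm (vsub y x) ^+ 2 <= 2 * vnorm y ^+ 2 + 2 * vnorm x ^+ 2.
Proof.
have := vnorm_vsub_le y x; have := vnorm_ge0 y; have := vnorm_ge0 x; have := vnorm_ge0 (vsub y x).
by move=> *; have := sqr_ge0 (vnorm x - vnorm y); nra.
Qed.

Lemma measurable_vnorm_vsub :
  measurable_fun setT (fun z : d.-tuple R * d.-tuple R => vnorm (vsub z.2 z.1)).
Proof.
apply: (@measurableT_comp _ _ _ _ _ _ (@Num.sqrt R)).
  by apply: continuous_measurable_fun; exact: sqrt_continuous.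
apply: measurable_sum => i; apply: measurable_funX.
rewrite (_ : (fun z => _) = (fun z : d.-tuple R * d.-tuple R => tnth z.2 i - tnth z.1 i)); last first.
  by apply/funext => z; rewrite tnth_mktuple.
apply: measurable_funB; apply: (measurableT_comp (measurable_tnth i)).
  exact: measurable_snd.
exact: measurable_fst.
Qed.

Lemma measurable_vnorm : measurable_fun setT (@vnorm R d).
Proof.
apply: (@measurableT_comp _ _ _ _ _ _ (@Num.sqrt R)).
  by apply: continuous_measurable_fun; exact: sqrt_continuous.
by apply: measurable_sum => i; apply: measurable_funX; exact: measurable_tnth.
Qed.

End vectors.

Section gaussian.
Context {R : realType} (d : nat) (sigma : R).
Hypotheses (d1 : (0 < d)%N) (s0 : 0 < sigma).
Implicit Types x y : d.-tuple R.

Let k x y := gauss_dens sigma (vsub y x).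

Definition gauss_peak : R := (Num.sqrt (2 * pi * sigma ^+ 2)) ^- d.

Let c2pi : 0 < 2 * pi * sigma ^+ 2.
Proof. by rewrite mulr_gt0 ?exprn_gt0// mulr_gt0// pi_gt0. Qed.

Lemma gauss_peak_gt0 : 0 < gauss_peak.
Proof. by rewrite invr_gt0 exprn_gt0// sqrtr_gt0. Qed.

Lemma gauss_densE x y :
  k x y = gauss_peak * expR (- (vnorm (vsub y x) ^+ 2 / (2 * sigma ^+ 2))).
Proof. by rewrite /k /gauss_dens mulNr. Qed.

Lemma gauss_dens_gt0 x y : 0 < k x y.
Proof. by rewrite gauss_densE mulr_gt0 ?gauss_peak_gt0 ?expR_gt0. Qed.

Lemma gauss_dens_le x y : k x y <= gauss_peak.
Proof.
rewrite gauss_densE ler_piMr ?(ltW gauss_peak_gt0)// -expR0 ler_expR oppr_le0.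
by rewrite divr_ge0 ?sqr_ge0// mulr_ge0// sqr_ge0.
Qed.

Lemma measurable_gauss_dens :
  measurable_fun setT (fun z : d.-tuple R * d.-tuple R => k z.1 z.2).
Proof.
rewrite (_ : (fun z => _) = (fun z : d.-tuple R * d.-tuple R =>
  gauss_peak * expR (- (vnorm (vsub z.2 z.1) ^+ 2 / (2 * sigma ^+ 2))))); last first.
  by apply/funext => z; exact: gauss_densE.
apply: measurable_funM => //; apply: measurableT_comp => //; apply: measurableT_comp => //.
by apply: measurable_funM => //; apply: measurable_funX; exact: measurable_vnorm_vsub.
Qed.

Variable (lam : {measure set (d.-tuple R) -> \bar R}).
Hypothesis Hlam : is_lebesgue_Rd lam.

Let mlam_gauss (b : R) x : measurable_fun setT (fun y => (expR (- b * vnorm (vsub y x) ^+ 2))%:E).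
Proof.
apply/measurable_EFinP; apply: measurableT_comp => //; apply: measurable_funM => //.
apply: measurable_funX.
apply: (@measurableT_comp _ _ _ _ _ _ (fun z : d.-tuple R * d.-tuple R => vnorm (vsub z.2 z.1)) _ (fun y => (x, y))).
  exact: measurable_vnorm_vsub.
exact: pair1_measurable.
Qed.

(* Tilting by exp(|y - x|^2 / (4 d sigma^2)) costs (1 - 1/(2d))^(-d/2) <= 2, by Bernoulli. *)
Lemma integral_gauss_tilt x :
  (\int[lam]_y (k x y * expR (vnorm (vsub y x) ^+ 2 / (4 * d%:R * sigma ^+ 2)))%:E <= 2%:E)%E.
Proof.
have dR : (1 : R) <= d%:R by rewrite ler1n.
have dR0 : (0 : R) < d%:R by rewrite ltr0n.
(* The tilt removes the fraction [del] of the Gaussian exponent, and d del = 1/2. *)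
pose del : R := (2 * d%:R)^-1.
have del0 : 0 < del by rewrite invr_gt0 mulr_gt0.
have ddel : d%:R * del = 2^-1 by rewrite /del; field; rewrite gt_eqF.
have del1 : del <= 2^-1 by rewrite -ddel ler_peMl// ltW.
pose b := (1 - del) / (2 * sigma ^+ 2).
have b0 : 0 < b by rewrite divr_gt0 ?mulr_gt0 ?exprn_gt0//; lra.
under eq_integral => y _.
  rewrite gauss_densE -mulrA -expRD EFinM.
  rewrite (_ : _ + _ = - b * vnorm (vsub y x) ^+ 2); last first.
    by rewrite /b /del; field; rewrite !gt_eqF.
  over.
rewrite ge0_integralZl//; last by rewrite lee_fin (ltW gauss_peak_gt0).
rewrite (integral_gauss_Rd Hlam)// -EFinM lee_fin.
have -> : Num.sqrt (pi / b) = Num.sqrt (2 * pi * sigma ^+ 2) * (Num.sqrt (1 - del))^-1.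
  rewrite -sqrtrV; last lra.
  rewrite -sqrtrM; last exact: ltW.
  by congr Num.sqrt; rewrite /b; field; rewrite !gt_eqF//; lra.
rewrite exprMn mulrA /gauss_peak mulVf ?mul1r; last by rewrite gt_eqF// exprn_gt0// sqrtr_gt0.
rewrite exprVn -[leRHS]invrK lef_pV2 ?posrE ?invr_gt0 ?exprn_gt0 ?sqrtr_gt0//; last lra.
(* Bernoulli gives (1 - del)^d >= 1/2; taking the square root only enlarges a number of [0, 1]. *)
have bern n : n%:R * del <= 1 -> 1 - n%:R * del <= (1 - del) ^+ n.
  elim: n => [|n IH]; first by rewrite mul0r subr0 expr0.
  rewrite -natr1 => H; have := IH ltac:(lra); rewrite exprS => H1.
  have : (1 - del) * (1 - n%:R * del) <= (1 - del) * (1 - del) ^+ n by rewrite ler_wpM2l//; lra.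
  have : 0 <= n%:R * del * del by rewrite !mulr_ge0// ltW.
  lra.
have := bern d; rewrite ddel => /(_ ltac:(lra)) H.
apply: (@le_trans _ _ ((1 - del) ^+ d)); first lra.
rewrite lerXn2r ?nnegrE ?sqrtr_ge0//; first lra.
have a0 : 0 <= 1 - del by lra.
rewrite -[leLHS](sqr_sqrtr a0) expr2 ler_piMl ?sqrtr_ge0//.
by rewrite -[leRHS]sqrtr1 ler_sqrt//; lra.
Qed.

(** The squared kernel decays like exp(-|y - x|^2 / sigma^2). Three quarters of this exponent are
    left to the weights, and the present integrand is what remains. *)
Lemma integral_gauss_sq x :
  (\int[lam]_y (gauss_peak ^+ 2 * expR (- (vnorm (vsub y x) ^+ 2 / (4 * sigma ^+ 2))))%:E
     <= (sigma ^- d)%:E)%E.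
Proof.
have pi2 := @pi_ge2 R.
pose b := (4 * sigma ^+ 2)^-1.
have s20 : 0 < sigma ^+ 2 by rewrite exprn_gt0.
have b0 : 0 < b by rewrite invr_gt0 mulr_gt0.
under eq_integral => y _.
  rewrite EFinM (_ : - _ = - b * vnorm (vsub y x) ^+ 2); last by rewrite mulNr mulrC.
  over.
rewrite ge0_integralZl//; last by rewrite lee_fin sqr_ge0.
rewrite (integral_gauss_Rd Hlam)// -EFinM lee_fin.
rewrite /gauss_peak -exprVn -exprM mulnC exprM -exprMn -[leRHS]exprVn.
have c0 := c2pi; have sc0 : 0 <= 2 * pi * sigma ^+ 2 by exact: ltW.
have pb0 : 0 <= pi / b by rewrite divr_ge0 ?pi_ge0// ltW.
rewrite [(Num.sqrt _)^-1 ^+ 2]exprVn sqr_sqrtr//.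
rewrite lerXn2r ?nnegrE ?mulr_ge0 ?sqrtr_ge0 ?invr_ge0//; try exact: ltW.
rewrite mulrC ler_pdivrMr//.
have -> : sigma^-1 * (2 * pi * sigma ^+ 2) = 2 * pi * sigma by field; rewrite gt_eqF.
have ps0 : 0 <= 2 * pi * sigma by rewrite mulr_ge0 ?(ltW s0)// mulr_ge0 ?pi_ge0.
rewrite -[leRHS](ger0_norm ps0) -sqrtr_sqr ler_wsqrtr//.
have -> : pi / b = 4 * pi * sigma ^+ 2 by rewrite /b invrK; ring.
have -> : (2 * pi * sigma) ^+ 2 = 4 * pi * sigma ^+ 2 * pi by ring.
have : 0 <= 4 * pi * sigma ^+ 2 by rewrite mulr_ge0 ?sqr_ge0// mulr_ge0// pi_ge0.
by nra.
Qed.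

Let vsub0 y : vsub y [tuple 0 | i < d] = y.
Proof. by apply: eq_from_tnth => i; rewrite !tnth_mktuple subr0. Qed.

(** The mass of the auxiliary Cauchy-Schwarz weight, with exact base 5 l sqrt(pi) and pi <= 4. *)
Lemma integral_gauss_width (l : R) : 0 < l ->
  (\int[lam]_y (expR (- (vnorm y ^+ 2 / (25 * l ^+ 2))))%:E <= ((10 * l) ^+ d)%:E)%E.
Proof.
move=> l0; have pi4 : (pi : R) <= 4 by have := @pihalf_lt2 R; lra.
pose b := (25 * l ^+ 2)^-1.
have l20 : 0 < l ^+ 2 by rewrite exprn_gt0.
have b0 : 0 < b by rewrite invr_gt0 mulr_gt0.
under eq_integral => y _.
  rewrite (_ : - _ = - b * vnorm (vsub y [tuple 0 | i < d]) ^+ 2); last first.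
    by rewrite vsub0 mulNr mulrC.
  over.
rewrite (integral_gauss_Rd Hlam)// lee_fin.
have l10 : 0 <= 10 * l by rewrite mulr_ge0// ltW.
rewrite lerXn2r ?nnegrE ?sqrtr_ge0//.
rewrite -[leRHS](ger0_norm l10) -sqrtr_sqr ler_wsqrtr//.
by rewrite /b invrK; nra.
Qed.

End gaussian.

Section empirical.
Context {R : realType} {d n : nat}.

Lemma integral_empirical (x : 'I_n -> d.-tuple R) (f : d.-tuple R -> \bar R) :
  (0 < n)%N -> (forall y, 0 <= f y)%E -> measurable_fun setT f ->
  (\int[empirical x]_y f y = (n%:R^-1)%:E * \sum_(i < n) f (x i))%E.
Proof.
case: n x => // m x _ f0 mf.
have V0 : 0 <= (m.+1%:R^-1 : R) by rewrite invr_ge0.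
pose D (j : nat) : {measure set (d.-tuple R) -> \bar R} := dirac (x (inord j)).
(* [empirical] is a bare set function, recognised here as a scaled sum of Dirac measures; [inord]
   serves because [msum] is indexed by all naturals. *)
have -> : empirical x = mscale (NngNum V0) (msum D m.+1).
  apply/funext => A; rewrite /empirical /mscale/= /msum; congr (_ * _)%E.
  by apply: eq_bigr => i _; rewrite /D inord_val.
rewrite ge0_integral_mscale//= ge0_integral_measure_sum//; congr (_ * _)%E.
by apply: eq_bigr => i _; rewrite /D integral_dirac// diracT mul1e inord_val.
Qed.

End empirical.

(** * Weighted deviation of smoothed empirical densities *)

Section gaussian_deviation.
Context {R : realType} (d : nat) (sigma : R).
Hypotheses (d1 : (0 < d)%N) (s0 : 0 < sigma).
Variable (lam : {measure set (d.-tuple R) -> \bar R}).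
Hypothesis Hlam : is_lebesgue_Rd lam.

Let k (x y : d.-tuple R) := gauss_dens sigma (vsub y x).

Let mk2 x : measurable_fun setT (k x).
Proof.
apply: (@measurableT_comp _ _ _ _ _ _ (fun z : d.-tuple R * d.-tuple R => k z.1 z.2) _ (fun y => (x, y))).
  exact: measurable_gauss_dens.
exact: pair1_measurable.
Qed.

Let mk1 y : measurable_fun setT (k ^~ y).
Proof.
apply: (@measurableT_comp _ _ _ _ _ _ (fun z : d.-tuple R * d.-tuple R => k z.1 z.2) _ (fun x => (x, y))).
  exact: measurable_gauss_dens.
exact: measurable_fun_pair.
Qed.

Lemma conv_gauss_densE (mu : probability (d.-tuple R) R) y :
  (\int[mu]_x (k x y)%:E)%E = (conv_gauss_dens sigma mu y)%:E.
Proof.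
rewrite fineK// ge0_fin_numE; last first.
  by apply: integral_ge0 => x _; rewrite lee_fin ltW// gauss_dens_gt0.
apply: (@le_lt_trans _ _ (\int[mu]_x (gauss_peak d sigma)%:E)%E).
  apply: ge0_le_integral => //.
  - by move=> x _; rewrite lee_fin ltW// gauss_dens_gt0.
  - by apply/measurable_EFinP; exact: (mk1 y).
  - by move=> x _; rewrite lee_fin gauss_dens_le.
by rewrite integral_cst// [X in (_ * X)%E]probability_setT mule1 ltry.
Qed.

Lemma measurable_conv_gauss_dens (mu : probability (d.-tuple R) R) :
  measurable_fun setT (conv_gauss_dens sigma mu).
Proof.
apply: measurableT_comp => //.
apply: (@measurable_fun_fubini_tonelli_G _ _ _ _ _ mu (fun z => (k z.1 z.2)%:E)).
  by apply/measurable_EFinP; exact: measurable_gauss_dens.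
by move=> z; rewrite lee_fin ltW// gauss_dens_gt0.
Qed.

Lemma conv_gauss_dens_empirical n (x : 'I_n -> d.-tuple R) y : (0 < n)%N ->
  conv_gauss_dens sigma (empirical x) y = n%:R^-1 * \sum_(i < n) k (x i) y.
Proof.
move=> n0; rewrite /conv_gauss_dens integral_empirical//.
- by rewrite sumEFin -EFinM.
- by move=> z; rewrite lee_fin ltW// gauss_dens_gt0.
- by apply/measurable_EFinP; exact: (mk1 y).
Qed.

Section weight.
Variables (mu : probability (d.-tuple R) R) (w Nb Hb : d.-tuple R -> R).
Variables (l B K c0 : R).
Hypotheses (mw : measurable_fun setT w) (w0 : forall y, 0 <= w y).
Hypotheses (K0 : 0 < K) (l0 : 0 < l) (B0 : 0 < B).
Hypotheses (mNb : measurable_fun setT Nb) (mHb : measurable_fun setT Hb).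
Hypothesis wN : forall x, (\int[lam]_y (w y * k x y)%:E <= (Nb x)%:E)%E.
Hypothesis expN : (\int[mu]_x (expR (Nb x / K))%:E <= c0%:E)%E.
Hypothesis wH : forall x,
  (\int[lam]_y (w y ^+ 2 * k x y ^+ 2 * expR (vnorm y ^+ 2 / (25 * l ^+ 2)))%:E <= (Hb x)%:E)%E.
Hypothesis HB : (\int[mu]_x (Hb x)%:E <= (B ^+ 2 * sigma ^- d)%:E)%E.

Lemma gaussian_deviation n dO (Omega : measurableType dO) (P : probability Omega R)
    (X : 'I_n -> Omega -> d.-tuple R) (z : R) :
  (0 < n)%N -> iid P X mu -> 0 <= z ->
  (\int[lam]_y (w y * conv_gauss_dens sigma mu y)%:E < +oo)%E /\
  exists A, [/\ measurable A, (P A <= (expR (- (n%:R * Num.min (z ^+ 2) z)))%:E)%E &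
    forall om, ~ A om ->
    exists2 t, t < 10 ^+ d * (Num.sqrt l / Num.sqrt sigma) ^+ d * B / Num.sqrt n%:R
                   + (16 * c0 * expR (c0 - 1) + 2) * K * z &
      (\int[lam]_y (w y * `|conv_gauss_dens sigma (empirical (X ^~ om)) y -
                           conv_gauss_dens sigma mu y|)%:E = t%:E)%E].
Proof.
move=> n0 iidX z0.
(* Tonelli needs the sigma-finite structure; [lam'] has the same underlying function as [lam]. *)
have [lam' lamE] := sigma_finite_measure_of (lebesgue_Rd_sigma_finite Hlam).
have ssl : 0 < Num.sqrt l by rewrite sqrtr_gt0.
have sss : 0 < Num.sqrt sigma by rewrite sqrtr_gt0.
(* The amplitude that balances the mass of [th], proportional to kap, against the dual moment,
   proportional to 1 / kap. Both become (l / sigma)^(d/2) B, up to the factor 10^d on the first. *)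
pose kap := B / (Num.sqrt l * Num.sqrt sigma) ^+ d.
have kap0 : 0 < kap by rewrite divr_gt0// exprn_gt0// mulr_gt0.
pose th (y : d.-tuple R) := kap * expR (- (vnorm y ^+ 2 / (25 * l ^+ 2))).
have th0 y : 0 < th y by rewrite mulr_gt0// expR_gt0.
have mv : measurable_fun setT (fun y : d.-tuple R => vnorm y ^+ 2 / (25 * l ^+ 2)).
  by apply: measurable_funM => //; apply: measurable_funX; exact: measurable_vnorm.
have mth : measurable_fun setT th.
  by apply: measurable_funM => //; apply: measurableT_comp => //; exact: measurableT_comp.
have thV y : (th y)^-1 = kap^-1 * expR (vnorm y ^+ 2 / (25 * l ^+ 2)).
  by rewrite invfM expRN invrK.
have mthV : measurable_fun setT (fun y => (th y)^-1).
  rewrite (_ : (fun y => _) = (fun y => kap^-1 * expR (vnorm y ^+ 2 / (25 * l ^+ 2)))).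
    by apply: measurable_funM => //; exact: measurableT_comp.
  by apply/funext => y; exact: thV.
have k0 x y : 0 <= k x y by rewrite ltW// gauss_dens_gt0.
have kB x y : k x y <= gauss_peak d sigma by exact: gauss_dens_le.
have mkk := @measurable_gauss_dens R d sigma.
have Noo x : (\int[lam']_y (w y * k x y)%:E < +oo)%E.
  by rewrite lamE (le_lt_trans (wN x))// ltry.
have mwk : measurable_fun setT (fun z : d.-tuple R * d.-tuple R => (w z.2 * k z.1 z.2)%:E).
  apply/measurable_EFinP; apply: measurable_funM => //.
  exact: (measurableT_comp mw measurable_snd).
have expN' : (\int[mu]_x (expR (fine (\int[lam']_y (w y * k x y)%:E) / K))%:E <= c0%:E)%E.
  apply: le_trans expN; apply: ge0_le_integral => //.
  - apply/measurable_EFinP; apply: measurableT_comp => //; apply: measurable_funM => //.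
    apply: measurableT_comp => //.
    apply: (@measurable_fun_fubini_tonelli_F _ _ _ _ _ lam' _ mwk) => u.
    by rewrite lee_fin mulr_ge0.
  - by apply/measurable_EFinP; apply: measurableT_comp => //; exact: measurable_funM.
  - move=> x _; rewrite lee_fin ler_expR ler_pM2r ?invr_gt0//.
    rewrite -lee_fin fineK; first by rewrite lamE.
    by rewrite ge0_fin_numE// integral_ge0// => y _; rewrite lee_fin mulr_ge0.
have tha : (\int[lam']_y (th y)%:E <= (kap * (10 * l) ^+ d)%:E)%E.
  rewrite lamE; under eq_integral do rewrite EFinM.
  rewrite ge0_integralZl//; last 2 first.
  - by apply/measurable_EFinP; apply: measurableT_comp => //; exact: measurableT_comp.
  - by rewrite lee_fin ltW.
  rewrite [leRHS]EFinM; apply: lee_wpmul2l; first by rewrite lee_fin ltW.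
  exact: integral_gauss_width.
have mF : measurable_fun setT (fun z : d.-tuple R * d.-tuple R =>
    (w z.2 ^+ 2 * k z.1 z.2 ^+ 2 / th z.2)%:E).
  apply/measurable_EFinP; apply: measurable_funM; last exact: (measurableT_comp mthV measurable_snd).
  apply: measurable_funM; last exact: measurable_funX.
  by apply: measurable_funX; exact: (measurableT_comp mw measurable_snd).
have F0 x y : 0 <= w y ^+ 2 * k x y ^+ 2 / th y.
  by rewrite divr_ge0 ?mulr_ge0 ?sqr_ge0// ltW.
have thb : (\int[mu]_x \int[lam']_y (w y ^+ 2 * k x y ^+ 2 / th y)%:E <=
    (kap^-1 * (B ^+ 2 * sigma ^- d))%:E)%E.
  have H x : (\int[lam']_y (w y ^+ 2 * k x y ^+ 2 / th y)%:E <= (kap^-1)%:E * (Hb x)%:E)%E.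
    rewrite lamE; under eq_integral => y _ do rewrite thV mulrCA EFinM.
    rewrite ge0_integralZl//; last 3 first.
    - apply/measurable_EFinP; apply: measurable_funM; last exact: measurableT_comp.
      by apply: measurable_funM; exact: measurable_funX.
    - by move=> y _; rewrite lee_fin mulr_ge0 ?expR_ge0// mulr_ge0 ?sqr_ge0.
    - by rewrite lee_fin invr_ge0 ltW.
    by rewrite lee_wpmul2l// lee_fin invr_ge0 ltW.
  have Hb0 x : 0 <= Hb x.
    rewrite -lee_fin; apply: le_trans (wH x); apply: integral_ge0 => y _.
    by rewrite lee_fin mulr_ge0 ?expR_ge0// mulr_ge0 ?sqr_ge0.
  apply: (@le_trans _ _ (\int[mu]_x ((kap^-1)%:E * (Hb x)%:E))%E).
    apply: ge0_le_integral => //.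
    - by move=> x _; apply: integral_ge0 => y _; rewrite lee_fin.
    - by apply: (@measurable_fun_fubini_tonelli_F _ _ _ _ _ lam' _ mF) => u; rewrite lee_fin.
    - by apply: measurable_funeM; exact/measurable_EFinP.
  rewrite ge0_integralZl//; last 3 first.
  - exact/measurable_EFinP.
  - by move=> x _; rewrite lee_fin.
  - by rewrite lee_fin invr_ge0 ltW.
  by rewrite EFinM lee_wpmul2l// lee_fin invr_ge0 ltW.
split.
  have := integral_wp_lty mkk k0 kB mw w0 Noo K0 expN'.
  by rewrite lamE.
have mZ := measurable_sample iidX.
have := L1_deviation mkk k0 kB mw w0 mth th0 mthV Noo K0 expN' tha thb n0 mZ (iid_law iidX) z0.
set A := [set om | _] => -[mA PA]; exists A; split => // om nA.
have nR : (0 : R) < n%:R by rewrite ltr0n.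
have sn : 0 < Num.sqrt (n%:R : R) by rewrite sqrtr_gt0.
(* Back from the unnormalised sum to the difference of densities. *)
exists (n%:R^-1 * L1_dev mu lam' k w (sample X om)).
  move: nA; rewrite /A/= => /negP; rewrite -ltNge => H.
  rewrite mulrC ltr_pdivrMr//; apply: (lt_le_trans H).
  have aE : kap * (10 * l) ^+ d = 10 ^+ d * (Num.sqrt l / Num.sqrt sigma) ^+ d * B.
    rewrite /kap -{2}(sqr_sqrtr (ltW l0)) !exprMn exprVn.
    by field; rewrite !gt_eqF ?exprn_gt0.
  have bE : kap^-1 * (B ^+ 2 * sigma ^- d) = (Num.sqrt l / Num.sqrt sigma) ^+ d * B.
    rewrite /kap invfM invrK -{2}(sqr_sqrtr (ltW s0)) !exprMn exprVn.
    by field; rewrite !gt_eqF ?exprn_gt0.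
  rewrite aE bE; set D := (_ / _) ^+ d * B; rewrite -[10 ^+ d * _ * B]mulrA -/D.
  have D0 : 0 <= D by rewrite mulr_ge0 ?(ltW B0)// exprn_ge0// divr_ge0// ltW.
  rewrite [leRHS]mulrDl; apply: lerD; last by rewrite le_eqVlt; apply/orP; left; apply/eqP; ring.
  have -> : 10 ^+ d * D / Num.sqrt n%:R * n%:R = Num.sqrt n%:R * (10 ^+ d * D).
    by rewrite -{2}(sqr_sqrtr (ltW nR)); field; rewrite gt_eqF.
  rewrite -mulrA ler_wpM2l ?sqrtr_ge0//.
  have : D <= 10 ^+ d * D by rewrite ler_peMl// exprn_ege1//; lra.
  by lra.
rewrite EFinM -(L1_devE mkk k0 kB mw w0 Noo K0 expN') lamE -ge0_integralZl//; last 2 first.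
- apply/measurable_EFinP; apply: measurable_funM => //; apply: measurableT_comp => //.
  apply: measurable_sum => i; apply: measurable_funB => //.
  exact: measurable_conv_gauss_dens.
- by move=> y _; rewrite lee_fin mulr_ge0.
apply: eq_integral => y _; rewrite -EFinM; congr EFin.
rewrite mulrCA; congr (_ * _).
rewrite conv_gauss_dens_empirical// -[n%:R^-1 in RHS]ger0_norm ?invr_ge0// -normrM; congr `|_|.
rewrite /dev_sum sumrB sumr_const card_ord -[X in _ = _ * (_ - X)]mulr_natl mulrBr mulKf ?gt_eqF//.
by congr (_ * _ - _); apply: eq_bigr => i _; rewrite tnth_mktuple.
Qed.

End weight.
End gaussian_deviation.

(** * Stability of the Kullback-Leibler divergence *)

Section KL.
Context {R : realType}.

Lemma ln_le_sub1 (x : R) : 0 < x -> ln x <= x - 1.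
Proof. by move=> x0; have := expR_ge1Dx (ln x); rewrite lnK ?posrE//; lra. Qed.

Lemma kl_integrandE (a b : R) : 0 < a -> 0 < b -> kl_integrand a b = a * (ln a - ln b).
Proof. by move=> a0 b0; rewrite /kl_integrand gt_eqF// ln_div ?posrE. Qed.

(** The difference is (a - b)(ln b - ln q) + a (ln a - ln b). When a <= b the second term is at most
    b - a by ln x <= x - 1; when a >= b that inequality and the bound [U] give (a - b)(1 + U). Hence
    [ln a] needs no lower bound, which is essential when [a] is an empirical density. *)
Lemma kl_integrand_diffl (a b q W U : R) : 0 < a -> 0 < b -> 0 < q ->
  `|ln b - ln q| <= W -> 0 <= U -> ln a - ln b <= U ->
  `|kl_integrand a q - kl_integrand b q| <= `|a - b| * (W + 1 + U).
Proof.
move=> a0 b0 q0 hW U0 hU; rewrite !kl_integrandE//.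
have -> : a * (ln a - ln q) - b * (ln b - ln q) =
  (a - b) * (ln b - ln q) + a * (ln a - ln b) by ring.
have W0 : 0 <= W := le_trans (normr_ge0 _) hW.
have ab1 : b * (ln a - ln b) <= a - b.
  rewrite -ln_div ?posrE//; have := ln_le_sub1 (divr_gt0 a0 b0).
  move=> /(ler_wpM2l (ltW b0)); rewrite mulrBr mulr1 mulrCA divff ?gt_eqF// mulr1//.
have ba1 : a * (ln b - ln a) <= b - a.
  rewrite -ln_div ?posrE//; have := ln_le_sub1 (divr_gt0 b0 a0).
  move=> /(ler_wpM2l (ltW a0)); rewrite mulrBr mulr1 mulrCA divff ?gt_eqF// mulr1//.
apply: (le_trans (ler_normD _ _)); rewrite -(addrA W) [leRHS]mulrDr; apply: lerD.
  by rewrite normrM ler_wpM2l.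
have [ab|ab] := leP b a.
  rewrite [`|a - b|]ger0_norm ?subr_ge0// ger0_norm; last first.
    by rewrite mulr_ge0 ?(ltW a0)// subr_ge0 ler_ln ?posrE.
  have : (a - b) * (ln a - ln b) <= (a - b) * U by rewrite ler_wpM2l// subr_ge0.
  lra.
rewrite [`|a - b|]ltr0_norm ?subr_lt0// ler0_norm; last first.
  by rewrite mulr_ge0_le0 ?(ltW a0)// subr_le0 ler_ln ?posrE// ltW.
have : 0 <= (b - a) * U by rewrite mulr_ge0// subr_ge0 ltW.
lra.
Qed.

(** On [m, +oo[ the logarithm is Lipschitz with constant 1 / m, and a / m <= Lam. *)
Lemma kl_integrand_diffr (a b b' m Lam : R) : 0 < a -> 0 < m -> m <= b -> m <= b' ->
  a <= Lam * m ->
  `|kl_integrand a b' - kl_integrand a b| <= Lam * `|b' - b|.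
Proof.
move=> a0 m0 mb mb' aL.
have b0 := lt_le_trans m0 mb; have b'0 := lt_le_trans m0 mb'.
have L0 : 0 < Lam by rewrite -(pmulr_lgt0 _ m0) (lt_le_trans a0).
have key (u v : R) : m <= u -> m <= v -> u <= v -> a * (ln v - ln u) <= Lam * (v - u).
  move=> mu mv uv; have u0 := lt_le_trans m0 mu; have v0 := lt_le_trans m0 mv.
  apply: (@le_trans _ _ (Lam * m * (ln v - ln u))).
    by rewrite ler_wpM2r// subr_ge0 ler_ln ?posrE.
  rewrite -mulrA ler_wpM2l ?(ltW L0)//.
  apply: (@le_trans _ _ (u * (ln v - ln u))).
    by rewrite ler_wpM2r// subr_ge0 ler_ln ?posrE.
  rewrite -ln_div ?posrE//; have := ln_le_sub1 (divr_gt0 v0 u0).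
  by move=> /(ler_wpM2l (ltW u0)); rewrite mulrBr mulr1 mulrCA divff ?gt_eqF// mulr1.
rewrite !kl_integrandE// -mulrBr.
have -> : ln a - ln b' - (ln a - ln b) = ln b - ln b' by ring.
have [bb|bb] := leP b b'.
  rewrite [`|b' - b|]ger0_norm ?subr_ge0// ler0_norm; last first.
    by rewrite mulr_ge0_le0 ?(ltW a0)// subr_le0 ler_ln ?posrE.
  by rewrite -mulrN opprB; exact: key.
rewrite [`|b' - b|]ltr0_norm ?subr_lt0// opprB ger0_norm; last first.
  by rewrite mulr_ge0 ?(ltW a0)// subr_ge0 ler_ln ?posrE// ltW.
by apply: key => //; exact: ltW.
Qed.

Context {dT : measure_display} {T : measurableType dT}.
Variable rho : {measure set T -> \bar R}.

Lemma KL_dens_pos (p q : T -> R) : (forall x, 0 < q x) ->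
  KL_dens rho p q = (\int[rho]_x (kl_integrand (p x) (q x))%:E)%E.
Proof.
move=> q0; rewrite /KL_dens asboolT//.
by apply: aeW => x /eqP; rewrite gt_eqF.
Qed.

Lemma measurable_kl_integrand (p q : T -> R) :
  (forall x, 0 < p x) -> (forall x, 0 < q x) ->
  measurable_fun setT p -> measurable_fun setT q ->
  measurable_fun setT (fun x => kl_integrand (p x) (q x)).
Proof.
move=> p0 q0 mp mq.
rewrite (_ : (fun x => _) = fun x => p x * (ln (p x) - ln (q x))); last first.
  by apply/funext => x; rewrite kl_integrandE.
apply: measurable_funM => //; apply: measurable_funB.
  exact: (measurableT_comp (@measurable_ln R) mp).
exact: (measurableT_comp (@measurable_ln R) mq).
Qed.

(** The integrable majorant [G] makes the second divergence finite, so the difference in the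
    extended reals is meaningful and equals the integral of the pointwise difference, controlled by
    [W]. *)
Lemma KL_dens_dist (p' q' p q G W : T -> R) (t : R) :
  (forall x, 0 < p' x) -> (forall x, 0 < q' x) ->
  (forall x, 0 < p x) -> (forall x, 0 < q x) ->
  measurable_fun setT p' -> measurable_fun setT q' ->
  measurable_fun setT p -> measurable_fun setT q ->
  measurable_fun setT G -> measurable_fun setT W ->
  (forall x, `|kl_integrand (p x) (q x)| <= G x) ->
  (\int[rho]_x (G x)%:E < +oo)%E ->
  (forall x, `|kl_integrand (p' x) (q' x) - kl_integrand (p x) (q x)| <= W x) ->
  (\int[rho]_x (W x)%:E <= t%:E)%E ->
  (`|KL_dens rho p' q' - KL_dens rho p q| <= t%:E)%E.
Proof.
move=> p'0 q'0 p0 q0 mp' mq' mp mq mG mW klG Goo klW Wt.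
rewrite !KL_dens_pos//.
pose f x := kl_integrand (p' x) (q' x); pose g x := kl_integrand (p x) (q x).
have mf : measurable_fun setT f by exact: measurable_kl_integrand.
have mg : measurable_fun setT g by exact: measurable_kl_integrand.
have ig : rho.-integrable setT (EFin \o g).
  apply/integrableP; split; first exact/measurable_EFinP.
  apply: le_lt_trans Goo; apply: ge0_le_integral => //.
  - by apply: measurableT_comp => //; exact/measurable_EFinP.
  - exact/measurable_EFinP.
  - by move=> x _; rewrite /= lee_fin; exact: klG.
have mfg : measurable_fun setT (fun x => f x - g x) by exact: measurable_funB.
have intfg : (\int[rho]_x `|(f x - g x)%:E| <= t%:E)%E.
  apply: le_trans Wt; apply: ge0_le_integral => //.
  - by apply: measurableT_comp => //; exact/measurable_EFinP.
  - exact/measurable_EFinP.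
  - by move=> x _; rewrite /= lee_fin; exact: klW.
have ifg : rho.-integrable setT (EFin \o (fun x => f x - g x)).
  apply/integrableP; split; first exact/measurable_EFinP.
  by apply: le_lt_trans intfg _; rewrite ltry.
have -> : (\int[rho]_x (f x)%:E = \int[rho]_x (g x)%:E + \int[rho]_x (f x - g x)%:E)%E.
  rewrite -integralD//; apply: eq_integral => x _.
  by rewrite /= -EFinD; congr EFin; rewrite addrC subrK.
rewrite addeAC subee; last exact: integrable_fin_num.
rewrite add0e; apply: le_trans intfg.
by apply: le_abse_integral => //; exact/measurable_EFinP.
Qed.

End KL.

(** * Pointwise bounds on smoothed densities *)

Section densities.
Context {R : realType} (d : nat) (sigma : R).
Hypotheses (d1 : (0 < d)%N) (s0 : 0 < sigma).
Notation T := (d.-tuple R).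

Lemma measurable_gauss_dens_fst (y : T) :
  measurable_fun setT (fun x : T => gauss_dens sigma (vsub y x)).
Proof.
apply: (@measurableT_comp _ _ _ _ _ _
  (fun z : d.-tuple R * d.-tuple R => gauss_dens sigma (vsub z.2 z.1)) _ (fun x => (x, y))).
  exact: measurable_gauss_dens.
exact: measurable_fun_pair.
Qed.

Lemma measurable_gauss_dens_snd (x : T) :
  measurable_fun setT (fun y : T => gauss_dens sigma (vsub y x)).
Proof.
apply: (@measurableT_comp _ _ _ _ _ _
  (fun z : d.-tuple R * d.-tuple R => gauss_dens sigma (vsub z.2 z.1)) _ (fun y => (x, y))).
  exact: measurable_gauss_dens.
exact: pair1_measurable.
Qed.

Lemma measurable_conv_empirical n (x : 'I_n -> T) : (0 < n)%N ->
  measurable_fun setT (conv_gauss_dens sigma (empirical x)).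
Proof.
move=> n0; rewrite (_ : conv_gauss_dens _ _ = fun y =>
  n%:R^-1 * \sum_(i < n) gauss_dens sigma (vsub y (x i))); last first.
  by apply/funext => y; exact: conv_gauss_dens_empirical.
apply: measurable_funM => //; apply: measurable_sum => i.
exact: measurable_gauss_dens_snd.
Qed.

Lemma conv_empirical_bounds n (x : 'I_n -> T) y (a b : R) : (0 < n)%N ->
  (forall i, a <= gauss_dens sigma (vsub y (x i)) <= b) ->
  a <= conv_gauss_dens sigma (empirical x) y <= b.
Proof.
move=> n0 H; rewrite conv_gauss_dens_empirical//.
have nR : (0 : R) < n%:R by rewrite ltr0n.
rewrite mulrC ler_pdivlMr// ler_pdivrMr//; apply/andP; split.
  rewrite mulr_natr -[n in leLHS](card_ord n) -sumr_const.
  by apply: ler_sum => i _; have /andP[] := H i.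
rewrite mulr_natr -[n in leRHS](card_ord n) -sumr_const.
by apply: ler_sum => i _; have /andP[] := H i.
Qed.

Lemma conv_empirical_gt0 n (x : 'I_n -> T) y : (0 < n)%N ->
  0 < conv_gauss_dens sigma (empirical x) y.
Proof.
move=> n0; rewrite conv_gauss_dens_empirical// mulr_gt0 ?invr_gt0 ?ltr0n//.
rewrite (bigD1 (Ordinal n0))//= ltr_wpDr ?gauss_dens_gt0// sumr_ge0// => i _.
by rewrite ltW// gauss_dens_gt0.
Qed.

Lemma conv_empirical_le n (x : 'I_n -> T) y : (0 < n)%N ->
  conv_gauss_dens sigma (empirical x) y <= gauss_peak d sigma.
Proof.
move=> n0.
have /andP[] // : 0 <= conv_gauss_dens sigma (empirical x) y <= gauss_peak d sigma.
by apply: conv_empirical_bounds => // i; rewrite ltW ?gauss_dens_gt0// gauss_dens_le.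
Qed.

Lemma conv_le (mu : probability T R) y : conv_gauss_dens sigma mu y <= gauss_peak d sigma.
Proof.
rewrite -lee_fin -conv_gauss_densE//.
rewrite -[leRHS]mule1 -[X in (_ * X)%E](@probability_setT _ _ _ mu) -integral_cst//.
apply: ge0_le_integral => //.
- by move=> x _; rewrite lee_fin ltW// gauss_dens_gt0.
- by apply/measurable_EFinP; exact: measurable_gauss_dens_fst.
- by move=> x _; rewrite lee_fin gauss_dens_le.
Qed.

Lemma measurable_vnorm2 : measurable_fun setT (fun x : T => vnorm x ^+ 2).
Proof. by apply: measurable_funX; exact: measurable_vnorm. Qed.

(* Jensen's inequality through the tangent line of exp at the mean exponent. *)
Lemma conv_ge (mu : probability T R) (M : R) y : 0 <= M ->
  (\int[mu]_x (vnorm x ^+ 2)%:E <= M%:E)%E ->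
  gauss_peak d sigma * expR (- ((vnorm y ^+ 2 + M) / sigma ^+ 2)) <=
    conv_gauss_dens sigma mu y.
Proof.
move=> M0 intM.
pose U := (vnorm y ^+ 2 + M) / sigma ^+ 2; rewrite -/U.
pose c := gauss_peak d sigma * expR (- U).
have c0 : 0 < c by rewrite mulr_gt0 ?gauss_peak_gt0// expR_gt0.
have s20 : 0 < sigma ^+ 2 by rewrite exprn_gt0.
have q0 x : 0 <= gauss_dens sigma (vsub y x) by rewrite ltW// gauss_dens_gt0.
have cs0 : 0 <= c / sigma ^+ 2 by rewrite divr_ge0// ltW.
(* The quadratic term of the tangent inequality is placed on the side of the density, so that both
   integrands are nonnegative. *)
have H : ((c * (1 + M / sigma ^+ 2))%:E <=
   \int[mu]_x (1 * gauss_dens sigma (vsub y x) + c / sigma ^+ 2 * vnorm x ^+ 2 + 0)%:E)%E.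
  rewrite -[leLHS]mule1 -[X in (_ * X <= _)%E](@probability_setT _ _ _ mu) -integral_cst//.
  apply: ge0_le_integral => //.
  - by move=> x _; rewrite lee_fin mulr_ge0 ?(ltW c0)// addr_ge0// divr_ge0// ltW.
  - apply/measurable_EFinP; apply: measurable_funD => //; apply: measurable_funD.
      by apply: measurable_funM => //; exact: measurable_gauss_dens_fst.
    by apply: measurable_funM => //; exact: measurable_vnorm2.
  - move=> x _; rewrite lee_fin addr0 mul1r gauss_densE.
    pose v := vnorm (vsub y x) ^+ 2 / (2 * sigma ^+ 2); rewrite -/v.
    have vle : v <= (vnorm y ^+ 2 + vnorm x ^+ 2) / sigma ^+ 2.
      rewrite /v ler_pdivrMr ?mulr_gt0// (_ : _ / _ * _ = 2 * vnorm y ^+ 2 + 2 * vnorm x ^+ 2).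
        exact: vnorm_vsub_sqr_le.
      by field; rewrite gt_eqF.
    (* The tangent of exp at [- U], the lower bound for the mean exponent. *)
    have : c * (1 + (U - v)) <= gauss_peak d sigma * expR (- v).
      have -> : expR (- v) = expR (- U) * expR (U - v) by rewrite -expRD; congr expR; ring.
      by rewrite mulrA ler_wpM2l ?(ltW c0)// expR_ge1Dx.
    have : c * (U - (vnorm y ^+ 2 + vnorm x ^+ 2) / sigma ^+ 2) <= c * (U - v).
      by rewrite ler_wpM2l ?(ltW c0)// lerB.
    have -> : U - (vnorm y ^+ 2 + vnorm x ^+ 2) / sigma ^+ 2 = M / sigma ^+ 2 - vnorm x ^+ 2 / sigma ^+ 2.
      by rewrite /U; field; rewrite gt_eqF.
    have -> : c / sigma ^+ 2 * vnorm x ^+ 2 = c * (vnorm x ^+ 2 / sigma ^+ 2) by ring.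
    lra.
rewrite (@ge0_integral_affine _ _ _ mu _ (fun x : T => vnorm x ^+ 2) _ _ _ q0
  (measurable_gauss_dens_fst y) (fun x => sqr_ge0 _) measurable_vnorm2 ler01 cs0 (lexx 0)) in H.
rewrite conv_gauss_densE// mul1e adde0 in H.
have : ((c * (1 + M / sigma ^+ 2))%:E <= (conv_gauss_dens sigma mu y)%:E + (c / sigma ^+ 2)%:E * M%:E)%E.
  by apply: (le_trans H); rewrite leeD2l// lee_wpmul2l.
rewrite -EFinM -EFinD lee_fin -/c.
have -> : c / sigma ^+ 2 * M = c * (M / sigma ^+ 2) by ring.
lra.
Qed.

End densities.

(** * Moments and rates *)

Section moments.
Context {R : realType} {d : nat}.
Notation T := (d.-tuple R).
Implicit Type mu : probability T R.
Let e : R := expR 1.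

Lemma measurable_outside_ball (r : R) : measurable [set x : T | r < vnorm x].
Proof.
rewrite (_ : [set x | _] = ~` [set x : T | vnorm x <= r]); last first.
  by apply/seteqP; split => x /=; rewrite ltNge => /negP.
apply: measurableC.
have := @measurable_fun_le _ _ _ setT (@vnorm R d) (cst r) measurableT.
by rewrite setTI; apply => //; exact: measurable_vnorm.
Qed.

Lemma integral_supp_in_ball_le mu (r b : R) (f : T -> R) : supp_in_ball r mu ->
  0 <= b -> measurable_fun setT f -> (forall x, 0 <= f x) ->
  (forall x, vnorm x <= r -> f x <= b) -> (\int[mu]_x (f x)%:E <= b%:E)%E.
Proof.
move=> supp b0 mf f0 fb.
rewrite -[leRHS]mule1 -[X in (_ * X)%E](@probability_setT _ _ _ mu) -integral_cst//.
apply: ae_ge0_le_integral => //.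
- by move=> x _; rewrite lee_fin.
- exact/measurable_EFinP.
exists [set x | r < vnorm x]; split => //.
  exact: measurable_outside_ball.
move=> x /= H; rewrite ltNge; apply/negP => xr; apply: H => _.
by rewrite lee_fin fb.
Qed.

(** Since p >= 2, u^2 <= 1 + u^p for u >= 0, whence e^(u^2) <= e e^(u^p), and the mean of e^(u^p) is
    at most 2. *)
Lemma psi_norm_exp_moment mu (p L : R) : 0 < L -> 2 <= p -> (psi_norm p mu <= L%:E)%E ->
  (\int[mu]_x (expR (vnorm x ^+ 2 / (4 * L ^+ 2)))%:E <= (2 * e)%:E)%E.
Proof.
move=> L0 p2 psi.
(* The infimum need not be attained; doubling [L] yields an admissible c < 2 L, which is where 4 L^2
   comes from. *)
have : (psi_norm p mu < (2 * L)%:E)%E.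
  by apply: (le_lt_trans psi); rewrite lte_fin; lra.
move=> /ereal_inf_lt[_ [c [c0 intc] <-]]; rewrite lte_fin => cL.
pose h (x : T) := expR ((vnorm x / c) `^ p) - 1.
have h0 x : 0 <= h x by rewrite subr_ge0 -expR0 ler_expR powR_ge0.
have mh : measurable_fun setT h.
  apply: measurable_funB => //; apply: measurableT_comp => //.
  apply: (measurableT_comp (measurable_powR p)); apply: measurable_funM => //.
  exact: measurable_vnorm.
have e0 : 0 <= e := expR_ge0 _.
apply: (@le_trans _ _ (\int[mu]_x (e * h x + 0 * h x + e)%:E)%E).
  apply: ge0_le_integral => //.
  - apply/measurable_EFinP; apply: measurableT_comp => //; apply: measurable_funM => //.
    exact: measurable_vnorm2.
  - apply/measurable_EFinP; apply: measurable_funD => //; apply: measurable_funD; exact: measurable_funM.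
  - move=> x _; rewrite lee_fin mul0r addr0 /h mulrBr mulr1 subrK -expRD ler_expR.
    set u := vnorm x / c.
    have u0 : 0 <= u by rewrite divr_ge0 ?vnorm_ge0// ltW.
    apply: (@le_trans _ _ (u ^+ 2)).
      rewrite /u expr_div_n ler_wpM2l ?sqr_ge0// lef_pV2 ?posrE ?mulr_gt0 ?exprn_gt0//.
      have -> : 4 * L ^+ 2 = (2 * L) ^+ 2 by ring.
      by rewrite lerXn2r ?nnegrE ?mulr_ge0 ?(ltW c0)// ltW.
    have [u1|u1] := leP u 1.
      have : u ^+ 2 <= 1 by rewrite exprn_ile1.
      by have := powR_ge0 u p; lra.
    have : u ^+ 2 <= u `^ p by rewrite -powR_mulrn// ler_powR// ltW.
    lra.
rewrite ge0_integral_affine// mul0e adde0.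
apply: (@le_trans _ _ (e%:E * 1%:E + e%:E)%E).
  by rewrite leeD2r// lee_wpmul2l.
by rewrite -EFinM -EFinD lee_fin; lra.
Qed.

Lemma second_moment_of_exp mu (L : R) : 0 < L ->
  (\int[mu]_x (expR (vnorm x ^+ 2 / (4 * L ^+ 2)))%:E <= (2 * e)%:E)%E ->
  (\int[mu]_x (vnorm x ^+ 2)%:E <= (8 * e * L ^+ 2)%:E)%E.
Proof.
move=> L0 H.
have L20 : 0 < 4 * L ^+ 2 by rewrite mulr_gt0// exprn_gt0.
apply: (@le_trans _ _ (\int[mu]_x ((4 * L ^+ 2)%:E * (expR (vnorm x ^+ 2 / (4 * L ^+ 2)))%:E))%E).
  apply: ge0_le_integral => //.
  - by move=> x _; rewrite lee_fin sqr_ge0.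
  - by apply/measurable_EFinP; exact: measurable_vnorm2.
  - apply: measurable_funeM; apply/measurable_EFinP; apply: measurableT_comp => //.
    by apply: measurable_funM => //; exact: measurable_vnorm2.
  - move=> x _; rewrite -EFinM lee_fin.
    have := expR_ge1Dx (vnorm x ^+ 2 / (4 * L ^+ 2)).
    by rewrite -ler_pdivrMl// mulrC; lra.
rewrite ge0_integralZl//; last 2 first.
- apply/measurable_EFinP; apply: measurableT_comp => //.
  by apply: measurable_funM => //; exact: measurable_vnorm2.
- by rewrite lee_fin ltW.
apply: (@le_trans _ _ ((4 * L ^+ 2)%:E * (2 * e)%:E)%E).
  by apply: lee_wpmul2l => //; rewrite lee_fin ltW.
by rewrite -EFinM lee_fin; lra.
Qed.

Lemma SG_second_moment mu (L : R) : 1 <= L -> (0 < d)%N -> SG L mu ->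
  (\int[mu]_x (vnorm x ^+ 2)%:E <= ((2 + 16 * e) * L ^+ 2 * d%:R)%:E)%E.
Proof.
move=> L1 d1 [s2 [s20 [[_ sub] maxL]]].
set m := mean_vec mu in sub maxL.
have L0 : 0 < L by lra.
have [s2L mL] : s2 <= L /\ vnorm m <= L by move: maxL; rewrite ge_max => /andP[].
have e0 : 0 <= e := expR_ge0 _.
(* Test vectors of length L^(-1/2) along an axis make the sub-Gaussian exponent at most 1/2. The two
   signs together dominate e^|t v|, which dominates (t v)^2 / 4, so each coordinate has variance at
   most 8 e L. *)
pose t := (Num.sqrt L)^-1.
have t0 : 0 < t by rewrite invr_gt0 sqrtr_gt0.
have t2 : t ^+ 2 = L^-1 by rewrite exprVn sqr_sqrtr// ltW.
have mv i : measurable_fun setT (fun x : T => tnth x i - tnth m i).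
  by apply: measurable_funB => //; exact: measurable_tnth.
have mgf i (a : R) : a ^+ 2 = L^-1 ->
    (\int[mu]_x (expR (a * (tnth x i - tnth m i)))%:E <= e%:E)%E.
  move=> a2; pose u : T := [tuple if j == i then a else 0 | j < d].
  have := sub u.
  under eq_integral => x _.
    rewrite (_ : vdot _ _ = a * (tnth x i - tnth m i)); last first.
      rewrite /vdot (bigD1 i)//= !tnth_mktuple eqxx big1 ?addr0// => j /negbTE ji.
      by rewrite !tnth_mktuple ji mul0r.
    over.
  move=> /le_trans; apply; rewrite lee_fin ler_expR vnorm2E (bigD1 i)//= big1; last first.
    by move=> j /negbTE ji; rewrite tnth_mktuple ji expr0n.
  rewrite tnth_mktuple eqxx addr0 a2.
  have : s2 / L <= 1 by rewrite ler_pdivrMr// mul1r.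
  have : 0 <= s2 / L by rewrite divr_ge0// ltW.
  lra.
have var i : (\int[mu]_x ((tnth x i - tnth m i) ^+ 2)%:E <= (8 * e * L)%:E)%E.
  pose f (x : T) := expR (t * (tnth x i - tnth m i)).
  pose g (x : T) := expR (- t * (tnth x i - tnth m i)).
  have mf : measurable_fun setT f by apply: measurableT_comp => //; exact: measurable_funM.
  have mg : measurable_fun setT g by apply: measurableT_comp => //; exact: measurable_funM.
  have L40 : 0 <= 4 * L by lra.
  apply: (@le_trans _ _ (\int[mu]_x (4 * L * f x + 4 * L * g x + 0)%:E)%E).
    apply: ge0_le_integral => //.
    - by move=> x _; rewrite lee_fin sqr_ge0.
    - by apply/measurable_EFinP; exact: measurable_funX.
    - by apply/measurable_EFinP; apply: measurable_funD => //; apply: measurable_funD; exact: measurable_funM.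
    - move=> x _; rewrite lee_fin addr0 /f /g mulNr; set v := tnth x i - tnth m i.
      have := sqr_le_expR (normr_ge0 (t * v)).
      rewrite real_normK ?num_real// exprMn t2.
      have : expR `|t * v| <= expR (t * v) + expR (- (t * v)).
        have := expR_ge0 (t * v); have := expR_ge0 (- (t * v)).
        by case: (ger0P (t * v)) => _; lra.
      move=> H1 H2; have : v ^+ 2 <= L * (4 * (expR (t * v) + expR (- (t * v)))).
        rewrite -ler_pdivrMl//; lra.
      lra.
  rewrite (ge0_integral_affine mu (fun x => expR_ge0 _) mf (fun x => expR_ge0 _) mg L40 L40 (lexx 0)) adde0.
  apply: (@le_trans _ _ ((4 * L)%:E * e%:E + (4 * L)%:E * e%:E)%E).
    apply: leeD; apply: lee_wpmul2l; rewrite ?lee_fin//; apply: mgf => //.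
    by rewrite sqrrN.
  by rewrite -EFinM -EFinD lee_fin; lra.
have vsubE x : vnorm (vsub x m) ^+ 2 = \sum_(i < d) (tnth x i - tnth m i) ^+ 2.
  by rewrite vnorm2E; apply: eq_bigr => i _; rewrite tnth_mktuple.
have mvs : measurable_fun setT (fun x : T => vnorm (vsub x m) ^+ 2).
  rewrite (_ : (fun x => _) = fun x : T => \sum_(i < d) (tnth x i - tnth m i) ^+ 2).
    by apply: measurable_sum => i; exact: measurable_funX.
  by apply/funext => x; exact: vsubE.
have var_sum : (\int[mu]_x (vnorm (vsub x m) ^+ 2)%:E <= (d%:R * (8 * e * L))%:E)%E.
  under eq_integral do rewrite vsubE -sumEFin.
  rewrite ge0_integral_sum//; last 2 first.
  - by move=> i; apply/measurable_EFinP; exact: measurable_funX.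
  - by move=> i x _; rewrite lee_fin sqr_ge0.
  rewrite mulr_natl -[n in (_ *+ n)%:E](card_ord d) -sumr_const -sumEFin.
  by apply: lee_sum => i _; exact: var.
have m20 : 0 <= 2 * vnorm m ^+ 2 by rewrite mulr_ge0// sqr_ge0.
have twoR : 0 <= (2 : R) by [].
apply: (@le_trans _ _ (\int[mu]_x (2 * vnorm (vsub x m) ^+ 2 + 0 * vnorm (vsub x m) ^+ 2 + 2 * vnorm m ^+ 2)%:E)%E).
  apply: ge0_le_integral => //.
  - by move=> x _; rewrite lee_fin sqr_ge0.
  - by apply/measurable_EFinP; exact: measurable_vnorm2.
  - by apply/measurable_EFinP; apply: measurable_funD => //; apply: measurable_funD; exact: measurable_funM.
  - by move=> x _; rewrite lee_fin; have := vnorm_sqr_le x m; lra.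
rewrite (ge0_integral_affine mu (fun x => sqr_ge0 _) mvs (fun x => sqr_ge0 _) mvs twoR (lexx 0) m20).
rewrite mul0e adde0.
apply: (@le_trans _ _ (2%:E * (d%:R * (8 * e * L))%:E + (2 * L ^+ 2)%:E)%E).
  apply: leeD; first exact: lee_wpmul2l.
  rewrite lee_fin ler_wpM2l// lerXn2r ?nnegrE ?vnorm_ge0//; lra.
rewrite -EFinM -EFinD lee_fin.
have dR : (1 : R) <= d%:R by rewrite ler1n.
have LL : L <= L ^+ 2 by rewrite expr2 ler_peMr//; lra.
have : d%:R * (8 * e * L) <= d%:R * (8 * e * L ^+ 2) by rewrite ler_wpM2l// ler_wpM2l// mulr_ge0.
have : L ^+ 2 * 1 <= L ^+ 2 * d%:R by rewrite ler_wpM2l// sqr_ge0.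
lra.
Qed.

End moments.

Section rates.
Context {R : realType}.
Let e : R := expR 1.

Lemma e_ge2 : 2 <= e. Proof. by have := expR_ge1Dx (1 : R); rewrite /e; lra. Qed.

Lemma powR_half (x : R) (d : nat) : 0 <= x -> x `^ (d%:R / 2) = Num.sqrt x ^+ d.
Proof.
by move=> x0; rewrite mulrC powRrM powR12_sqrt// powR_mulrn// sqrtr_ge0.
Qed.

(** The exponent [a] is slack, since l' >= 1; it is 1 for laws in a ball and 2 for sub-Gaussian
    laws. *)
Lemma dimension_rate (d : nat) (l l' sigma a : R) : (0 < d)%N -> 0 < sigma ->
  0 < l -> l <= l' -> 1 <= l' -> 0 <= a ->
  10 ^+ d * (Num.sqrt l / Num.sqrt sigma) ^+ d <=
  (3 * e * d%:R) ^+ (3 * (d + 2)) * l' `^ (d%:R / 2 + a) * sigma `^ (- (d%:R / 2)).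
Proof.
move=> d1 s0 l0 ll' l'1 a0.
have ed : 6 <= 3 * e * d%:R.
  have : (1 : R) <= d%:R by rewrite ler1n.
  by have := e_ge2; nra.
have l'0 : 0 <= l' by lra.
rewrite expr_div_n mulrA powRN powR_half ?(ltW s0)//.
have exp_sqrt_ge0 (x : R) : 0 <= Num.sqrt x ^+ d by rewrite exprn_ge0// sqrtr_ge0.
have ten0 : 0 <= (10 : R) ^+ d by rewrite exprn_ge0.
apply: ler_wpM2r; first by rewrite invr_ge0.
apply: ler_pM => //.
  (* 3 e d >= 6, so its cube exceeds 10 and (3 e d)^(3 d) absorbs 10^d; the six remaining factors
     are at least 1. *)
  rewrite mulnDr exprD exprM -[leLHS]mulr1; apply: ler_pM => //.
    rewrite lerXn2r ?nnegrE ?exprn_ge0//; try lra.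
    have : (6 : R) ^+ 3 <= (3 * e * d%:R) ^+ 3 by rewrite lerXn2r ?nnegrE//; lra.
    lra.
  by rewrite exprn_ege1//; lra.
rewrite powRD; last by apply/implyP => _; rewrite gt_eqF//; lra.
rewrite powR_half// -[leLHS]mulr1; apply: ler_pM => //.
  by rewrite lerXn2r ?nnegrE ?sqrtr_ge0// ler_wsqrtr.
by rewrite -(powRr0 l') ler_powR.
Qed.

Lemma sample_rate (n : nat) (tau : R) : (0 < n)%N -> 0 <= tau ->
  (Num.sqrt n%:R)^-1 <= n%:R `^ (- ((1 - tau) / 2)) :> R.
Proof.
move=> n1 t0; rewrite -powR12_sqrt// -powRN ler_powR ?ler1n//; lra.
Qed.

End rates.

(** * Sub-Gaussian laws *)

Section weighted_kernel.
Context {R : realType} (d : nat) (sigma : R).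
Hypotheses (d1 : (0 < d)%N) (s0 : 0 < sigma).
Variable (lam : {measure set (d.-tuple R) -> \bar R}).
Hypothesis Hlam : is_lebesgue_Rd lam.
Notation T := (d.-tuple R).
Variables (w : T -> R) (x : T) (c : R).
Hypotheses (mw : measurable_fun setT w) (w0 : forall y, 0 <= w y) (c0 : 0 <= c).

Let mvx : measurable_fun setT (fun y : T => vnorm (vsub y x) ^+ 2).
Proof.
apply: measurable_funX.
apply: (@measurableT_comp _ _ _ _ _ _ (fun z : T * T => vnorm (vsub z.2 z.1)) _ (fun y => (x, y))).
  exact: measurable_vnorm_vsub.
exact: pair1_measurable.
Qed.

Let mexp (b : R) : measurable_fun setT (fun y : T => expR (vnorm (vsub y x) ^+ 2 / b)).
Proof. by apply: measurableT_comp => //; exact: measurable_funM. Qed.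

(** The hypothesis measures [w] against the tilt under which the Gaussian still has mass at most
    2. *)
Lemma integral_weight_gauss_le :
  (forall y, w y <= c * expR (vnorm (vsub y x) ^+ 2 / (4 * d%:R * sigma ^+ 2))) ->
  (\int[lam]_y (w y * gauss_dens sigma (vsub y x))%:E <= (c * 2)%:E)%E.
Proof.
move=> wc; have k0 y : 0 < gauss_dens sigma (vsub y x) by exact: gauss_dens_gt0.
have mk := @measurable_gauss_dens_snd R d sigma x.
apply: (@le_trans _ _ (\int[lam]_y (c%:E * (gauss_dens sigma (vsub y x) *
    expR (vnorm (vsub y x) ^+ 2 / (4 * d%:R * sigma ^+ 2)))%:E))%E).
  apply: ge0_le_integral => //.
  - by move=> y _; rewrite lee_fin mulr_ge0// ltW.
  - by apply/measurable_EFinP; exact: measurable_funM.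
  - by apply: measurable_funeM; apply/measurable_EFinP; exact: measurable_funM.
  - by move=> y _; rewrite -EFinM lee_fin mulrC mulrCA ler_wpM2l// ltW.
rewrite ge0_integralZl//; last 2 first.
- by apply/measurable_EFinP; exact: measurable_funM.
- by move=> y _; rewrite lee_fin mulr_ge0 ?expR_ge0// ltW.
by rewrite EFinM lee_wpmul2l// integral_gauss_tilt.
Qed.

(** The squared weight and the inverse of the auxiliary weight may together use three quarters of
    the exponent of the squared kernel. *)
Lemma integral_weight_gauss_sq_le (l : R) :
  (forall y, w y ^+ 2 * expR (vnorm y ^+ 2 / (25 * l ^+ 2)) <=
     c * expR (3 * vnorm (vsub y x) ^+ 2 / (4 * sigma ^+ 2))) ->
  (\int[lam]_y (w y ^+ 2 * gauss_dens sigma (vsub y x) ^+ 2 *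
      expR (vnorm y ^+ 2 / (25 * l ^+ 2)))%:E <= (c * sigma ^- d)%:E)%E.
Proof.
move=> wc; have k0 y : 0 < gauss_dens sigma (vsub y x) by exact: gauss_dens_gt0.
have mk := @measurable_gauss_dens_snd R d sigma x.
have mE : measurable_fun setT (fun y : T => gauss_peak d sigma ^+ 2 *
    expR (- (vnorm (vsub y x) ^+ 2 / (4 * sigma ^+ 2)))).
  apply: measurable_funM => //; apply: measurableT_comp => //; apply: measurableT_comp => //.
  exact: measurable_funM.
apply: (@le_trans _ _ (\int[lam]_y (c%:E * (gauss_peak d sigma ^+ 2 *
    expR (- (vnorm (vsub y x) ^+ 2 / (4 * sigma ^+ 2))))%:E))%E).
  apply: ge0_le_integral => //.
  - by move=> y _; rewrite lee_fin mulr_ge0 ?expR_ge0// mulr_ge0 ?sqr_ge0.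
  - apply/measurable_EFinP; apply: measurable_funM.
      by apply: measurable_funM; exact: measurable_funX.
    by apply: measurableT_comp => //; apply: measurable_funM => //; exact: measurable_vnorm2.
  - by apply: measurable_funeM; exact/measurable_EFinP.
  - move=> y _; rewrite -EFinM lee_fin mulrAC.
    apply: (le_trans (ler_wpM2r (sqr_ge0 _) (wc y))).
    have -> : gauss_dens sigma (vsub y x) ^+ 2 =
        gauss_peak d sigma ^+ 2 * expR (- (vnorm (vsub y x) ^+ 2 / sigma ^+ 2)).
      rewrite gauss_densE exprMn -expRM_natl; congr (_ * expR _).
      by field; rewrite gt_eqF.
    rewrite -(mulrA c) ler_wpM2l// mulrCA ler_wpM2l ?sqr_ge0// -expRD.
    rewrite ler_expR le_eqVlt; apply/orP; left; apply/eqP.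
    by field; rewrite gt_eqF.
rewrite ge0_integralZl//; last 2 first.
- exact/measurable_EFinP.
- by move=> y _; rewrite lee_fin mulr_ge0 ?sqr_ge0 ?expR_ge0.
by rewrite EFinM lee_wpmul2l// integral_gauss_sq.
Qed.

End weighted_kernel.

Section one_sample.
Context {R : realType}.
Let e : R := expR 1.
(* Makes 3 |y|^2 + tail_const L^2 d dominate 3 |y|^2 + 2 M1 + M2 + sigma^2 for
   the second moments M1 <= 8 e L^2 and M2 of the two laws. *)
Definition tail_const : R := 3 + 32 * e.
(** Bounds the mean of e^(Nb / (48 D)) in [KL_one_sample]: the constant part of Nb / (48 D) is (2
    tail_const + 48) / 48, and its quadratic part falls under the moment bound 2 e. *)
Definition exp_moment_const : R := expR ((2 * tail_const + 48) / 48) * (2 * e).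

(** Jensen places the logarithms of the densities of [mu] and [nu] within [U] and [V] below that of
    the peak. The empirical density is only compared with the peak from above. The resulting
    Lipschitz factor is U + V + 1 + U, which is what [w] has to dominate. *)
Lemma KL_gauss_dist_le d (lam : {measure set (d.-tuple R) -> \bar R}) (sigma M1 M2 t : R)
    n (x : 'I_n -> d.-tuple R) (mu nu : probability (d.-tuple R) R) (w : d.-tuple R -> R) :
  (0 < n)%N -> 0 < sigma -> 0 <= M1 -> 0 <= M2 ->
  (\int[mu]_x (vnorm x ^+ 2)%:E <= M1%:E)%E -> (\int[nu]_x (vnorm x ^+ 2)%:E <= M2%:E)%E ->
  measurable_fun setT w ->
  (forall y, 3 * vnorm y ^+ 2 + 2 * M1 + M2 + sigma ^+ 2 <= w y * sigma ^+ 2) ->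
  (\int[lam]_y (w y * conv_gauss_dens sigma mu y)%:E < +oo)%E ->
  (\int[lam]_y (w y * `|conv_gauss_dens sigma (empirical x) y -
                       conv_gauss_dens sigma mu y|)%:E <= t%:E)%E ->
  (`| KL_gauss lam sigma (empirical x) nu - KL_gauss lam sigma mu nu | <= t%:E)%E.
Proof.
move=> n0 s0 M10 M20 intM1 intM2 mw hw wp tE.
have s20 : 0 < sigma ^+ 2 by rewrite exprn_gt0.
pose p' := conv_gauss_dens sigma (empirical x).
pose pm := conv_gauss_dens sigma mu; pose q := conv_gauss_dens sigma nu.
pose U (y : d.-tuple R) := (vnorm y ^+ 2 + M1) / sigma ^+ 2.
pose V (y : d.-tuple R) := (vnorm y ^+ 2 + M2) / sigma ^+ 2.
have c0 : 0 < gauss_peak d sigma by exact: gauss_peak_gt0.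
have U0 y : 0 <= U y by rewrite divr_ge0 ?addr_ge0 ?sqr_ge0.
have V0 y : 0 <= V y by rewrite divr_ge0 ?addr_ge0 ?sqr_ge0.
have pmL y : gauss_peak d sigma * expR (- U y) <= pm y by exact: conv_ge.
have qL y : gauss_peak d sigma * expR (- V y) <= q y by exact: conv_ge.
have pm0 y : 0 < pm y by apply: lt_le_trans (pmL y); rewrite mulr_gt0 ?expR_gt0.
have q0 y : 0 < q y by apply: lt_le_trans (qL y); rewrite mulr_gt0 ?expR_gt0.
have p'0 y : 0 < p' y by exact: conv_empirical_gt0.
have lnc (a u : R) : 0 < a -> gauss_peak d sigma * expR (- u) <= a -> a <= gauss_peak d sigma ->
    ln (gauss_peak d sigma) - u <= ln a /\ ln a <= ln (gauss_peak d sigma).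
  move=> a0 h1 h2; split; last by rewrite ler_ln ?posrE.
  rewrite -[- u]expRK -lnM ?posrE ?expR_gt0// ler_ln ?posrE//.
  by rewrite mulr_gt0// expR_gt0.
have lnpm y := lnc (pm y) (U y) (pm0 y) (pmL y) (conv_le s0 mu y).
have lnq y := lnc (q y) (V y) (q0 y) (qL y) (conv_le s0 nu y).
have lnp' y : ln (p' y) <= ln (gauss_peak d sigma).
  by rewrite ler_ln ?posrE//; exact: conv_empirical_le.
have lnpq y : `|ln (pm y) - ln (q y)| <= U y + V y.
  have [h1 h2] := lnpm y; have [h3 h4] := lnq y; have := U0 y; have := V0 y.
  by rewrite ler_norml => *; apply/andP; split; lra.
have UVw y : U y + V y + 1 + U y <= w y.
  have -> : U y + V y + 1 + U y =
      (3 * vnorm y ^+ 2 + 2 * M1 + M2 + sigma ^+ 2) / sigma ^+ 2.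
    by rewrite /U /V; field; rewrite gt_eqF.
  by rewrite ler_pdivrMr.
have mpm := measurable_conv_gauss_dens s0 mu.
have mq := measurable_conv_gauss_dens s0 nu.
have mp' : measurable_fun setT p' by exact: measurable_conv_empirical.
apply: (@KL_dens_dist _ _ _ lam p' q pm q (fun y => w y * pm y) (fun y => w y * `|p' y - pm y|)) => //.
- exact: measurable_funM.
- by apply: measurable_funM => //; apply: measurableT_comp => //; exact: measurable_funB.
- move=> y; rewrite kl_integrandE// normrM (gtr0_norm (pm0 y)) mulrC ler_wpM2r ?(ltW (pm0 y))//.
  by apply: (le_trans (lnpq y)); have := UVw y; have := U0 y; lra.
- move=> y; rewrite [leRHS]mulrC.
  apply: (@le_trans _ _ (`|p' y - pm y| * (U y + V y + 1 + U y))).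
    apply: kl_integrand_diffl => //.
    by have [h1 h2] := lnpm y; have := lnp' y; lra.
  by rewrite ler_wpM2l.
Qed.

Lemma KL_one_sample d (lam : {measure set (d.-tuple R) -> \bar R}) (sigma p L : R)
    n (z : R) (mu nu : probability (d.-tuple R) R)
    dO (Omega : measurableType dO) (P : probability Omega R) (X : 'I_n -> Omega -> d.-tuple R) :
  (0 < d)%N -> is_lebesgue_Rd lam -> 0 < sigma -> sigma <= 1 -> 2 <= p -> 1 <= L ->
  (0 < n)%N -> 0 <= z -> SG L nu -> (psi_norm p mu <= L%:E)%E -> iid P X mu ->
  let D := L ^+ 2 * d%:R / sigma ^+ 2 in
  exists A, [/\ measurable A, (P A <= (expR (- (n%:R * Num.min (z ^+ 2) z)))%:E)%E &
    forall om, ~ A om ->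
      (`| KL_gauss lam sigma (empirical (X ^~ om)) nu - KL_gauss lam sigma mu nu | <
       (10 ^+ d * (Num.sqrt L / Num.sqrt sigma) ^+ d * (2 * e * (75 + tail_const) * D) / Num.sqrt n%:R
         + (16 * exp_moment_const * expR (exp_moment_const - 1) + 2) * (48 * D) * z)%:E)%E].
Proof.
move=> d1 Hlam s0 s1 p2 L1 n0 z0 SGnu psimu iidX D.
have e2 : 2 <= e := @e_ge2 R.
have L0 : 0 < L by lra.
have dR : (1 : R) <= d%:R by rewrite ler1n.
have C10 : 99 / 2 <= tail_const by rewrite /tail_const; lra.
have L2 : 1 <= L ^+ 2 by rewrite expr_ge1//; lra.
have Ld : 1 <= L ^+ 2 * d%:R by rewrite -[leLHS]mulr1 ler_pM.
have LLd : L ^+ 2 <= L ^+ 2 * d%:R by rewrite ler_peMr// sqr_ge0.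
have s20 : 0 < sigma ^+ 2 by rewrite exprn_gt0.
have s21 : sigma ^+ 2 <= 1 by rewrite exprn_ile1// ltW.
have is2 : 1 <= (sigma ^+ 2)^-1 by rewrite invf_ge1.
have D1 : 1 <= D by rewrite /D -[leLHS]mulr1 ler_pM.
have dD : d%:R <= D.
  rewrite /D mulrAC -[leLHS]mul1r ler_wpM2r//.
  by rewrite -[leLHS]mulr1 ler_pM.
have expM := psi_norm_exp_moment L0 p2 psimu.
have Mmu := second_moment_of_exp L0 expM; have Mnu := SG_second_moment L1 d1 SGnu.
rewrite -/e in expM Mmu Mnu.
pose w (y : d.-tuple R) := (3 * vnorm y ^+ 2 + tail_const * (L ^+ 2 * d%:R)) / sigma ^+ 2.
have w0 y : 0 <= w y.
  by rewrite divr_ge0 ?sqr_ge0// addr_ge0// mulr_ge0 ?sqr_ge0//; lra.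
have mw : measurable_fun setT w.
  apply: measurable_funM => //; apply: measurable_funD => //; apply: measurable_funM => //.
  exact: measurable_vnorm2.
(* With t = |y - x|^2 / (4 d sigma^2), the part of [w] growing with |y - x| is at most 24 d t <= 24
   D t, and [a + 24 D t <= (a + 24 D) e^t], where [a] collects the rest. The final 2 is the tilted
   Gaussian mass. *)
pose Nb (x : d.-tuple R) := ((6 * vnorm x ^+ 2 + tail_const * (L ^+ 2 * d%:R)) / sigma ^+ 2 + 24 * D) * 2.
have Nb0 x : 0 <= (6 * vnorm x ^+ 2 + tail_const * (L ^+ 2 * d%:R)) / sigma ^+ 2 + 24 * D.
  rewrite addr_ge0//; last by lra.
  by rewrite divr_ge0 ?sqr_ge0// addr_ge0// mulr_ge0 ?sqr_ge0//; lra.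
(* With t = |y|^2 / (25 L^2), 3 |y|^2 = 75 L^2 t, so that w(y) <= E (1 + t) <= E e^t. *)
pose E := (75 + tail_const) * D.
have E0 : 0 <= E by rewrite mulr_ge0//; lra.
pose Hb (x : d.-tuple R) := E ^+ 2 * expR (vnorm x ^+ 2 / (4 * L ^+ 2)) * sigma ^- d.
have mexp : measurable_fun setT (fun x : d.-tuple R => expR (vnorm x ^+ 2 / (4 * L ^+ 2))).
  by apply: measurableT_comp => //; apply: measurable_funM => //; exact: measurable_vnorm2.
have mNb : measurable_fun setT Nb.
  apply: measurable_funM => //; apply: measurable_funD => //; apply: measurable_funM => //.
  apply: measurable_funD => //; apply: measurable_funM => //; exact: measurable_vnorm2.
have mHb : measurable_fun setT Hb by apply: measurable_funM => //; exact: measurable_funM.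
have K0 : 0 < 48 * D by lra.
have B0 : 0 < 2 * e * (75 + tail_const) * D.
  by rewrite mulr_gt0//; [rewrite mulr_gt0//; lra|lra].
have wN x : (\int[lam]_y (w y * gauss_dens sigma (vsub y x))%:E <= (Nb x)%:E)%E.
  apply: integral_weight_gauss_le => // y.
  set tl := _ / (4 * _ * _).
  have tl0 : 0 <= tl by rewrite divr_ge0 ?sqr_ge0// mulr_ge0 ?sqr_ge0// mulr_ge0.
  have tl1 : 1 + tl <= expR tl := expR_ge1Dx tl.
  have uE : vnorm (vsub y x) ^+ 2 / sigma ^+ 2 = 4 * d%:R * tl.
    by rewrite /tl; field; rewrite !gt_eqF//; lra.
  apply: (@le_trans _ _ ((6 * vnorm x ^+ 2 + tail_const * (L ^+ 2 * d%:R)) / sigma ^+ 2 + 24 * (d%:R * tl))).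
    have -> : 24 * (d%:R * tl) = 6 * vnorm (vsub y x) ^+ 2 / sigma ^+ 2.
      by rewrite -[RHS]mulrA uE; ring.
    rewrite -mulrDl ler_pM2r ?invr_gt0//; have := vnorm_sqr_le y x; lra.
  have : d%:R * tl <= D * tl by rewrite ler_wpM2r.
  set a := (6 * _ + _) / _.
  have a0 : 0 <= a.
    by rewrite divr_ge0 ?sqr_ge0// addr_ge0// mulr_ge0 ?sqr_ge0//; lra.
  have : (a + 24 * D) * (1 + tl) <= (a + 24 * D) * expR tl by rewrite ler_wpM2l//; lra.
  have : 0 <= a * tl by rewrite mulr_ge0.
  lra.
have expN : (\int[mu]_x (expR (Nb x / (48 * D)))%:E <= exp_moment_const%:E)%E.
  pose a := (2 * tail_const + 48) / 48.
  apply: (@le_trans _ _ (\int[mu]_x ((expR a)%:E * (expR (vnorm x ^+ 2 / (4 * L ^+ 2)))%:E))%E).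
    apply: ge0_le_integral => //.
    - by apply/measurable_EFinP; apply: measurableT_comp => //; exact: measurable_funM.
    - by apply: measurable_funeM; exact/measurable_EFinP.
    - move=> x _; rewrite -EFinM lee_fin -expRD ler_expR.
      have -> : Nb x / (48 * D) = a + vnorm x ^+ 2 / (4 * L ^+ 2) / d%:R.
        by rewrite /Nb /a /D; field; rewrite !gt_eqF//; lra.
      rewrite lerD2l ler_pdivrMr; last lra.
      by rewrite ler_peMr// divr_ge0 ?sqr_ge0// mulr_ge0// sqr_ge0.
  rewrite ge0_integralZl//; last by exact/measurable_EFinP.
  by rewrite /exp_moment_const EFinM lee_wpmul2l// lee_fin expR_ge0.
have wH x : (\int[lam]_y (w y ^+ 2 * gauss_dens sigma (vsub y x) ^+ 2 *
    expR (vnorm y ^+ 2 / (25 * L ^+ 2)))%:E <= (Hb x)%:E)%E.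
  apply: integral_weight_gauss_sq_le => //.
    by rewrite mulr_ge0 ?sqr_ge0 ?expR_ge0.
  move=> y; set t := _ / (25 * _).
  have t0 : 0 <= t by rewrite divr_ge0 ?sqr_ge0// mulr_ge0// sqr_ge0.
  have t1 : 1 + t <= expR t := expR_ge1Dx t.
  have wt : w y <= E * expR t.
    have -> : w y = (75 * L ^+ 2 * t + tail_const * (L ^+ 2 * d%:R)) / sigma ^+ 2.
      by rewrite /w /t; congr ((_ + _) / _); field; rewrite gt_eqF.
    rewrite /E /D (_ : _ * expR t = ((75 + tail_const) * (L ^+ 2 * d%:R) * expR t) / sigma ^+ 2); last by ring.
    rewrite ler_pM2r ?invr_gt0//.
    have : L ^+ 2 * t <= L ^+ 2 * d%:R * t by rewrite ler_wpM2r.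
    have C1p : 0 <= tail_const by lra.
    have : (75 + tail_const) * (L ^+ 2 * d%:R) * (1 + t) <= (75 + tail_const) * (L ^+ 2 * d%:R) * expR t.
      by rewrite ler_wpM2l// mulr_ge0//; lra.
    have : 0 <= tail_const * (L ^+ 2 * d%:R) * t.
      by apply: mulr_ge0 t0; apply: mulr_ge0 C1p _; apply: le_trans Ld.
    lra.
  (* The exponent becomes 3 t, at most 6/25 (|x|^2 + |y - x|^2) / L^2. The width 25 is large enough
     for 6/25 <= 1/4, the exponent available in the moment of [mu]; the other half fits in 3/4
     because sigma <= 1 <= L. *)
  apply: (@le_trans _ _ ((E * expR t) ^+ 2 * expR t)).
    by rewrite ler_wpM2r ?expR_ge0// lerXn2r ?nnegrE// mulr_ge0 ?expR_ge0.
  rewrite exprMn -mulrA -(mulrA (E ^+ 2)) ler_wpM2l ?sqr_ge0// -expRM_natl -!expRD ler_expR.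
  have h1 : t * 25 * L ^+ 2 = vnorm y ^+ 2 by rewrite /t; field; rewrite gt_eqF.
  have -> : 2 * t + t = 3 * vnorm y ^+ 2 / (25 * L ^+ 2) by rewrite -h1; field; rewrite gt_eqF.
  apply: (@le_trans _ _ (6 * vnorm x ^+ 2 / (25 * L ^+ 2) + 6 * vnorm (vsub y x) ^+ 2 / (25 * L ^+ 2))).
    rewrite -mulrDl ler_pM2r ?invr_gt0 ?mulr_gt0 ?exprn_gt0//.
    by have := vnorm_sqr_le y x; lra.
  have q0 : 0 <= vnorm x ^+ 2 / L ^+ 2 by rewrite divr_ge0 ?sqr_ge0.
  have q1 : 0 <= vnorm (vsub y x) ^+ 2 / sigma ^+ 2 by rewrite divr_ge0 ?sqr_ge0.
  apply: lerD.
    have -> : 6 * vnorm x ^+ 2 / (25 * L ^+ 2) = 6 / 25 * (vnorm x ^+ 2 / L ^+ 2).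
      by field; rewrite gt_eqF.
    have -> : vnorm x ^+ 2 / (4 * L ^+ 2) = 1 / 4 * (vnorm x ^+ 2 / L ^+ 2).
      by field; rewrite gt_eqF.
    lra.
  have -> : 3 * vnorm (vsub y x) ^+ 2 / (4 * sigma ^+ 2) = 3 / 4 * (vnorm (vsub y x) ^+ 2 / sigma ^+ 2).
    by field; rewrite gt_eqF.
  have -> : 6 * vnorm (vsub y x) ^+ 2 / (25 * L ^+ 2) = 6 / 25 * (vnorm (vsub y x) ^+ 2 / L ^+ 2).
    by field; rewrite gt_eqF.
  have : vnorm (vsub y x) ^+ 2 / L ^+ 2 <= vnorm (vsub y x) ^+ 2 / sigma ^+ 2.
    by rewrite ler_wpM2l ?sqr_ge0// lef_pV2 ?posrE ?exprn_gt0//; lra.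
  lra.
have HB : (\int[mu]_x (Hb x)%:E <= ((2 * e * (75 + tail_const) * D) ^+ 2 * sigma ^- d)%:E)%E.
  have sd0 : 0 <= sigma ^- d by rewrite invr_ge0 exprn_ge0// ltW.
  under eq_integral do rewrite /Hb mulrAC EFinM.
  rewrite ge0_integralZl//; last 2 first.
  - exact/measurable_EFinP.
  - by rewrite lee_fin mulr_ge0 ?sqr_ge0.
  apply: (@le_trans _ _ ((E ^+ 2 * sigma ^- d)%:E * (2 * e)%:E)%E).
    by apply: lee_wpmul2l => //; rewrite lee_fin mulr_ge0 ?sqr_ge0.
  rewrite -EFinM lee_fin mulrAC ler_wpM2r//.
  have -> : (2 * e * (75 + tail_const) * D) ^+ 2 = E ^+ 2 * (2 * e) ^+ 2 by rewrite /E; ring.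
  by rewrite ler_wpM2l ?sqr_ge0// expr2 ler_peMr//; lra.
have [wp [A [mA PA HA]]] := gaussian_deviation s0 Hlam mw w0 K0 L0 B0 mNb mHb wN expN wH HB n0 iidX z0.
exists A; split => // om nA; have [t tlt tE] := HA om nA.
apply: (@le_lt_trans _ _ t%:E); last by rewrite lte_fin.
have e0 : 0 <= e by lra.
apply: (KL_gauss_dist_le n0 s0 _ _ Mmu Mnu mw _ wp); last by rewrite tE.
- by apply: mulr_ge0; [apply: mulr_ge0|exact: sqr_ge0].
- by rewrite -mulrA; apply: mulr_ge0; [lra|exact: le_trans Ld].
- move=> y; rewrite /w divfK ?gt_eqF// /tail_const.
  have : e * L ^+ 2 <= e * (L ^+ 2 * d%:R) by rewrite ler_wpM2l.
  lra.
Qed.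

End one_sample.

(** * Laws supported in a ball *)

Section bounded_ratio.
Context {R : realType}.
Implicit Types a b m Lam p q : R.

(** Both logarithms lie in an interval of length ln Lam, and ln Lam <= Lam - 1 turns this into a
    multiple of the weight. *)
Let ln_ratio a b m Lam : 0 < m -> 1 <= Lam ->
  m <= a <= Lam * m -> m <= b <= Lam * m -> `|ln a - ln b| <= Lam - 1.
Proof.
move=> m0 L1 /andP[ma aL] /andP[mb bL].
have a0 := lt_le_trans m0 ma; have b0 := lt_le_trans m0 mb.
have L0 : 0 < Lam by lra.
have lnL : ln Lam <= Lam - 1 by exact: ln_le_sub1.
have bnd c : m <= c -> c <= Lam * m -> ln m <= ln c /\ ln c <= ln Lam + ln m.
  move=> mc cL; have c0 := lt_le_trans m0 mc; split; first by rewrite ler_ln ?posrE.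
  by rewrite -lnM ?posrE// ler_ln ?posrE// mulr_gt0.
have [h1 h2] := bnd _ ma aL; have [h3 h4] := bnd _ mb bL.
by rewrite ler_norml; apply/andP; split; lra.
Qed.

Lemma kl_integrand_ratio_le p q m Lam : 0 < m -> 1 <= Lam ->
  m <= p <= Lam * m -> m <= q <= Lam * m -> `|kl_integrand p q| <= Lam * p.
Proof.
move=> m0 L1 mp mq; have /andP[mp1 mp2] := mp; have /andP[mq1 mq2] := mq.
have p0 := lt_le_trans m0 mp1; have q0 := lt_le_trans m0 mq1.
rewrite kl_integrandE// normrM (gtr0_norm p0) mulrC ler_wpM2r ?(ltW p0)//.
by have := ln_ratio m0 L1 mp mq; lra.
Qed.

(** The second argument moves first, with p' fixed, then the first argument. *)
Lemma kl_integrand_ratio_dist p' q' p q m Lam : 0 < m -> 1 <= Lam ->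
  m <= p' <= Lam * m -> m <= q' <= Lam * m ->
  m <= p <= Lam * m -> m <= q <= Lam * m ->
  `|kl_integrand p' q' - kl_integrand p q| <= 2 * Lam * `|p' - p| + Lam * `|q' - q|.
Proof.
move=> m0 L1 mp' mq' mp mq.
have /andP[mp'1 mp'2] := mp'; have /andP[mp1 mp2] := mp.
have /andP[mq'1 mq'2] := mq'; have /andP[mq1 mq2] := mq.
have p'0 := lt_le_trans m0 mp'1; have p0 := lt_le_trans m0 mp1.
have q0 := lt_le_trans m0 mq1.
have hr := kl_integrand_diffr p'0 m0 mq1 mq'1 mp'2.
have hl : `|kl_integrand p' q - kl_integrand p q| <= `|p' - p| * (Lam - 1 + 1 + (Lam - 1)).
  apply: kl_integrand_diffl => //; [exact: ln_ratio mp mq|lra|].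
  by apply: le_trans (ler_norm _) _; exact: ln_ratio mp' mp.
have := ler_normD (kl_integrand p' q' - kl_integrand p' q) (kl_integrand p' q - kl_integrand p q).
rewrite addrA subrK; have := normr_ge0 (p' - p); lra.
Qed.

End bounded_ratio.

Section ball.
Context {R : realType} (d : nat) (sigma r : R).
Hypotheses (d1 : (0 < d)%N) (s0 : 0 < sigma) (s1 : sigma <= 1) (r0 : 0 <= r).
Notation T := (d.-tuple R).

Let s20 : 0 < sigma ^+ 2. Proof. by rewrite exprn_gt0. Qed.

(** The kernel at the largest possible distance |y| + r between [y] and a point of the ball. *)
Definition ball_floor (y : T) : R :=
  gauss_peak d sigma * expR (- ((vnorm y + r) ^+ 2 / (2 * sigma ^+ 2))).
(** (|y| + r)^2 - (|y| - r)^2 = 4 r |y| accounts for |y| >= r. The extra r^2 covers points [y]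
    inside the ball, where the distance may be zero. *)
Definition ball_ratio (y : T) : R := expR ((4 * r * vnorm y + r ^+ 2) / (2 * sigma ^+ 2)).

Lemma ball_floor_gt0 y : 0 < ball_floor y.
Proof. by rewrite mulr_gt0 ?gauss_peak_gt0// expR_gt0. Qed.

Lemma ball_ratio_ge1 y : 1 <= ball_ratio y.
Proof.
rewrite -expR0 ler_expR; apply: divr_ge0; last by rewrite mulr_ge0// ltW.
by apply: addr_ge0 (sqr_ge0 r); rewrite mulr_ge0 ?vnorm_ge0// mulr_ge0.
Qed.

Lemma measurable_ball_ratio : measurable_fun setT ball_ratio.
Proof.
apply: measurableT_comp => //; apply: measurable_funM => //; apply: measurable_funD => //.
by apply: measurable_funM => //; exact: measurable_vnorm.
Qed.

Lemma gauss_dens_ball x y : vnorm x <= r ->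
  ball_floor y <= gauss_dens sigma (vsub y x) <= ball_ratio y * ball_floor y.
Proof.
move=> xr; have xn := vnorm_ge0 x; have yn := vnorm_ge0 y.
have c0 : 0 <= gauss_peak d sigma by rewrite ltW// gauss_peak_gt0.
have un := vnorm_ge0 (vsub y x).
have h1 := vnorm_vsub_le y x; have h2 := vnorm_le_add y x.
rewrite gauss_densE /ball_floor /ball_ratio; apply/andP; split.
  rewrite ler_wpM2l// ler_expR lerN2 ler_pM2r ?invr_gt0 ?mulr_gt0//.
  by rewrite lerXn2r ?nnegrE//; lra.
rewrite [leRHS]mulrCA -expRD ler_wpM2l// ler_expR -!mulNr -mulrDl.
rewrite ler_pM2r ?invr_gt0 ?mulr_gt0//.
have [yr|yr] := leP r (vnorm y).
  have : (vnorm y - r) ^+ 2 <= vnorm (vsub y x) ^+ 2 by rewrite lerXn2r ?nnegrE//; lra.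
  by have := sqr_ge0 r; lra.
have : vnorm y * vnorm y <= r * vnorm y by rewrite ler_wpM2r// ltW.
have : 0 <= r * vnorm y by rewrite mulr_ge0.
by have := sqr_ge0 (vnorm (vsub y x)); lra.
Qed.

Lemma conv_gauss_dens_ball (mu : probability T R) y : supp_in_ball r mu ->
  ball_floor y <= conv_gauss_dens sigma mu y <= ball_ratio y * ball_floor y.
Proof.
move=> supp; apply/andP; split; last first.
  rewrite -lee_fin -conv_gauss_densE//; apply: integral_supp_in_ball_le supp _ _ _ _ => //.
  - by rewrite mulr_ge0 ?expR_ge0// ltW// ball_floor_gt0.
  - exact: measurable_gauss_dens_fst.
  - by move=> x; rewrite ltW// gauss_dens_gt0.
  - by move=> x xr; have /andP[] := gauss_dens_ball y xr.
rewrite -lee_fin -conv_gauss_densE//.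
rewrite -[leLHS]mule1 -[X in (_ * X <= _)%E](@probability_setT _ _ _ mu) -integral_cst//.
apply: ae_ge0_le_integral => //.
- by move=> x _; rewrite lee_fin ltW// ball_floor_gt0.
- by move=> x _; rewrite lee_fin ltW// gauss_dens_gt0.
- by apply/measurable_EFinP; exact: measurable_gauss_dens_fst.
exists [set x | r < vnorm x]; split => //.
  exact: measurable_outside_ball.
move=> x /= H; rewrite ltNge; apply/negP => xr; apply: H => _.
by rewrite lee_fin; have /andP[] := gauss_dens_ball y xr.
Qed.

Lemma iid_in_ball dO (Omega : measurableType dO) (P : probability Omega R) n
    (X : 'I_n -> Omega -> T) (mu : probability T R) : supp_in_ball r mu -> iid P X mu ->
  exists N, [/\ measurable N, P N = 0%E & forall om, ~ N om -> forall i, vnorm (X i om) <= r].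
Proof.
move=> supp [mX [lawX indX]].
pose F := ~` [set x : T | r < vnorm x].
have mF : measurable F by apply: measurableC; exact: measurable_outside_ball.
have muF : mu F = 1%E.
  rewrite probability_setC; last exact: measurable_outside_ball.
  by rewrite supp sube0.
have mI : measurable (\bigcap_(i in [set: 'I_n]) (X i @^-1` F)).
  apply: fin_bigcap_measurable => // i _; rewrite -[_ @^-1` _]setTI; exact: mX.
exists (~` \bigcap_(i in [set: 'I_n]) (X i @^-1` F)); split.
- exact: measurableC.
- rewrite probability_setC// indX// big1 ?subee// => i _.
  by rewrite lawX.
- move=> om /contrapT H i; have := H i I; rewrite /F /=.
  by move=> /negP; rewrite -leNgt.
Qed.

End ball.

Section two_samples.
Context {R : realType} (d : nat) (sigma r : R).
Hypotheses (d1 : (0 < d)%N) (s0 : 0 < sigma) (s1 : sigma <= 1) (r0 : 0 <= r).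
Variable (lam : {measure set (d.-tuple R) -> \bar R}).
Hypothesis Hlam : is_lebesgue_Rd lam.
Notation T := (d.-tuple R).

Let s20 : 0 < sigma ^+ 2. Proof. by rewrite exprn_gt0. Qed.
Let dR : (1 : R) <= d%:R. Proof. by rewrite ler1n. Qed.
Let d_neq0 : d%:R != 0 :> R. Proof. by rewrite pnatr_eq0 -lt0n. Qed.
Let mratio : measurable_fun setT (fun y : T => 3 * ball_ratio sigma r y).
Proof. by apply: measurable_funM => //; exact: measurable_ball_ratio. Qed.
Let ratio0 (y : T) : 0 <= 3 * ball_ratio sigma r y.
Proof. by rewrite mulr_ge0// expR_ge0. Qed.

(** The cross term is split by 4 r u <= 8 d r^2 + u^2 / (2 d), where u = |y - x|; the last term is
    exactly the tilt that costs a factor 2, and hence the dimension enters the exponent. *)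
Let weight_mean x (y : T) : 3 * ball_ratio sigma r y <=
  3 * expR ((4 * r * vnorm x + r ^+ 2 + 8 * d%:R * r ^+ 2) / (2 * sigma ^+ 2)) *
  expR (vnorm (vsub y x) ^+ 2 / (4 * d%:R * sigma ^+ 2)).
Proof.
rewrite -mulrA ler_wpM2l// -expRD ler_expR.
have -> : vnorm (vsub y x) ^+ 2 / (4 * d%:R * sigma ^+ 2) =
    vnorm (vsub y x) ^+ 2 / (2 * d%:R) / (2 * sigma ^+ 2).
  by field; rewrite d_neq0 gt_eqF.
rewrite -mulrDl ler_pM2r ?invr_gt0 ?mulr_gt0//.
have : 4 * r * vnorm y <= 4 * r * (vnorm x + vnorm (vsub y x)).
  by rewrite ler_wpM2l ?mulr_ge0// vnorm_le_add.
have : 4 * r * vnorm (vsub y x) <= 8 * d%:R * r ^+ 2 + vnorm (vsub y x) ^+ 2 / (2 * d%:R).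
  have -> : 8 * d%:R * r ^+ 2 + vnorm (vsub y x) ^+ 2 / (2 * d%:R) =
      4 * r * vnorm (vsub y x) + (vnorm (vsub y x) - 4 * d%:R * r) ^+ 2 / (2 * d%:R).
    by field; exact: d_neq0.
  by rewrite lerDl divr_ge0 ?sqr_ge0// mulr_ge0.
lra.
Qed.

(** Here 4 r u <= 8 r^2 + u^2 / 2, and the auxiliary weight adds at most 2/25 u^2, which together
    stay below 3/4 u^2. *)
Let weight_square x (y : T) :
  (3 * ball_ratio sigma r y) ^+ 2 * expR (vnorm y ^+ 2 / (25 * (r + 1) ^+ 2)) <=
  9 * expR ((4 * r * vnorm x + 9 * r ^+ 2 + vnorm x ^+ 2) / sigma ^+ 2) *
  expR (3 * vnorm (vsub y x) ^+ 2 / (4 * sigma ^+ 2)).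
Proof.
rewrite exprMn -expRM_natl (_ : 3 ^+ 2 = 9); last by ring.
rewrite -[leLHS]mulrA -[leRHS]mulrA ler_wpM2l// -!expRD ler_expR.
have -> : 3 * vnorm (vsub y x) ^+ 2 / (4 * sigma ^+ 2) =
    3 / 4 * vnorm (vsub y x) ^+ 2 / sigma ^+ 2 by field; rewrite gt_eqF.
have -> : 2 * ((4 * r * vnorm y + r ^+ 2) / (2 * sigma ^+ 2)) =
    (4 * r * vnorm y + r ^+ 2) / sigma ^+ 2 by field; rewrite gt_eqF.
have hy : vnorm y ^+ 2 / (25 * (r + 1) ^+ 2) <= vnorm y ^+ 2 / 25 / sigma ^+ 2.
  have r1 : 0 < r + 1 by rewrite ltr_wpDl.
  rewrite -[leRHS]mulrA -invfM ler_wpM2l ?sqr_ge0// lef_pV2 ?posrE ?mulr_gt0 ?exprn_gt0//.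
  by rewrite ler_pM2l// lerXn2r ?nnegrE ?(ltW s0) ?(ltW r1)// (le_trans s1)// lerDr.
apply: (@le_trans _ _ ((4 * r * vnorm y + r ^+ 2) / sigma ^+ 2 + vnorm y ^+ 2 / 25 / sigma ^+ 2)).
  by rewrite lerD2l.
rewrite -!mulrDl ler_pM2r ?invr_gt0//.
have : 4 * r * vnorm y <= 4 * r * (vnorm x + vnorm (vsub y x)).
  by rewrite ler_wpM2l ?mulr_ge0// vnorm_le_add.
have := sqr_ge0 (vnorm (vsub y x) - 4 * r); have := vnorm_sqr_le y x.
have := sqr_ge0 (vnorm (vsub y x)); have := sqr_ge0 (vnorm x).
have -> : (vnorm (vsub y x) - 4 * r) ^+ 2 =
  vnorm (vsub y x) ^+ 2 - 8 * r * vnorm (vsub y x) + 16 * r ^+ 2 by ring.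
lra.
Qed.

Let xi := expR ((r ^+ 2 + 4 * r) * (2 * d%:R * r ^+ 2 + (8 * d%:R + 1) * r + 1) / (2 * sigma ^+ 2)).

(** (32 d + 5) r^2 is the quadratic term of the expanded numerator in [xi]; its other terms are
    nonnegative. *)
Let xi_ge (a : R) : a <= (32 * d%:R + 5) * r ^+ 2 -> expR (a / (2 * sigma ^+ 2)) <= xi.
Proof.
move=> ar; rewrite ler_expR ler_pM2r ?invr_gt0 ?mulr_gt0//.
apply: (le_trans ar).
have -> : (r ^+ 2 + 4 * r) * (2 * d%:R * r ^+ 2 + (8 * d%:R + 1) * r + 1) =
  (32 * d%:R + 5) * r ^+ 2 + (2 * d%:R * r ^+ 4 + (16 * d%:R + 1) * r ^+ 3 + 4 * r) by ring.
rewrite lerDl !addr_ge0// ?mulr_ge0 ?exprn_ge0 ?addr_ge0 ?mulr_ge0//.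
Qed.

Lemma ball_deviation (mu : probability T R) n dO (Omega : measurableType dO)
    (P : probability Omega R) (X : 'I_n -> Omega -> T) (z : R) :
  (0 < n)%N -> supp_in_ball r mu -> iid P X mu -> 0 <= z ->
  (\int[lam]_y (3 * ball_ratio sigma r y * conv_gauss_dens sigma mu y)%:E < +oo)%E /\
  exists A, [/\ measurable A, (P A <= (expR (- (n%:R * Num.min (z ^+ 2) z)))%:E)%E &
    forall om, ~ A om ->
    exists2 t, t < 10 ^+ d * (Num.sqrt (r + 1) / Num.sqrt sigma) ^+ d * (3 * xi) / Num.sqrt n%:R
                   + (16 * expR 6 * expR (expR 6 - 1) + 2) * xi * z &
      (\int[lam]_y (3 * ball_ratio sigma r y *
          `|conv_gauss_dens sigma (empirical (X ^~ om)) y - conv_gauss_dens sigma mu y|)%:E = t%:E)%E].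
Proof.
move=> n0 supp iidX z0.
pose Nb (x : T) :=
  3 * expR ((4 * r * vnorm x + r ^+ 2 + 8 * d%:R * r ^+ 2) / (2 * sigma ^+ 2)) * 2.
pose Hb (x : T) :=
  9 * expR ((4 * r * vnorm x + 9 * r ^+ 2 + vnorm x ^+ 2) / sigma ^+ 2) * sigma ^- d.
have xi0 : 0 < xi := expR_gt0 _.
have sd0 : 0 <= sigma ^- d by rewrite invr_ge0 exprn_ge0// ltW.
have mlin : measurable_fun setT (fun x : T => 4 * r * vnorm x).
  by apply: measurable_funM => //; exact: measurable_vnorm.
have mNb : measurable_fun setT Nb.
  apply: measurable_funM => //; apply: measurable_funM => //; apply: measurableT_comp => //.
  apply: measurable_funM => //; apply: measurable_funD => //; exact: measurable_funD.
have mHb : measurable_fun setT Hb.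
  apply: measurable_funM => //; apply: measurable_funM => //; apply: measurableT_comp => //.
  apply: measurable_funM => //; apply: measurable_funD; last exact: measurable_vnorm2.
  exact: measurable_funD.
have r_vnorm (x : T) : vnorm x <= r -> r * vnorm x <= r ^+ 2.
  by move=> xr; rewrite expr2 ler_wpM2l.
have r2 : 0 <= r ^+ 2 := sqr_ge0 r.
have dr2 : r ^+ 2 <= d%:R * r ^+ 2 by rewrite ler_peMl// sqr_ge0.
(* On the ball Nb <= 6 xi and Hb <= 9 xi^2 sigma^(-d), hence K = xi with c0 = e^6, and B = 3 xi. The
   width r + 1 is at least sigma even for r = 0. *)
have := @gaussian_deviation R d sigma s0 lam Hlam mu (fun y => 3 * ball_ratio sigma r y)
  Nb Hb (r + 1) (3 * xi) xi (expR 6) mratio ratio0 xi0.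
apply => //; first by rewrite ltr_wpDl.
- by rewrite mulr_gt0.
- by move=> x; apply: integral_weight_gauss_le.
- apply: (integral_supp_in_ball_le supp); rewrite ?expR_ge0//.
    by apply: measurableT_comp => //; exact: measurable_funM.
  move=> x xr; rewrite ler_expR ler_pdivrMr// /Nb mulrAC (_ : 3 * 2 = 6); last by ring.
  by rewrite ler_pM2l//; apply: xi_ge; have := r_vnorm x xr; lra.
- move=> x; apply: integral_weight_gauss_sq_le => //.
- apply: (integral_supp_in_ball_le supp) => //.
  + by rewrite mulr_ge0// sqr_ge0.
  + by move=> x; rewrite !mulr_ge0// expR_ge0.
  move=> x xr; rewrite /Hb ler_wpM2r// exprMn (_ : 3 ^+ 2 = 9); last by ring.
  rewrite ler_pM2l//.
  have xr2 : vnorm x ^+ 2 <= r ^+ 2 by rewrite lerXn2r ?nnegrE ?vnorm_ge0.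
  set a := _ + vnorm x ^+ 2.
  have -> : expR (a / sigma ^+ 2) = expR (a / (2 * sigma ^+ 2)) ^+ 2.
    by rewrite -expRM_natl; congr expR; field; rewrite gt_eqF.
  rewrite lerXn2r ?nnegrE ?expR_ge0//; apply: xi_ge.
  by have := r_vnorm x xr; rewrite /a; lra.
Qed.

Lemma KL_two_sample (mu nu : probability T R) n dO (Omega : measurableType dO)
    (P : probability Omega R) (X Y : 'I_n -> Omega -> T) (z : R) :
  (0 < n)%N -> 0 <= z -> supp_in_ball r mu -> supp_in_ball r nu ->
  iid P X mu -> iid P Y nu ->
  exists A, [/\ measurable A, (P A <= (2 * expR (- (n%:R * Num.min (z ^+ 2) z)))%:E)%E &
    forall om, ~ A om ->
      (`| KL_gauss lam sigma (empirical (X ^~ om)) (empirical (Y ^~ om))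
          - KL_gauss lam sigma mu nu | <
       (2 * (10 ^+ d * (Num.sqrt (r + 1) / Num.sqrt sigma) ^+ d * (3 * xi) / Num.sqrt n%:R
         + (16 * expR 6 * expR (expR 6 - 1) + 2) * xi * z))%:E)%E].
Proof.
move=> n0 z0 supmu supnu iidX iidY.
have [wp [A [mA PA HA]]] := ball_deviation n0 supmu iidX z0.
have [_ [B [mB PB HB]]] := ball_deviation n0 supnu iidY z0.
have [NX [mNX PNX HNX]] := iid_in_ball supmu iidX.
have [NY [mNY PNY HNY]] := iid_in_ball supnu iidY.
set b := expR (- (n%:R * _)) in PA PB *.
(* The null sets discard samples leaving the ball, so only the two deviation events are paid for. *)
exists ((A `|` B) `|` (NX `|` NY)); split.
- by apply: measurableU; exact: measurableU.
- have subadd S1 S2 c1 c2 : measurable S1 -> measurable S2 ->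
      (P S1 <= c1 -> P S2 <= c2 -> P (S1 `|` S2) <= c1 + c2)%E.
    by move=> m1 m2 h1 h2; apply: le_trans (measureU2 _ _ _) _ => //; exact: leeD.
  have -> : ((2 * b)%:E = (b%:E + b%:E) + (0 + 0))%E by rewrite !adde0 mulr_natl mulr2n EFinD.
  apply: (subadd); [exact: measurableU|exact: measurableU|exact: (subadd)|].
  by apply: subadd; rewrite ?PNX ?PNY.
move=> om nAB.
have [t tlt tE] := HA om (fun h => nAB (or_introl (or_introl h))).
have [u ult uE] := HB om (fun h => nAB (or_introl (or_intror h))).
have ballX := HNX om (fun h => nAB (or_intror (or_introl h))).
have ballY := HNY om (fun h => nAB (or_intror (or_intror h))).
apply: (@le_lt_trans _ _ (t + u)%:E); last by rewrite lte_fin; lra.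
pose w (y : T) := 3 * ball_ratio sigma r y.
pose p' := conv_gauss_dens sigma (empirical (X ^~ om)).
pose q' := conv_gauss_dens sigma (empirical (Y ^~ om)).
pose p := conv_gauss_dens sigma mu; pose q := conv_gauss_dens sigma nu.
have m0 (y : T) : 0 < ball_floor sigma r y by exact: ball_floor_gt0.
have L1 (y : T) : 1 <= ball_ratio sigma r y by exact: ball_ratio_ge1.
have bp' y : ball_floor sigma r y <= p' y <= ball_ratio sigma r y * ball_floor sigma r y.
  by apply: conv_empirical_bounds => // i; exact: gauss_dens_ball.
have bq' y : ball_floor sigma r y <= q' y <= ball_ratio sigma r y * ball_floor sigma r y.
  by apply: conv_empirical_bounds => // i; exact: gauss_dens_ball.
have bp y : ball_floor sigma r y <= p y <= ball_ratio sigma r y * ball_floor sigma r y.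
  exact: conv_gauss_dens_ball.
have bq y : ball_floor sigma r y <= q y <= ball_ratio sigma r y * ball_floor sigma r y.
  exact: conv_gauss_dens_ball.
have pos (f : T -> R) y : ball_floor sigma r y <= f y <= ball_ratio sigma r y * ball_floor sigma r y ->
    0 < f y by move=> /andP[h _]; exact: lt_le_trans h.
have mp : measurable_fun setT p := measurable_conv_gauss_dens s0 mu.
have mq : measurable_fun setT q := measurable_conv_gauss_dens s0 nu.
have mp' : measurable_fun setT p' by exact: measurable_conv_empirical.
have mq' : measurable_fun setT q' by exact: measurable_conv_empirical.
have mdist (f g : T -> R) : measurable_fun setT f -> measurable_fun setT g ->
    measurable_fun setT (fun y => w y * `|f y - g y|).
  move=> mf mg; apply: measurable_funM => //.
  by apply: measurableT_comp => //; exact: measurable_funB.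
apply: (@KL_dens_dist _ _ _ lam p' q' p q (fun y => w y * p y)
  (fun y => w y * `|p' y - p y| + w y * `|q' y - q y|)) => //.
- by move=> y; exact: pos.
- by move=> y; exact: pos.
- by move=> y; exact: pos.
- by move=> y; exact: pos.
- exact: measurable_funM.
- by apply: measurable_funD; exact: mdist.
- move=> y; apply: le_trans (kl_integrand_ratio_le (m0 y) (L1 y) (bp y) (bq y)) _.
  rewrite ler_wpM2r//; first by rewrite ltW// pos.
  by rewrite /w; have := L1 y; lra.
- move=> y; apply: le_trans (kl_integrand_ratio_dist (m0 y) (L1 y) (bp' y) (bq' y) (bp y) (bq y)) _.
  by apply: lerD; rewrite ler_wpM2r// /w; have := L1 y; lra.
under eq_integral do rewrite EFinD.
rewrite ge0_integralD//; last 4 first.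
- by move=> y _; rewrite lee_fin mulr_ge0// ratio0.
- by apply/measurable_EFinP; exact: mdist.
- by move=> y _; rewrite lee_fin mulr_ge0// ratio0.
- by apply/measurable_EFinP; exact: mdist.
by rewrite EFinD tE uE.
Qed.

End two_samples.

(** * Comparison of the constants *)

Section rate_comparison.
Context {R : realType}.
Implicit Types a b q z : R.

Lemma affine_rate_le (Ka Kb D a q c z : R) (D' a' q' : R) : 0 <= z -> 0 <= Ka -> 0 <= Kb ->
  Ka <= c -> Kb <= c -> 0 <= D -> D <= D' -> 0 <= a -> a <= a' -> 0 <= q -> q <= q' ->
  a * (Ka * D) * q + Kb * D * z <= c * D' * (a' * q' + z).
Proof.
move=> z0 Ka0 Kb0 Kac Kbc D0 DD a0 aa q0 qq.
rewrite mulrDr; apply: lerD.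
  rewrite (_ : _ * q = Ka * D * (a * q)); last by ring.
  by apply: ler_pM; rewrite ?mulr_ge0//; exact: ler_pM.
by rewrite ler_wpM2r//; exact: ler_pM.
Qed.

Lemma sample_min_le (n : nat) z : n%:R * Num.min (z ^+ 2) z = Num.min (n%:R * z ^+ 2) (n%:R * z).
Proof. by rewrite minr_pMr. Qed.

(** A minimum lies below its first two terms, and there the exponents of [n] are at most 1 while n
    >= 1. *)
Lemma zeta_le (n d : nat) (z tau c : R) : (0 < n)%N -> 0 <= z -> 0 <= tau ->
  Num.min (Num.min (n%:R `^ ((d%:R + 12 - 8 * tau) / (d%:R + 12)) * z ^+ 2)
                   (n%:R `^ ((d%:R + 12 - 4 * tau) / (d%:R + 12)) * z)) c <=
  n%:R * Num.min (z ^+ 2) z.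
Proof.
move=> n0 z0 t0; rewrite sample_min_le ge_min; apply/orP; left.
have dn : 0 < d%:R + 12 :> R by rewrite ltr_wpDl.
have powle (b : R) : 0 <= b -> n%:R `^ ((d%:R + 12 - b * tau) / (d%:R + 12)) <= n%:R :> R.
  move=> b0; rewrite -[leRHS]powRr1// ler_powR ?ler1n// ler_pdivrMr// mul1r gerBl.
  by rewrite mulr_ge0.
by rewrite le_min !ge_min !ler_wpM2r ?sqr_ge0 ?powle ?orbT.
Qed.

(** A strict bound off the measurable set [A] forces the event into [A], so the event itself is
    never shown measurable. *)
Lemma prob_le_of_lt dO (Omega : measurableType dO) (P : probability Omega R)
    (f : Omega -> \bar R) (a a' b b' : R) :
  (exists A, [/\ measurable A, (P A <= b%:E)%E & forall om, ~ A om -> (f om < a%:E)%E]) ->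
  a <= a' -> b <= b' -> prob_le P [set om | (a'%:E <= f om)%E] b'.
Proof.
move=> [A [mA PA fA]] aa bb; exists A; split => //; split; last first.
  by apply: le_trans PA _; rewrite lee_fin.
move=> om /= fom; apply: contrapT => nA.
have aaE : (a%:E <= a'%:E)%E by rewrite lee_fin.
by have := lt_le_trans (fA om nA) (le_trans aaE fom); rewrite ltxx.
Qed.

End rate_comparison.

Unset Implicit Arguments. Set Strict Implicit. Set Printing Implicit Defensive.

Theorem theorem1 (R : realType) :
  exists C : R, 0 < C /\
  forall (d : nat) (lam : {measure set (d.-tuple R) -> \bar R})
         (sigma r p L tau : R),
    (1 <= d)%N -> is_lebesgue_Rd lam ->
    0 < sigma -> sigma <= 1 -> 0 <= r -> 2 <= p -> 1 <= L -> 0 <= tau -> tau <= 1 ->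
  forall (n : nat) (z : R), (1 <= n)%N -> 0 <= z ->
  (* (i) *)
  (forall (mu nu : probability (d.-tuple R) R),
     supp_in_ball r mu -> supp_in_ball r nu ->
   forall (dO : measure_display) (Omega : measurableType dO)
          (P : probability Omega R) (X Y : 'I_n -> Omega -> d.-tuple R),
     iid P X mu -> iid P Y nu ->
     let xi := expR ((r ^+ 2 + 4 * r) * (2 * d%:R * r ^+ 2 + (8 * d%:R + 1) * r + 1)
                     / (2 * sigma ^+ 2)) in
     let xit := (3 * expR 1 * d%:R) ^+ (3 * (d + 2)) * (r + 1) `^ (d%:R / 2 + 1)
                * sigma `^ (- (d%:R / 2)) in
     prob_le P
       [set w | ((C * xi * (xit * n%:R `^ (- (1 / 2)) + z))%:E <=
                 `| KL_gauss lam sigma (empirical (X ^~ w)) (empirical (Y ^~ w))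
                    - KL_gauss lam sigma mu nu |)%E]
       (2 * expR (- Num.min (n%:R * z ^+ 2) (n%:R * z))))
  /\
  (* (ii) *)
  (forall (mu nu : probability (d.-tuple R) R),
     SG L mu -> SG L nu -> (psi_norm p mu <= L%:E)%E ->
   forall (dO : measure_display) (Omega : measurableType dO)
          (P : probability Omega R) (X : 'I_n -> Omega -> d.-tuple R),
     iid P X mu ->
     let xih := (3 * expR 1 * d%:R) ^+ (3 * (d + 2)) * (4 * L) `^ (d%:R / 2 + 2)
                * sigma `^ (- (d%:R / 2)) in
     let xic := L ^+ 4 * d%:R ^+ 3 * sigma ^- 4 in
     let zeta := Num.min (Num.min
                   (n%:R `^ ((d%:R + 12 - 8 * tau) / (d%:R + 12)) * z ^+ 2)
                   (n%:R `^ ((d%:R + 12 - 4 * tau) / (d%:R + 12)) * z))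
                   (n%:R `^ (p * tau / (d%:R + 12)) / ln (n%:R + 1)) in
     prob_le P
       [set w | ((C * xic * (xih * n%:R `^ (- ((1 - tau) / 2)) + z))%:E <=
                 `| KL_gauss lam sigma (empirical (X ^~ w)) nu
                    - KL_gauss lam sigma mu nu |)%E]
       (3 * expR (- zeta))).
Proof.
have e2 : 2 <= expR 1 :> R := e_ge2.
pose c2 : R := exp_moment_const; pose c1 : R := tail_const.
have c10 : 0 <= c1 by rewrite /c1 /tail_const; lra.
have c20 : 0 <= c2 by rewrite /c2 /exp_moment_const mulr_ge0 ?expR_ge0// mulr_ge0 ?expR_ge0.
(* [Ka] and [Kb] are the mean and deviation factors for one sample, and [Kc] is the deviation factor
   for two samples, whose mean factor is 6 = 2 * 3. Their sum serves both parts. *)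
pose Ka : R := 2 * expR 1 * (75 + c1).
pose Kb : R := (16 * c2 * expR (c2 - 1) + 2) * 48.
pose Kc : R := 2 * (16 * expR 6 * expR (expR 6 - 1) + 2).
have Ka0 : 0 <= Ka by rewrite /Ka; apply: mulr_ge0; lra.
have Kb0 : 0 <= Kb.
  by rewrite mulr_ge0// addr_ge0// mulr_ge0 ?expR_ge0// mulr_ge0.
have Kc0 : 0 <= Kc.
  by rewrite mulr_ge0// addr_ge0// mulr_ge0 ?expR_ge0// mulr_ge0 ?expR_ge0.
exists (Ka + Kb + Kc + 6); split; first lra.
move=> d lam sigma r p L tau d1 Hlam s0 s1 r0 p2 L1 t0 t1 n z n1 z0.
have s20 : 0 < sigma ^+ 2 by rewrite exprn_gt0.
have rate0 l : 0 <= 10 ^+ d * (Num.sqrt l / Num.sqrt sigma) ^+ d :> R.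
  by rewrite mulr_ge0 ?exprn_ge0// divr_ge0 ?sqrtr_ge0.
have sn0 : 0 <= (Num.sqrt n%:R)^-1 :> R by rewrite invr_ge0 sqrtr_ge0.
split.
  move=> mu nu supmu supnu dO Omega P X Y iidX iidY xi xit.
  apply: prob_le_of_lt (KL_two_sample d1 s0 s1 r0 Hlam n1 z0 supmu supnu iidX iidY) _ _;
    last by rewrite sample_min_le.
  rewrite -/xi.
  pose a := 10 ^+ d * (Num.sqrt (r + 1) / Num.sqrt sigma) ^+ d.
  apply: (@le_trans _ _ (a * (6 * xi) * (Num.sqrt n%:R)^-1 + Kc * xi * z)).
    by rewrite /Kc -/a le_eqVlt; apply/orP; left; apply/eqP; ring.
  apply: affine_rate_le => //; try lra.
  - exact: expR_ge0.
  - exact: rate0.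
  - by apply: dimension_rate => //; lra.
  - by have := @sample_rate R n 0 n1 (lexx 0); rewrite subr0.
move=> mu nu SGmu SGnu psimu dO Omega P X iidX xih xic zeta.
pose D := L ^+ 2 * d%:R / sigma ^+ 2.
(* The factor produced by the proof is L^2 d / sigma^2, which is smaller because L, d >= 1 and sigma
   <= 1. *)
have Dxic : D <= xic.
  have dR : (1 : R) <= d%:R by rewrite ler1n.
  rewrite /D /xic; apply: ler_pM => //.
  - by rewrite mulr_ge0// sqr_ge0.
  - by rewrite invr_ge0 ltW.
  - apply: ler_pM => //; first exact: sqr_ge0.
      exact: ler_weXn2l.
    by rewrite -[leLHS]expr1; exact: ler_weXn2l.
  - rewrite lef_pV2 ?posrE ?exprn_gt0//.
    by apply: ler_wiXn2l => //; exact: ltW.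
apply: prob_le_of_lt (KL_one_sample d1 Hlam s0 s1 p2 L1 n1 z0 SGnu psimu iidX) _ _.
  pose a := 10 ^+ d * (Num.sqrt L / Num.sqrt sigma) ^+ d.
  apply: (@le_trans _ _ (a * (Ka * D) * (Num.sqrt n%:R)^-1 + Kb * D * z)).
    by rewrite /Kb /Ka -/D -/c1 -/c2 -/a le_eqVlt; apply/orP; left; apply/eqP; ring.
  apply: affine_rate_le => //; try lra.
  - by rewrite divr_ge0 ?(ltW s20)// mulr_ge0// sqr_ge0.
  - exact: rate0.
  - by apply: dimension_rate => //; lra.
  - exact: sample_rate.
apply: (@le_trans _ _ (expR (- zeta))).
  by rewrite ler_expR lerN2; exact: zeta_le.
by have := expR_ge0 (- zeta); lra.
Qed.
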